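(* For every $\vartheta_0\in\mathbb{R}$, let $T_*=T_*(\vartheta_0,\alpha,c_\phi):=\sup_{\vartheta\le\vartheta_0}T(\vartheta)\in(0,+\infty]$. Then for every $k_0\in\mathcal{K}_{\vartheta_0}$ the Cauchy problem $$\frac{d}{dt}k_t=L^\Delta k_t,\qquad k_t|_{t=0}=k_0,$$ has a unique classical solution $k_t\in\mathcal{K}_{\vartheta(t)}$ on $[0,T_* )$.
   Context: Data. $a:\mathbb{R}^d\to[0,+\infty)$ and $\phi:\mathbb{R}^d\to[0,+\infty)$ are measurable, $a(x)=a(-x)$, $\phi(x)=\phi(-x)$, with $$0<\alpha:=\int_{\mathbb{R}^d}a(x)\,dx<\infty,\qquad c_\phi:=\int_{\mathbb{R}^d}\left(1-e^{-\phi(x)}\right)dx<\infty.$$ Finite configurations. $\Gamma_0=\bigsqcup_{n\ge 0}\Gamma^{(n)}$, where $\Gamma^{(0)}=\{\emptyset\}$ and $\Gamma^{(n)}=\{\eta\subset\mathbb{R}^d:|\eta|=n\}$, with the Borel $\sigma$-field of the disjoint union topology ($\Gamma^{(n)}$ is identified with the symmetrization of $\{(x_1,\dots,x_n):x_i\ne x_j,\ i\neq j\}$). A measurable $k:\Gamma_0\to\mathbb{R}$ is identified with a sequence of symmetric functions $k^{(n)}:(\mathbb{R}^d)^n\to\mathbb{R}$, $k(\{x_1,\dots,x_n\})=k^{(n)}(x_1,\dots,x_n)$, with $k^{(0)}$ constant. The Lebesgue-Poisson measure on $\Gamma_0$ is $\lambda=\delta_\emptyset+\sum_{n\ge1}\frac1{n!}m^{(n)}$,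 where $m^{(n)}$ is the restriction of $dx_1\cdots dx_n$ to $\Gamma^{(n)}$. Single points $x$ are also written for the configurations $\{x\}$. Operator. For $f:\mathbb{R}^d\to\mathbb{R}$, $e(f,\eta)=\prod_{x\in\eta}f(x)$, $e(f,\emptyset)=1$. Let $t_x(y)=e^{-\phi(x-y)}-1$, $\tau_x(y)=t_x(y)+1$. Then $$(L^\Delta k)(\eta)=\sum_{y\in\eta}\int_{\mathbb{R}^d}a(x-y)\,e(\tau_y,\eta\setminus y\cup x)\left(\int_{\Gamma_0}e(t_y,\xi)\,k(\xi\cup x\cup\eta\setminus y)\,\lambda(d\xi)\right)dx$$ $$\qquad-\int_{\Gamma_0}k(\xi\cup\eta)\left(\sum_{x\in\eta}\int_{\mathbb{R}^d}a(x-y)\,e(\tau_y,\eta)\,e(t_y,\xi)\,dy\right)\lambda(d\xi).$$ Spaces. For $\vartheta\in\mathbb{R}$, $\mathcal{K}_\vartheta$ is the Banach space of ($\lambda$-a.e. classes of) $k:\Gamma_0\to\mathbb{R}$ with $\|k\|_\vartheta=\sup_{n\ge0}e^{\vartheta n}\nu_n(k)<\infty$, where $\nu_0(k)=|k^{(0)}|$ and $\nu_n(k)=\|k^{(n)}\|_{L^\infty((\mathbb{R}^d)^n)}$. One has $\mathcal{K}_{\vartheta}\subset\mathcal{K}_{\vartheta'}$ for $\vartheta>\vartheta'$. In $\mathcal{K}_\vartheta$ the operator $L^\Delta$ has domain $\mathrm{Dom}(L^\Delta)=\{k\in\mathcal{K}_\vartheta:L^\Delta k\in\mathcal{K}_\vartheta\}$.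 Times. For fixed $\vartheta_0$, $$T(\vartheta)=\frac{\vartheta_0-\vartheta}{2\alpha}\exp\left(-c_\phi e^{-\vartheta}\right)\quad(\vartheta\le\vartheta_0),\qquad \vartheta(t)=\sup\{\vartheta\in(-\infty,\vartheta_0]:t<T(\vartheta)\}.$$ Solutions. A classical solution in $\mathcal{K}_\vartheta$ on a time interval $I$ is a map $I\ni t\mapsto k_t\in\mathcal{K}_\vartheta$ which is continuous on $I$, continuously differentiable on the interior of $I$, takes values in $\mathrm{Dom}(L^\Delta)$, and solves the problem. A classical solution $k_t\in\mathcal{K}_{\vartheta(t)}$ on $[0,T_* )$ means a map $t\mapsto k_t$ with $k_t\in\mathcal{K}_{\vartheta(t)}$ for each $t\in[0,T_* )$ whose restriction to $[0,T(\vartheta))$ is, for every $\vartheta<\vartheta_0$, a classical solution in $\mathcal{K}_\vartheta$ (note $t<T(\vartheta)$ implies $\mathcal{K}_{\vartheta(t)}\subset\mathcal{K}_\vartheta$). *)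

(* Defs.v *)
From HB Require Import structures.
From mathcomp Require Import all_boot all_order all_algebra finmap.
From mathcomp Require Import all_classical all_reals all_analysis.
From mathcomp Require Import measurable_realfun ess_sup_inf.

Set Implicit Arguments.
Unset Strict Implicit.
Unset Printing Implicit Defensive.

Import Order.TTheory GRing.Theory Num.Theory.
Import numFieldNormedType.Exports.

Local Open Scope classical_set_scope.
Local Open Scope ring_scope.

Section power_measure.
Context d (T : measurableType d) (R : realType).
Variable mu : {sigma_finite_measure set T -> \bar R}.

Definition cons_pair n (p : T * n.-tuple T) : n.+1.-tuple T :=
  [tuple of p.1 :: p.2].

Lemma measurable_cons_pair n : measurable_fun setT (@cons_pair n).
Proof. exact: measurable_cons. Qed.

Section step.
Variables (n : nat) (nu : {sigma_finite_measure set (n.-tuple T) -> \bar R}).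

Definition power_step : set (n.+1.-tuple T) -> \bar R :=
  pushforward (mu \x nu)%E (@cons_pair n).

Let power_step0 : power_step set0 = 0%E.
Proof. by rewrite /power_step /pushforward preimage_set0 measure0. Qed.

Let power_step_ge0 A : (0 <= power_step A)%E.
Proof. exact: (measure_ge0 (mu \x nu)%E). Qed.

Let power_step_sigma_additive : semi_sigma_additive power_step.
Proof.
have mc := @measurable_cons_pair n.
move=> F mF tF mUF; rewrite /power_step /pushforward preimage_bigcup.
apply: measure_semi_sigma_additive.
- by move=> i; rewrite -[X in measurable X]setTI; exact: mc.
- apply/trivIsetP => /= i j _ _ ij; rewrite -preimage_setI.
  by move/trivIsetP : tF => /(_ _ _ _ _ ij) ->//; rewrite preimage_set0.
- by rewrite -preimage_bigcup -[X in measurable X]setTI; exact: mc.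
Qed.

HB.instance Definition _ := isMeasure.Build _ _ _ power_step
  power_step0 power_step_ge0 power_step_sigma_additive.

(* The canonical SigmaFiniteMeasure structure on _ \x _ is shadowed in the
   library by the one for subprobabilities, hence this direct proof. *)
Let power_step_sigma_finite : sigma_finite setT power_step.
Proof.
have /sigma_finiteP[F [TF ndF Foo]] := sigma_finiteT mu.
have /sigma_finiteP[G [TG ndG Goo]] := sigma_finiteT nu.
have mth : measurable_fun setT (fun t : n.+1.-tuple T => thead t).
  exact: measurable_tnth.
have mbh := @measurable_behead _ T n.
pose H i := ((fun t : n.+1.-tuple T => thead t) @^-1` F i) `&`
  ((fun t : n.+1.-tuple T => [tuple of behead t]) @^-1` G i).
exists H.
  apply/esym; rewrite -subTset => t _.
  have : setT (thead t) by [].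
  rewrite TF => -[i _ Fi].
  have : setT [tuple of behead t] by [].
  rewrite TG => -[j _ Gj].
  exists (maxn i j) => //; split.
    by have /subsetPset := ndF _ _ (leq_maxl i j); exact.
  by have /subsetPset := ndG _ _ (leq_maxr i j); exact.
move=> i; have [mFi Fi] := Foo i; have [mGi Gi] := Goo i; split.
  by apply: measurableI; rewrite -[X in measurable X]setTI;
    [exact: mth|exact: mbh].
rewrite /power_step /pushforward (_ : @cons_pair n @^-1` H i = F i `*` G i).
  by rewrite product_measure1E// lte_mul_pinfty// ge0_fin_numE.
have headK (p : T * n.-tuple T) : thead (cons_pair p) = p.1 by [].
have tailK (p : T * n.-tuple T) :
  [tuple of behead (cons_pair p)] = p.2 :> n.-tuple T by exact/val_inj.
by apply/seteqP; split => p; rewrite /H /preimage /= headK tailK.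
Qed.

HB.instance Definition _ := Measure_isSigmaFinite.Build _ _ _ power_step
  power_step_sigma_finite.

End step.

(* The product measure mu x ... x mu (n factors) on T^n; for n = 0 it is the
   unit mass on the one-point space T^0. *)
Fixpoint power_measure n : {sigma_finite_measure set (n.-tuple T) -> \bar R} :=
  if n is m.+1 then power_step (power_measure m) else \d_[tuple].

End power_measure.

Section euclidean.
Context (R : realType) (d : nat).

Definition Eucl : Type := d.-tuple (measurableTypeR R).
HB.instance Definition _ := Measurable.on Eucl.

Definition lebd : {sigma_finite_measure set Eucl -> \bar R} :=
  power_measure (@lebesgue_measure R) d.

Definition Eucl_sub (x y : Eucl) : Eucl :=
  [tuple (tnth x i : R) - tnth y i | i < d].

Definition Eucl_opp (x : Eucl) : Eucl := [tuple - (tnth x i : R) | i < d].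

Definition lebdn n : {sigma_finite_measure set (n.-tuple Eucl) -> \bar R} :=
  power_measure lebd n.

Lemma measurable_distinct n : measurable [set t : n.-tuple Eucl | uniq t].
Proof.
rewrite (_ : [set t | _] = \bigcap_(ij in [set ij : 'I_n * 'I_n | ij.1 != ij.2])
    ~` (\bigcap_(c in [set: 'I_d]) [set t : n.-tuple Eucl |
      (tnth (tnth t ij.1) c : R) - tnth (tnth t ij.2) c = 0])).
  apply: fin_bigcap_measurable => [|[i j] /= _]; first exact: finite_finset.
  apply: measurableC; apply: fin_bigcap_measurable => [|c _].
    exact: finite_finset.
  have mt k : measurable_fun setT
      (fun t : n.-tuple Eucl => tnth (tnth t k) c : R).
    apply: (@measurableT_comp _ _ _ _ _ _ (fun x : Eucl => tnth x c)).
      exact: measurable_tnth.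
    exact: measurable_tnth.
  have mB := measurable_funB (mt i) (mt j).
  by have := mB measurableT [set 0] (measurable_set1 0); rewrite setTI.
apply/seteqP; split=> [t /tuple_uniqP inj_t [i j] /= ij eq_t|t ut].
  move/eqP: ij; apply; apply: inj_t; apply: eq_from_tnth => c.
  by apply/eqP; rewrite -subr_eq0; apply/eqP; exact: eq_t.
apply/tuple_uniqP => i j tij; apply/eqP/negPn/negP => ij.
by apply: (ut (i, j) ij) => c _ /=; rewrite tij subrr.
Qed.

Definition Gamma0 : Type := {fset Eucl}.
HB.instance Definition _ := Choice.on Gamma0.
HB.instance Definition _ := isPointed.Build Gamma0 fset0.

Definition config_of n (t : n.-tuple Eucl) : Gamma0 := [fset x in tval t]%fset.

(* The preimage of A in the space of ordered n-tuples of distinct points. *)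
Definition level n (A : set Gamma0) : set (n.-tuple Eucl) :=
  [set t : n.-tuple Eucl | uniq t] `&` @config_of n @^-1` A.

(* The Borel sets of the disjoint union of the Gamma^(n): Gamma^(n) is the
   quotient of the space of n-tuples of distinct points by permutations. *)
Definition Gamma0_measurable : set (set Gamma0) :=
  [set A | forall n, measurable (@level n A)].

Let Gamma0_measurable0 : Gamma0_measurable set0.
Proof. by move=> n; rewrite /level preimage_set0 setI0. Qed.

Let Gamma0_measurableC A : Gamma0_measurable A -> Gamma0_measurable (~` A).
Proof.
move=> mA n; rewrite (_ : @level n (~` A) =
      [set t : n.-tuple Eucl | uniq t] `\` @level n A).
  by apply: measurableD; [exact: measurable_distinct|exact: mA].
by apply/seteqP; split => t /= => [[ut At]|[ut /not_andP[]]]; split=> // -[].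
Qed.

Let Gamma0_measurable_bigcup (F : (set Gamma0)^nat) :
  (forall i, Gamma0_measurable (F i)) -> Gamma0_measurable (\bigcup_i F i).
Proof.
move=> mF n; rewrite /level preimage_bigcup setI_bigcupr.
by apply: bigcupT_measurable => i; exact: mF.
Qed.

HB.instance Definition _ := @isMeasurable.Build default_measure_display Gamma0
  Gamma0_measurable Gamma0_measurable0 Gamma0_measurableC
  Gamma0_measurable_bigcup.

Definition mlevel n (A : set Gamma0) : \bar R := lebdn n (@level n A).

Let mlevel0 n : mlevel n set0 = 0%E.
Proof. by rewrite /mlevel /level preimage_set0 setI0 measure0. Qed.

Let mlevel_ge0 n A : (0 <= mlevel n A)%E.
Proof. exact: measure_ge0. Qed.

Let mlevel_sigma_additive n : semi_sigma_additive (mlevel n).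
Proof.
move=> F mF tF mUF; rewrite /mlevel /level preimage_bigcup setI_bigcupr.
apply: measure_semi_sigma_additive.
- by move=> i; exact: mF.
- apply/trivIset_setIl/trivIsetP => /= i j _ _ ij; rewrite -preimage_setI.
  by move/trivIsetP : tF => /(_ _ _ _ _ ij) ->//; rewrite preimage_set0.
- by rewrite -setI_bigcupr -preimage_bigcup; exact: mUF.
Qed.

HB.instance Definition _ n := isMeasure.Build _ _ _ (mlevel n)
  (mlevel0 n) (@mlevel_ge0 n) (@mlevel_sigma_additive n).

(* For n = 0 the summand is the unit mass at fset0, and for n >= 1 it is m^(n)
   divided by n factorial. *)
Definition lebesgue_poisson : {measure set Gamma0 -> \bar R} :=
  mseries (fun n => mscale (n`!%:R^-1)%:nng (mlevel n)) 0.

Definition eprod (f : Eucl -> R) (eta : Gamma0) : R := \prod_(x <- eta) f x.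

End euclidean.

Arguments Eucl : clear implicits.
Arguments lebd : clear implicits.
Arguments lebdn : clear implicits.
Arguments Gamma0 : clear implicits.
Arguments lebesgue_poisson : clear implicits.

Section jump_operator.
Context (R : realType) (d : nat).
Variables a phi : Eucl R d -> R.
Local Notation dx := (lebd R d).
Local Notation lambda := (lebesgue_poisson R d).
Local Open Scope fset_scope.

Definition tfun (x y : Eucl R d) : R := expR (- phi (Eucl_sub x y)) - 1.

Definition taufun (x y : Eucl R d) : R := tfun x y + 1.

(* All integrals converge absolutely for lambda-almost every eta as soon as k
   belongs to one of the spaces Kspace below, so that the real-valued integral
   carries no default value there. *)
Definition LDelta (k : Gamma0 R d -> R) (eta : Gamma0 R d) : R :=
  \sum_(y <- eta) \int[dx]_x
    (a (Eucl_sub x y) * eprod (taufun y) (x |` (eta `\ y)) *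
     \int[lambda]_xi
       (eprod (tfun y) xi * k (xi `|` (x |` (eta `\ y)))))
  - \int[lambda]_xi
      (k (xi `|` eta) *
       \sum_(x <- eta) \int[dx]_y
         (a (Eucl_sub x y) * eprod (taufun y) eta * eprod (tfun y) xi)).

End jump_operator.

Section spaces.
Context (R : realType) (d : nat).
Local Notation config := (Gamma0 R d).
Local Notation lambda := (lebesgue_poisson R d).
Implicit Types (k : config -> R) (theta t : R) (I : set R).

(* k^(n) as a function on (R^d)^n; its values at tuples with repeated points
   are irrelevant, such tuples forming a null set. *)
Definition kn n k (t : n.-tuple (Eucl R d)) : R := k (config_of t).

(* For n = 0 this is the absolute value of k fset0, since lebdn R d 0 is the
   unit mass on a one-point space. *)
Definition nu n k : \bar R := 'N[lebdn R d n]_+oo [EFin \o @kn n k].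

Definition knorm theta k : \bar R :=
  ereal_sup (range (fun n => (expR (theta * n%:R))%:E * nu n k)%E).

(* Elements of K_theta are represented by functions; the classes are those of
   equality lambda-almost everywhere, on which knorm only depends. *)
Definition Kspace theta : set (config -> R) :=
  [set k | measurable_fun setT k /\ (knorm theta k < +oo)%E].

Definition Kcontinuous_at theta I (k : R -> config -> R) t : Prop :=
  (fun s => knorm theta (k s \- k t)) @ within I (nbhs t) --> 0%E.

Definition Kderivative_at theta (k : R -> config -> R) t (l : config -> R) :
    Prop :=
  (fun h => knorm theta (fun eta => h^-1 * (k (t + h) eta - k t eta) - l eta))
    @ 0^' --> 0%E.

Section cauchy_problem.
Variables a phi : Eucl R d -> R.

Definition DomLDelta theta : set (config -> R) :=
  [set k | Kspace theta k /\ Kspace theta (LDelta a phi k)].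

Definition classical_solution theta I (k0 : config -> R)
    (k : R -> config -> R) : Prop :=
  [/\ forall t, I t -> DomLDelta theta (k t),
      forall t, I t -> Kcontinuous_at theta I k t,
      exists k' : R -> config -> R,
        [/\ forall t, I° t -> Kspace theta (k' t),
            forall t, I° t -> Kderivative_at theta k t (k' t),
            forall t, I° t -> Kcontinuous_at theta I° k' t &
            forall t, I° t -> k' t = LDelta a phi (k t) %[ae lambda]] &
      k 0 = k0 %[ae lambda] ].

Definition alpha : R := \int[lebd R d]_x a x.

Definition cphi : R := \int[lebd R d]_x (1 - expR (- phi x)).

End cauchy_problem.

Section times.
Variables alpha cphi theta0 : R.

Definition Ttime theta : R :=
  (theta0 - theta) / (2 * alpha) * expR (- (cphi * expR (- theta))).

Definition Tstar : \bar R :=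
  ereal_sup [set (Ttime theta)%:E | theta in [set theta | theta <= theta0]].

Definition theta_of t : R :=
  sup [set theta | theta <= theta0 /\ t < Ttime theta].

End times.

(* "A classical solution k_t in K_theta(t) on [0, Tstar[". *)
Definition scale_solution (a phi : Eucl R d -> R) (theta0 : R)
    (k0 : config -> R) (k : R -> config -> R) : Prop :=
  (forall t, 0 <= t -> (t%:E < Tstar (alpha a) (cphi phi) theta0)%E ->
     Kspace (theta_of (alpha a) (cphi phi) theta0 t) (k t)) /\
  (forall theta, theta < theta0 ->
     classical_solution a phi theta
       `[0, Ttime (alpha a) (cphi phi) theta0 theta[%classic k0 k).

End spaces.

(* Main.v *)
(** The operator has the bound |(L k)(eta)| <= 2 alpha n C q^n exp(c_phi q),
    n = |eta|, whenever |k| <= C q^|.|. Hence A exp(-(theta_0 - K s) n), with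
    K = 2 alpha exp(c_phi e^-theta), is a supersolution of the majorant equation
    for as long as theta_0 - K s >= theta, that is for s <= T(theta). All Picard
    partial sums sum_m s^m/m! |L^m k_0| stay below it, so the exponential series
    of L applied to k_0 converges in K_theta on [0, T(theta)) and is the
    solution; letting theta increase to theta(t) gives the level K_theta(t).
    For uniqueness, a solution v with v_0 = 0 is measured in norms whose level
    decreases linearly in time: the loss of level pays for the factor n, and a
    mean value inequality halves any bound on v on a short interval, so v = 0. *)
Require Import Defs.
From mathcomp Require Import all_boot all_order all_algebra finmap.
From mathcomp Require Import all_classical all_reals all_analysis.
From mathcomp Require Import measurable_realfun ess_sup_inf.
From mathcomp Require Import ring lra.

Set Implicit Arguments.
Unset Strict Implicit.
Unset Printing Implicit Defensive.

Import Order.TTheory GRing.Theory Num.Theory.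
Import numFieldNormedType.Exports.
Local Open Scope classical_set_scope.
Local Open Scope ring_scope.

(** * Product measures *)

(** Elements of K_theta are classes, but for a fixed nonempty [eta] the loss integral of [LDelta]
    sees [k] only at configurations containing [eta], which form a null set. This shapes both halves
    of the proof. Existence works with a representative bounded at every configuration, so that the
    operator bound, the iterates and their series hold pointwise in [eta]. Uniqueness concerns
    solutions known only almost everywhere and needs that [LDelta] respects classes: by Fubini, for
    almost every [eta], almost every [xi] joined to [eta] avoids a given null set.

    All estimates in time rest on the value of the supersolution at the single time T(theta), where
    its level is exactly theta: this gives T(theta)^m / m! |L^m k_0| <= A exp(-theta n) for every m.
    On [0, r] with r < T(theta), the derivative, its continuity and the exchange of [LDelta] with
    the sum then follow by comparison with a geometric series of ratio r / T(theta), the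
    configuration entering only through the constant A exp(-theta n). *)

Section almost_everywhere_product.
Context (R : realType).
Local Open Scope ereal_scope.

Lemma ae_measurableP d (T : measurableType d) (mu : {measure set T -> \bar R})
    (P : set T) : measurable P ->
  {ae mu, forall x, P x} <-> mu (~` P) = 0.
Proof.
move=> mP; split.
  by move=> /negligibleP; apply; exact: measurableC.
by move=> P0; apply/negligibleP => //; exact: measurableC.
Qed.

Lemma ge0_integral_eq0 d (T : measurableType d) (mu : {measure set T -> \bar R})
    (f : T -> \bar R) : measurable_fun setT f -> (forall x, 0 <= f x) ->
  \int[mu]_x f x = 0 <-> {ae mu, forall x, f x = 0}.
Proof.
move=> mf f0; have := ae_eq_integral_abs mu measurableT mf.
under eq_integral do rewrite gee0_abs//.
move=> [h1 h2]; split.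
  by move/h1; apply: filterS => x /(_ I).
by move=> h; apply: h2; apply: filterS h.
Qed.

Context d1 d2 (T1 : measurableType d1) (T2 : measurableType d2).
Variable m1 : {sigma_finite_measure set T1 -> \bar R}.
Variable m2 : {sigma_finite_measure set T2 -> \bar R}.
Variable P : set (T1 * T2).
Hypothesis mP : measurable P.

Let f : T1 * T2 -> \bar R := fun z => (\1_(~` P) z)%:E.

Let mf : measurable_fun setT f.
Proof. by apply/measurable_EFinP/measurable_indic/measurableC. Qed.

Let f0 z : 0 <= f z. Proof. by rewrite lee_fin. Qed.

Let prodE : (m1 \x m2) (~` P) = \int[m1 \x m2]_z f z.
Proof. by rewrite /f integral_indic ?setIT//; exact: measurableC. Qed.

Lemma measurable_section1 x : measurable [set y | P (x, y)].
Proof.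
rewrite -[X in measurable X]setTI; apply: (pair1_measurable x) => //.
Qed.

Lemma measurable_section2 y : measurable [set x | P (x, y)].
Proof.
rewrite -[X in measurable X]setTI; apply: (pair2_measurable y) => //.
Qed.

Let sec1 x : fubini_F m2 f x = m2 (~` [set y | P (x, y)]).
Proof.
rewrite /fubini_F /f -[in RHS](setIT (~` _)) -integral_indic//.
  exact/measurableC/measurable_section1.
Qed.

Let sec2 y : fubini_G m1 f y = m1 (~` [set x | P (x, y)]).
Proof.
rewrite /fubini_G /f -[in RHS](setIT (~` _)) -integral_indic//.
  exact/measurableC/measurable_section2.
Qed.

(** Tonelli for the indicator of the complement. The left side is a measure rather than an [ae]
    statement because [power_measure] is by definition an image of a product measure, so that the
    lemma applies to it by conversion. *)
Lemma ae_prodP1 : (m1 \x m2) (~` P) = 0 <->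
  {ae m1, forall x, {ae m2, forall y, P (x, y)}}.
Proof.
rewrite prodE fubini_tonelli1// ge0_integral_eq0; last 2 first.
  exact: measurable_fun_fubini_tonelli_F.
  by move=> x; exact: integral_ge0.
split; apply: filterS => x; rewrite sec1 => h.
  by apply/ae_measurableP => //; exact: measurable_section1.
by apply/ae_measurableP => //; exact: measurable_section1.
Qed.

Lemma ae_prodP2 : (m1 \x m2) (~` P) = 0 <->
  {ae m2, forall y, {ae m1, forall x, P (x, y)}}.
Proof.
rewrite prodE fubini_tonelli2// ge0_integral_eq0; last 2 first.
  exact: measurable_fun_fubini_tonelli_G.
  by move=> x; exact: integral_ge0.
split; apply: filterS => y; rewrite sec2 => h.
  by apply/ae_measurableP => //; exact: measurable_section2.
by apply/ae_measurableP => //; exact: measurable_section2.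
Qed.

(** The set is the zero set of the measure of the sections of the complement, a measurable function.
    This makes it possible to iterate [ae] statements. *)
Lemma measurable_ae2 : measurable [set y | {ae m1, forall x, P (x, y)}].
Proof.
have mG := measurable_fun_fubini_tonelli_G f mf f0 (m1 := m1).
have := mG measurableT [set 0] (emeasurable_set1 _).
rewrite setTI; congr measurable; apply/seteqP; split => y /=; rewrite sec2.
  by move=> h; apply/ae_measurableP => //; exact: measurable_section2.
by move=> h; apply/ae_measurableP => //; exact: measurable_section2.
Qed.

Lemma measurable_ae1 : measurable [set x | {ae m2, forall y, P (x, y)}].
Proof.
have mG := measurable_fun_fubini_tonelli_F f mf f0 (m2 := m2).
have := mG measurableT [set 0] (emeasurable_set1 _).
rewrite setTI; congr measurable; apply/seteqP; split => y /=; rewrite sec1.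
  by move=> h; apply/ae_measurableP => //; exact: measurable_section1.
by move=> h; apply/ae_measurableP => //; exact: measurable_section1.
Qed.

End almost_everywhere_product.

Section power_measure_theory.
Context d (T : measurableType d) (R : realType).
Variable mu : {sigma_finite_measure set T -> \bar R}.
Local Notation pm := (power_measure mu).
Local Open Scope ereal_scope.

Lemma integral_power_measureS n (f : n.+1.-tuple T -> \bar R) :
  measurable_fun setT f -> (forall t, 0 <= f t) ->
  \int[pm n.+1]_t f t = \int[mu]_x \int[pm n]_t f (cons_pair (x, t)).
Proof.
move=> mf f0.
have mc := @measurable_cons_pair _ T n.
transitivity (\int[pushforward (mu \x pm n) (@cons_pair _ T n)]_t f t).
  by apply: eq_measure_integral => A mA _.
rewrite ge0_integral_pushforward//= preimage_setT.
rewrite (fubini_tonelli1 (f \o @cons_pair _ T n))//; last by move=> ?; exact: f0.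
exact: measurableT_comp.
Qed.

Lemma integral_power_measureSr n (f : n.+1.-tuple T -> \bar R) :
  measurable_fun setT f -> (forall t, 0 <= f t) ->
  \int[pm n.+1]_t f t = \int[pm n]_t \int[mu]_x f (cons_pair (x, t)).
Proof.
move=> mf f0; rewrite integral_power_measureS//.
have mc := @measurable_cons_pair _ T n.
rewrite (fubini_tonelli (f \o @cons_pair _ T n))//; last by move=> ?; exact: f0.
exact: measurableT_comp.
Qed.

Lemma integral_power_measure0 (f : 0.-tuple T -> \bar R) :
  measurable_fun setT f -> \int[pm 0]_t f t = f [tuple].
Proof. by move=> mf; rewrite integral_dirac// diracT mul1e. Qed.

Lemma measurable_preimage_cons_pair n (P : set (n.+1.-tuple T)) :
  measurable P -> measurable (@cons_pair _ T n @^-1` P).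
Proof.
by move=> mP; rewrite -[X in measurable X]setTI; exact: measurable_cons_pair.
Qed.

Lemma ae_power_measureS n (P : set (n.+1.-tuple T)) : measurable P ->
  {ae pm n.+1, forall t, P t} <->
  {ae mu, forall x, {ae pm n, forall t, P (cons_pair (x, t))}}.
Proof.
move=> mP; rewrite ae_measurableP//.
exact: (ae_prodP1 mu (pm n) (measurable_preimage_cons_pair mP)).
Qed.

Lemma ae_power_measureSr n (P : set (n.+1.-tuple T)) : measurable P ->
  {ae pm n.+1, forall t, P t} <->
  {ae pm n, forall t, {ae mu, forall x, P (cons_pair (x, t))}}.
Proof.
move=> mP; rewrite ae_measurableP//.
exact: (ae_prodP2 mu (pm n) (measurable_preimage_cons_pair mP)).
Qed.

End power_measure_theory.

(** * Translation invariance of Lebesgue measure *)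

Section translation.
Context (R : realType).
Local Notation leb := (@lebesgue_measure R).

Lemma ge0_integral_lebesgue_translation (f : measurableTypeR R -> \bar R)
    (y : R) :
  measurable_fun setT f -> (forall x, (0 <= f x)%E) ->
  (\int[leb]_x f ((x : R) - y)%R = \int[leb]_x f x)%E.
Proof.
move=> mf f0; pose g (x : measurableTypeR R) : measurableTypeR R := (x : R) - y.
have mg : measurable_fun setT g by exact: measurable_funB.
transitivity (\int[pushforward leb g]_x f x)%E; last first.
  apply: eq_measure_integral => A mA _.
  (* Translation preserves the lengths of half-open intervals, and these determine the measure. *)
  apply/esym/lebesgue_measure_unique => //= _ [[a b]] _ <-.
  rewrite /pushforward (_ : g @^-1` _ = `]a + y, b + y]%classic).
    by rewrite !lebesgue_measure_itv/= !lte_fin ltrD2r -!EFinD opprD addrACA subrr addr0.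
  apply/seteqP; split => x; rewrite /g /= !in_itv/=; lra.
by rewrite ge0_integral_pushforward//= preimage_setT.
Qed.

(** With the first coordinate integrated innermost, the one-dimensional translation acts under the
    outer integral, and what remains is a function of the other coordinates, to which the induction
    hypothesis applies. *)
Lemma ge0_integral_lebd_translation d (f : Eucl R d -> \bar R) (y : Eucl R d) :
  measurable_fun setT f -> (forall x, (0 <= f x)%E) ->
  (\int[lebd R d]_x f (Eucl_sub x y) = \int[lebd R d]_x f x)%E.
Proof.
rewrite /lebd; elim: d f y => [|d IH] f y mf f0.
  by apply: eq_integral => x _; congr f; apply: eq_from_tnth => -[].
have mt : measurable_fun setT (fun x : Eucl R d.+1 => Eucl_sub x y).
  apply/measurable_fun_tnthP => i.
  rewrite (_ : _ \o _ = fun x : Eucl R d.+1 => (tnth x i : R) - tnth y i).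
    by apply: measurable_funB => //; exact: measurable_tnth.
  by apply/funext => x /=; rewrite tnth_mktuple.
pose y' : Eucl R d := [tuple of behead y].
have mf' : measurable_fun setT (fun z => f (cons_pair z)).
  by apply: measurableT_comp => //; exact: measurable_cons_pair.
rewrite integral_power_measureSr//; last exact: measurableT_comp.
transitivity (\int[power_measure leb d]_t
    \int[leb]_x f (cons_pair (x, Eucl_sub t y')))%E.
  apply: eq_integral => t _.
  have := ge0_integral_lebesgue_translation
    (f := fun x => f (cons_pair (x, Eucl_sub t y'))) (thead y).
  move=> <-//; last first.
    exact: (measurableT_comp mf' (pair2_measurable _)).
  apply: eq_integral => x _; congr f; apply: eq_from_tnth => i.
  rewrite tnth_mktuple; case: (unliftP ord0 i) => [j|] ->.
    rewrite /cons_pair !tnthS tnth_mktuple /y'.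
    rewrite [in RHS]tnth_behead; congr (_ - tnth y _); apply/val_inj => /=.
    by rewrite inordK// ltnS.
  by [].
rewrite [RHS]integral_power_measureSr//.
apply: (IH (fun t => \int[leb]_x f (cons_pair (x, t)))%E).
  by apply: (measurable_fun_fubini_tonelli_G (fun z => f (cons_pair z))).
by move=> t; exact: integral_ge0.
Qed.

End translation.

(** * Configurations and the Lebesgue-Poisson measure *)

Section tuple_measurability.
Context d0 d1 (P : measurableType d0) (T : measurableType d1).

Lemma measurable_cat_tuple m n (f : P -> m.-tuple T) (g : P -> n.-tuple T) :
  measurable_fun setT f -> measurable_fun setT g ->
  measurable_fun setT (fun p => [tuple of f p ++ g p] : (m + n).-tuple T).
Proof.
move=> /measurable_fun_tnthP mf /measurable_fun_tnthP mg.
apply/measurable_fun_tnthP => i.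
case: (split_ordP i) => j ->.
  by rewrite (_ : _ \o _ = (@tnth _ T ^~ j) \o f)//; apply/funext => p /=;
    rewrite tnth_lshift.
by rewrite (_ : _ \o _ = (@tnth _ T ^~ j) \o g)//; apply/funext => p /=;
  rewrite tnth_rshift.
Qed.

Lemma measurable_tnth_comp m (f : P -> m.-tuple T) i :
  measurable_fun setT f -> measurable_fun setT (fun p => tnth (f p) i).
Proof. by move=> /measurable_fun_tnthP; exact. Qed.

Lemma measurable_pick_tuple m n (s : 'I_n -> 'I_m) (f : P -> m.-tuple T) :
  measurable_fun setT f ->
  measurable_fun setT (fun p => [tuple tnth (f p) (s i) | i < n] : n.-tuple T).
Proof.
move=> mf; apply/measurable_fun_tnthP => i.
rewrite (_ : _ \o _ = fun p => tnth (f p) (s i)).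
  exact: measurable_tnth_comp.
by apply/funext => p /=; rewrite tnth_mktuple.
Qed.

End tuple_measurability.

Section configurations.
Context (R : realType) (d : nat).
Local Notation E := (Eucl R d).
Local Notation lambda := (lebesgue_poisson R d).

Lemma measurable_eq_Eucl d0 (P : measurableType d0) (f g : P -> E) :
  measurable_fun setT f -> measurable_fun setT g ->
  measurable [set p | f p = g p].
Proof.
move=> mf mg; rewrite (_ : [set p | _] = \bigcap_(c in [set: 'I_d])
    [set p | (tnth (f p) c : R) - tnth (g p) c = 0]).
  apply: fin_bigcap_measurable => [|c _]; first exact: finite_finset.
  have mB := measurable_funB (measurable_tnth_comp c mf : measurable_fun setT
    (fun p => tnth (f p) c : R)) (measurable_tnth_comp c mg).
  by have := mB measurableT [set 0] (measurable_set1 0); rewrite setTI.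
apply/seteqP; split=> [p /= fg c _ /=|p fg]; first by rewrite fg subrr.
by apply: eq_from_tnth => c; apply/eqP; rewrite -subr_eq0; apply/eqP; exact: fg.
Qed.

Lemma config_of_cat m n (s : m.-tuple E) (t : n.-tuple E) :
  config_of [tuple of s ++ t] = (config_of s `|` config_of t)%fset.
Proof. by apply/fsetP => x; rewrite !inE. Qed.

Lemma config_of_cons n x (t : n.-tuple E) :
  config_of (cons_pair (x, t)) = (x |` config_of t)%fset.
Proof. by apply/fsetP => y; rewrite !inE. Qed.

Lemma card_config_of n (t : n.-tuple E) : uniq t -> #|` config_of t| = n.
Proof. by move=> ut; rewrite card_fseq undup_id// size_tuple. Qed.

Lemma config_of_surj (eta : Gamma0 R d) :
  exists t : #|` eta|.-tuple E, uniq t /\ config_of t = eta.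
Proof.
have sz : size (enum_fset eta) == #|` eta|%fset by [].
exists (Tuple sz); split; first exact: fset_uniq.
by apply/fsetP => x; rewrite !inE.
Qed.

(* A tuple with repetitions has the same configuration as the subtuple of its
   distinct entries; there are countably many ways to select a subtuple. *)
Lemma measurable_config_of n : measurable_fun setT (@config_of R d n).
Proof.
move=> _ A mA; rewrite setTI.
pose h p (s : {ffun 'I_p -> 'I_n}) (t : n.-tuple E) : p.-tuple E :=
  [tuple tnth t (s i) | i < p].
pose F p (s : {ffun 'I_p -> 'I_n}) := h p s @^-1` (@level R d p A) `&`
  \bigcap_(i in [set: 'I_n]) \bigcup_(j in [set: 'I_p])
    [set t | tnth t i = tnth t (s j)].
have hE p (s : {ffun 'I_p -> 'I_n}) t : F p s t ->
    A (config_of (h p s t)) /\ config_of t = config_of (h p s t).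
  case=> -[uh Ah] tE; split => //; apply/fsetP => x; rewrite !inE.
  apply/tnthP/tnthP => -[i ->].
    by have [j _ ->] := tE i I; exists j; rewrite tnth_mktuple.
  by exists (s i); rewrite tnth_mktuple.
rewrite (_ : _ @^-1` _ = \bigcup_p \bigcup_(s in [set: {ffun 'I_p -> 'I_n}]) F p s).
  apply: bigcupT_measurable => p; apply: countable_bigcupT_measurable => // s.
  apply: measurableI.
    rewrite -[X in measurable X]setTI.
    by apply: (measurable_pick_tuple s (f := id)) => //; exact: mA.
  apply: fin_bigcap_measurable => [|i _]; first exact: finite_finset.
  apply: fin_bigcup_measurable => [|j _]; first exact: finite_finset.
  by apply: measurable_eq_Eucl; exact: measurable_tnth.
apply/seteqP; split => [t At|t [p _ [s _ /hE[Ah th]]]]; last first.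
  by rewrite /preimage /= th.
pose p := size (undup t).
have tn (j : 'I_p) : (index (tnth (in_tuple (undup t)) j) t < n)%N.
  by rewrite -[X in (_ < X)%N](size_tuple t) index_mem -mem_undup mem_tnth.
pose s := [ffun j => Ordinal (tn j)].
have sE j : tnth t (s j) = tnth (in_tuple (undup t)) j.
  rewrite (tnth_nth (tnth t (s j))) ffunE /= nth_index//.
  by rewrite -mem_undup mem_tnth.
have hsE : h p s t = in_tuple (undup t) :> seq E.
  by congr val; apply: eq_from_tnth => j; rewrite tnth_mktuple sE.
exists p => //; exists s => //; split.
  split; first by rewrite /= hsE undup_uniq.
  rewrite /preimage /= (_ : config_of _ = config_of t)//.
  by apply/fsetP => x; rewrite !inE hsE mem_undup.
move=> i _; have : tnth t i \in undup t by rewrite mem_undup mem_tnth.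
by move=> /(tnthP (in_tuple (undup t))) [j tj]; exists j => //=; rewrite sE.
Qed.

End configurations.

(** * Integrals and null sets of the Lebesgue-Poisson measure *)

Section lebesgue_poisson_theory.
Context (R : realType) (d : nat).
Hypothesis d_gt0 : (0 < d)%N.
Local Notation E := (Eucl R d).
Local Notation lambda := (lebesgue_poisson R d).

(** The first coordinates already differ almost everywhere. In dimension 0 the space is a single
    point of mass 1, hence the assumption [d_gt0]. *)
Lemma ae_neq_Eucl (y : E) : {ae lebd R d, forall x, x <> y}.
Proof.
case: d d_gt0 y => // d' _ y.
have mP : measurable [set x : Eucl R d'.+1 | x <> y].
  rewrite (_ : [set x | _] = ~` [set x | x = y])//.
  apply: measurableC.
  exact: (measurable_eq_Eucl (f := id) (g := cst y)).
apply/(ae_power_measureS _ mP).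
have : {ae @lebesgue_measure R, forall x, x <> thead y}.
  have E : ~` [set x | x <> thead y] = [set thead y].
    by apply/seteqP; split=> x /=; [move/contrapT|move=> ->; exact].
  apply/(@ae_measurableP R _ _ _ [set x | x <> thead y]).
    rewrite -[X in measurable X]setCK E; apply: measurableC.
    exact: measurable_set1.
  by rewrite E; exact: lebesgue_measure_set1.
apply: filterS => x xy; apply: aeW => t /= tE; apply: xy.
by rewrite -tE.
Qed.

Lemma ae_notin_Eucl (s : seq E) : {ae lebd R d, forall x, x \notin s}.
Proof.
elim: s => [|y s IH]; first exact: aeW.
move: (ae_neq_Eucl y) IH; apply: filterS2 => x /eqP xy xs.
by rewrite inE negb_or xy.
Qed.

(** Points are added one at a time, and almost every new point avoids the finitely many earlier
    ones. *)
Lemma ae_uniq_cat n (s : seq E) : uniq s ->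
  {ae lebdn R d n, forall t : n.-tuple E, uniq (t ++ s)}.
Proof.
move=> us.
have mP k : measurable [set t : k.-tuple E | uniq (t ++ s)].
  pose f (t : k.-tuple E) : (k + size s).-tuple E := [tuple of t ++ in_tuple s].
  have mf : measurable_fun setT f by exact: measurable_cat_tuple.
  by have := mf measurableT _ (@measurable_distinct R d _); rewrite setTI.
elim: n => [|n IH].
  apply/(ae_measurableP _ (mP 0%N)); rewrite /= diracE memNset//=; exact.

apply/(ae_power_measureSr _ (mP _)); apply: filterS IH => t ut.
move: (ae_notin_Eucl (t ++ s)); apply: filterS => x xt /=.
by rewrite xt ut.
Qed.

Lemma ae_uniq n : {ae lebdn R d n, forall t : n.-tuple E, uniq t}.
Proof.
have := @ae_uniq_cat n [::] isT; apply: filterS => t.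
by rewrite cats0.
Qed.

(** Identifies [mlevel n] with the image of Lebesgue measure under [config_of]: the tuples with
    repeated entries, which [level] discards, are a null set. *)
Lemma mlevelE n (A : set (Gamma0 R d)) : measurable A ->
  mlevel n A = lebdn R d n (@config_of R d n @^-1` A).
Proof.
move=> mA; rewrite /mlevel /level.
have mc : measurable (@config_of R d n @^-1` A).
  by rewrite -[X in measurable X]setTI; exact: measurable_config_of.
have mu := @measurable_distinct R d n.
have u0 : (lebdn R d n (~` [set t | uniq t]) = 0)%E.
  by apply/(ae_measurableP _ mu); exact: ae_uniq.
rewrite [RHS](measureDI _ mc mu) setIC [X in (X + _)%E](_ : _ = 0%E) ?add0e//.
by apply: subset_measure0 u0 => [||t []//]; [exact: measurableD|exact: measurableC].

Qed.

Local Open Scope ereal_scope.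

Lemma ge0_integral_mlevel n (f : Gamma0 R d -> \bar R) :
  measurable_fun setT f -> (forall eta, 0 <= f eta) ->
  \int[mlevel n]_eta f eta = \int[lebdn R d n]_t f (config_of t).
Proof.
move=> mf f0; have mc := @measurable_config_of R d n.
transitivity (\int[pushforward (lebdn R d n) (@config_of R d n)]_eta f eta).
  by apply: eq_measure_integral => A mA _; exact: mlevelE.
by rewrite ge0_integral_pushforward//= preimage_setT.
Qed.

Lemma ge0_integral_lambda (f : Gamma0 R d -> \bar R) :
  measurable_fun setT f -> (forall eta, 0 <= f eta) ->
  \int[lambda]_eta f eta =
  \sum_(n <oo) (n`!%:R^-1)%:E * \int[lebdn R d n]_t f (config_of t).
Proof.
move=> mf f0; rewrite ge0_integral_measure_series//.
apply: eq_eseriesr => n _.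
by rewrite ge0_integral_mscale// ge0_integral_mlevel.
Qed.

(** A series of nonnegative terms vanishes only if each term does, and the weights 1/n! are
    positive. *)
Lemma ae_lambdaP (P : set (Gamma0 R d)) : measurable P ->
  {ae lambda, forall eta, P eta} <->
  forall n, {ae lebdn R d n, forall t, P (config_of t)}.
Proof.
move=> mP.
have mPn n : measurable (@config_of R d n @^-1` P).
  by rewrite -[X in measurable X]setTI; exact: measurable_config_of.
have lE : lambda (~` P) =
    \sum_(n <oo) (n`!%:R^-1)%:E * lebdn R d n (~` (@config_of R d n @^-1` P)).
  apply: eq_eseriesr => n _; rewrite preimage_setC -mlevelE//.
  exact: measurableC.
rewrite ae_measurableP// lE; split => [s0 n|h].
  apply/(ae_measurableP _ (mPn n)).
  have f0 k : (0 <= k)%N -> xpredT k ->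
      0 <= (k`!%:R^-1)%:E * lebdn R d k (~` (@config_of R d k @^-1` P)).
    by move=> _ _; rewrite mule_ge0// lee_fin invr_ge0.
  have /eqP : (n`!%:R^-1)%:E * lebdn R d n (~` (@config_of R d n @^-1` P)) = 0.
    apply/eqP; rewrite eq_le f0// andbT -s0.
    rewrite (nneseriesD1 (n := n)) => [|k|//]; last exact: f0.
    by rewrite leeDl//; apply: nneseries_ge0 => k ? _; exact: f0.
  rewrite mule_eq0 eqe invr_eq0 pnatr_eq0 => /orP[|/eqP//].
  by rewrite gtn_eqF // fact_gt0.
rewrite eseries0// => n _ _.
by have /(ae_measurableP _ (mPn n)) -> := h n; rewrite mule0.
Qed.

End lebesgue_poisson_theory.

Section null_sets.
Context (R : realType) (d : nat).
Local Notation E := (Eucl R d).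

Definition delete_tuple (T : Type) n (i : 'I_n.+1) (t : n.+1.-tuple T) :
  n.-tuple T := [tuple tnth t (lift i j) | j < n].

Lemma measurable_delete_tuple d0 (T : measurableType d0) n (i : 'I_n.+1) :
  measurable_fun setT (@delete_tuple T n i).
Proof. exact: (measurable_pick_tuple (lift i) (f := id)). Qed.

(** Fubini along a concatenation, one point at a time. The induction runs over all properties: [P]
    gives way to its validity for almost every first point, measurable by [measurable_ae2]. *)
Lemma ae_cat_tuple j n (P : set ((j + n).-tuple E)) : measurable P ->
  {ae lebdn R d (j + n), forall u, P u} ->
  {ae lebdn R d n, forall t : n.-tuple E,
    {ae lebdn R d j, forall s : j.-tuple E, P [tuple of s ++ t]}}.
Proof.
elim: j P => [|j IH] P mP aeP.
  apply: filterS aeP => t Pt; apply: aeW => s.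
  by rewrite (_ : [tuple of _] = t)//; apply/val_inj; rewrite (tuple0 s).
have mQ := measurable_preimage_cons_pair mP.
move/(ae_power_measureSr _ mP): aeP => aeP.
have := IH _ (measurable_ae2 (lebd R d) mQ) aeP.
apply: filterS => t aet.
have mc : measurable [set s : j.+1.-tuple E | P [tuple of s ++ t]].
  have mf : measurable_fun setT (fun s : j.+1.-tuple E => [tuple of s ++ t]).
    exact: measurable_cat_tuple.
  by have := mf measurableT _ mP; rewrite setTI.
apply/(ae_power_measureSr _ mc); apply: filterS aet => s /=.
apply: filterS => x; congr P; exact/val_inj.
Qed.

(** Forgetting a coordinate pulls null sets back to null sets. The induction peels off first
    coordinates until the one to be forgotten comes first. *)
Lemma ae_delete_tuple n (i : 'I_n.+1) (Q : set (n.-tuple E)) : measurable Q ->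
  {ae lebdn R d n, forall t, Q t} ->
  {ae lebdn R d n.+1, forall t : n.+1.-tuple E, Q (delete_tuple i t)}.
Proof.
elim: n i Q => [|n IH] i Q mQ aeQ.
  apply: aeW => t; rewrite tuple0.
  (* The empty tuple carries a unit mass, so a property valid almost everywhere holds at it. *)
  move/(ae_measurableP _ mQ) : aeQ; rewrite /= diracE.
  case: (boolP (_ \in _)) => [_ [] /eqP|]; first by rewrite oner_eq0.
  by rewrite notin_setE => /contrapT.
have mP k (P : set (k.-tuple E)) (l : 'I_k.+1) : measurable P -> measurable
    [set t : k.+1.-tuple E | P (delete_tuple l t)].
  move=> mP'; rewrite -[X in measurable X]setTI.
  exact: measurable_delete_tuple.
apply/(ae_power_measureS _ (mP _ _ _ mQ)).
case: (unliftP ord0 i) => [i'|] ->; last first.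
  apply: aeW => x; apply: filterS aeQ => t /=; congr Q.
  by apply: eq_from_tnth => k; rewrite tnth_mktuple /cons_pair tnthS.
move/(ae_power_measureS _ mQ): aeQ; apply: filterS => x aex.
have mQx : measurable [set t | Q (cons_pair (x, t))].
  exact: (measurable_section1 (measurable_preimage_cons_pair mQ)).
apply: filterS (IH i' _ mQx aex) => t /=; congr Q.
apply: eq_from_tnth => k; rewrite tnth_mktuple.
case: (unliftP ord0 k) => [k'|] ->.
  rewrite /cons_pair tnthS /= tnth_mktuple.
  rewrite (_ : lift _ (lift _ _) = lift ord0 (lift i' k')) ?tnthS//.
  by apply/val_inj => /=; rewrite /bump/= ?add1n ltnS ?addnS.
rewrite /cons_pair tnth0 (_ : lift _ _ = ord0) ?tnth0//.
by apply/val_inj.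
Qed.
End null_sets.

(** * Measurability of functions of a parameter and a configuration *)

Section measurability_on_configurations.
Context (R : realType) (d : nat).
Local Notation E := (Eucl R d).
Local Notation config := (Gamma0 R d).
Local Notation lambda := (lebesgue_poisson R d).

Lemma measurable_fun_Gamma0P d1 (U : measurableType d1) (F : config -> U) :
  (forall n, measurable_fun [set t : n.-tuple E | uniq t]
     (fun t => F (config_of t))) ->
  measurable_fun setT F.
Proof.
move=> h _ B mB; rewrite setTI.
suff : Gamma0_measurable (F @^-1` B) by [].
move=> n; exact: h (@measurable_distinct R d n) _ mB.
Qed.

Lemma measurable_mem d0 (P : measurableType d0) (n : nat) (x : P -> E) (t : P -> n.-tuple E) :
  measurable_fun setT x -> measurable_fun setT t ->
  measurable_fun setT (fun p => x p \in t p).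
Proof.
move=> mx mt; apply: (measurable_fun_bool true).
rewrite setTI (_ : _ @^-1` _ = \bigcup_(i in [set: 'I_n]) [set p | x p = tnth (t p) i]).
  apply: fin_bigcup_measurable => [|i _]; first exact: finite_finset.
  by apply: measurable_eq_Eucl => //; exact: measurable_tnth_comp.
apply/seteqP; split => p /=.
  by move=> /tnthP[i xi]; exists i.
by move=> [i _ /= xi]; rewrite xi; exact: mem_tnth.
Qed.

(* Stands in for measurability on the product of P and Gamma0: the second
   variable is read through its enumerations. *)
Definition jointly_measurable d0 (P : measurableType d0) d1
    (U : measurableType d1) (F : P -> config -> U) :=
  forall n, measurable_fun setT
    (fun z : P * n.-tuple E => F z.1 (config_of z.2)).

Section joint.
Context d0 (P : measurableType d0).

Lemma jointly_measurable_section d1 (U : measurableType d1)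
    (F : P -> config -> U) p :
  jointly_measurable F -> measurable_fun setT (F p).
Proof.
move=> mF; apply: measurable_fun_Gamma0P => n.
apply: (@measurable_funS _ _ _ _ setT) => //.
exact: (measurableT_comp (mF n) (pair1_measurable p)).
Qed.

Lemma jointly_measurableM (F G : P -> config -> R) :
  jointly_measurable F -> jointly_measurable G ->
  jointly_measurable (fun p eta => F p eta * G p eta).
Proof. by move=> mF mG n; exact: (measurable_funM (mF n) (mG n)). Qed.

Lemma jointly_measurable_cst d1 (U : measurableType d1) (f : P -> U) :
  measurable_fun setT f -> jointly_measurable (fun p _ => f p).
Proof. by move=> mf n; exact: (measurableT_comp mf measurable_fst). Qed.

Lemma jointly_measurable_union d1 (U : measurableType d1) m (k : config -> U)
    (h : P -> m.-tuple E) :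
  measurable_fun setT k -> measurable_fun setT h ->
  jointly_measurable (fun p xi => k (xi `|` config_of (h p))%fset).
Proof.
move=> mk mh n.
rewrite (_ : (fun z => _) =
    fun z : P * n.-tuple E => k (config_of [tuple of z.2 ++ h z.1])).
  apply: measurableT_comp => //.
  apply: (measurableT_comp (@measurable_config_of R d _)).
  apply: measurable_cat_tuple => //.
  exact: (measurableT_comp mh measurable_fst).
by apply/funext => z; rewrite config_of_cat.
Qed.

(** The product runs over the set of entries, so a repeated entry counts once: the factor of the
    head is dropped when the head recurs in the tail. *)
Lemma jointly_measurable_eprod (f : P -> E -> R) :
  measurable_fun setT (fun z : P * E => f z.1 z.2) ->
  jointly_measurable (fun p => eprod (f p)).
Proof.
move=> mf n; elim: n => [|n IH].
  rewrite (_ : (fun z => _) = cst 1)//; apply/funext => z.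
  rewrite /eprod big_seq big1// => x; rewrite inE (tuple0 z.2).
  by rewrite inE.
pose b (z : P * n.+1.-tuple E) : n.-tuple E := [tuple of behead z.2].
have mb : measurable_fun setT b.
  exact: (measurableT_comp (@measurable_behead _ _ n) measurable_snd).
have mh : measurable_fun setT (fun z : P * n.+1.-tuple E => thead z.2).
  by apply: measurable_tnth_comp.
rewrite (_ : (fun z => _) = fun z => (if thead z.2 \in b z then 1
    else f z.1 (thead z.2)) * eprod (f z.1) (config_of (b z))).
  apply: measurable_funM.
    apply: measurable_fun_ifT => //; first exact: (measurable_mem mh mb).
    exact: (measurableT_comp mf (measurable_fun_pair measurable_fst mh)).
  exact: (measurableT_comp IH (measurable_fun_pair measurable_fst mb)).
apply/funext => -[p t] /=; rewrite [in LHS](tuple_eta t) /b /=.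
rewrite (config_of_cons (thead t) [tuple of behead t]).
case: ifPn => xt.
  rewrite mul1r; congr eprod; apply/fsetP => y; rewrite !inE.
  by case: eqP => // ->; rewrite xt.
by rewrite /eprod big_fsetU1// inE.
Qed.

End joint.
End measurability_on_configurations.

Section integrals_on_configurations.
Context (R : realType) (d : nat).
Hypothesis d_gt0 : (0 < d)%N.
Local Notation E := (Eucl R d).
Local Notation config := (Gamma0 R d).
Local Notation lambda := (lebesgue_poisson R d).

Section parameter.
Context d0 (P : measurableType d0).
Local Open Scope ereal_scope.

Lemma jointly_measurable_ge0_integral (F : P -> config -> \bar R) :
  jointly_measurable F -> (forall p eta, 0 <= F p eta) ->
  measurable_fun setT (fun p => \int[lambda]_eta F p eta).
Proof.
move=> mF F0; rewrite (_ : (fun p => _) = fun p =>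
    \sum_(n <oo) (n`!%:R^-1)%:E * \int[lebdn R d n]_t F p (config_of t)).
  apply: ge0_emeasurable_sum => n.
    by move=> p _ _; rewrite mule_ge0// ?lee_fin ?invr_ge0// integral_ge0.
  move=> _; apply: measurable_funeM.
  exact: (measurable_fun_fubini_tonelli_F (fun z : P * n.-tuple E =>
    F z.1 (config_of z.2)) (mF n) (fun z => F0 z.1 _)).
apply/funext => p; rewrite ge0_integral_lambda//.
exact: jointly_measurable_section.
Qed.

Lemma jointly_measurable_Rintegral (F : P -> config -> R) :
  jointly_measurable F ->
  measurable_fun setT (fun p => (\int[lambda]_eta F p eta)%R).
Proof.
(* Where the integral is infinite, [fine] returns 0, which does not disturb measurability. *)
move=> mF; apply: (measurableT_comp (fine_measurable measurableT)).
rewrite (_ : (fun p => _) = fun p =>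
    \int[lambda]_eta (EFin \o F p)^\+ eta -
    \int[lambda]_eta (EFin \o F p)^\- eta); last first.
  by apply/funext => p; rewrite integralE.
have mF' n : measurable_fun setT
    (fun z : P * n.-tuple E => (F z.1 (config_of z.2))%:E).
  by apply/measurable_EFinP; exact: mF.
apply: emeasurable_funB.
- apply: (jointly_measurable_ge0_integral (F := fun p => (EFin \o F p)^\+)) => // n.
  rewrite (_ : (fun z => _) = (fun z : P * n.-tuple E =>
    (F z.1 (config_of z.2))%:E)^\+); first exact: (measurable_funepos (mF' n)).
  by apply/funext => z; rewrite !funeposE.
- apply: (jointly_measurable_ge0_integral (F := fun p => (EFin \o F p)^\-)) => // n.
  rewrite (_ : (fun z => _) = (fun z : P * n.-tuple E =>
    (F z.1 (config_of z.2))%:E)^\-); first exact: (measurable_funeneg (mF' n)).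
  by apply/funext => z; rewrite !funenegE.
Qed.

Lemma measurable_parameter_Rintegral d1 (T : measurableType d1)
    (m : {sigma_finite_measure set T -> \bar R}) (g : P -> T -> R) :
  measurable_fun setT (fun z : P * T => g z.1 z.2) ->
  measurable_fun setT (fun p => (\int[m]_x g p x)%R).
Proof.
move=> mg; apply: (measurableT_comp (fine_measurable measurableT)).
rewrite (_ : (fun p => _) = fun p =>
    \int[m]_x (EFin \o g p)^\+ x - \int[m]_x (EFin \o g p)^\- x); last first.
  by apply/funext => p; rewrite integralE.
have mg' : measurable_fun setT (fun z : P * T => (g z.1 z.2)%:E).
  exact/measurable_EFinP.
apply: emeasurable_funB.
- apply: (measurable_fun_fubini_tonelli_F (fun z : P * T =>
    (EFin \o g z.1)^\+ z.2)) => //.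
  rewrite (_ : (fun z => _) = (fun z : P * T => (g z.1 z.2)%:E)^\+).
    exact: measurable_funepos.
  by apply/funext => z; rewrite !funeposE.
- apply: (measurable_fun_fubini_tonelli_F (fun z : P * T =>
    (EFin \o g z.1)^\- z.2)) => //.
  rewrite (_ : (fun z => _) = (fun z : P * T => (g z.1 z.2)%:E)^\-).
    exact: measurable_funeneg.
  by apply/funext => z; rewrite !funenegE.
Qed.

(** The integral over configurations is a series of integrals over tuples; Tonelli applies to each
    term, and a nonnegative series commutes with the integral over the parameter. *)
Lemma fubini_tonelli_lambda (m : {sigma_finite_measure set P -> \bar R})
    (F : P -> config -> \bar R) :
  jointly_measurable F -> (forall p eta, 0 <= F p eta) ->
  \int[lambda]_eta \int[m]_p F p eta = \int[m]_p \int[lambda]_eta F p eta.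
Proof.
move=> mF F0; have mFG n := measurable_fun_fubini_tonelli_G (m1 := m)
  (fun z : P * n.-tuple E => F z.1 (config_of z.2)) (mF n)
  (fun z => F0 z.1 _).
have mFF n := measurable_fun_fubini_tonelli_F (m2 := lebdn R d n)
  (fun z : P * n.-tuple E => F z.1 (config_of z.2)) (mF n)
  (fun z => F0 z.1 _).
rewrite ge0_integral_lambda//; last 2 first.
- apply: measurable_fun_Gamma0P => n.
  exact: (@measurable_funS _ _ _ _ setT _ _ measurableT _ (mFG n)).
- by move=> eta; exact: integral_ge0.
transitivity (\int[m]_p \sum_(n <oo)
    (n`!%:R^-1)%:E * \int[lebdn R d n]_t F p (config_of t)); last first.
  apply: eq_integral => p _; rewrite ge0_integral_lambda//.
  exact: jointly_measurable_section.
rewrite integral_nneseries//; last 2 first.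
- by move=> n; apply: measurable_funeM; exact: mFF.
- by move=> n p _; rewrite mule_ge0// ?lee_fin ?invr_ge0// integral_ge0.
apply: eq_eseriesr => n _; rewrite ge0_integralZl_EFin//; last 2 first.
- by move=> p _; exact: integral_ge0.
- exact: mFF.
by rewrite -(fubini_tonelli (fun z : P * n.-tuple E => F z.1 (config_of z.2))
  (mF n) (fun z => F0 z.1 _)).
Qed.

End parameter.

Lemma eprod_config_of (f : E -> R) n (t : n.-tuple E) : uniq t ->
  eprod f (config_of t) = \prod_(i < n) f (tnth t i).
Proof.
move=> ut; rewrite -(big_tuple _ _ t xpredT f) /eprod; apply: perm_big.
by apply: uniq_perm => // x; rewrite !inE.
Qed.

Lemma integral_prod_tuple (f : E -> R) (c : R) n :
  measurable_fun setT f -> (forall x, 0 <= f x) ->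
  (\int[lebd R d]_x (f x)%:E = c%:E)%E ->
  (\int[lebdn R d n]_t (\prod_(i < n) f (tnth t i))%:E = (c ^+ n)%:E)%E.
Proof.
move=> mf f0 fc; elim: n => [|n IH].
  rewrite integral_power_measure0 ?big_ord0//.
  rewrite (_ : (fun t => _) = cst 1%:E)//.
  by apply/funext => t; rewrite big_ord0.
have mp k : measurable_fun setT (fun t : k.-tuple E => (\prod_(i < k) f (tnth t i))%:E).
  apply/measurable_EFinP; apply: measurable_prod => i _.
  by apply: measurableT_comp => //; exact: measurable_tnth.
have p0 k (t : k.-tuple E) : 0 <= \prod_(i < k) f (tnth t i) by exact: prodr_ge0.
rewrite integral_power_measureS//; last by move=> t; rewrite lee_fin.
transitivity (\int[lebd R d]_x ((f x)%:E * (c ^+ n)%:E))%E.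
  apply: eq_integral => x _; rewrite -IH -ge0_integralZl_EFin//;
    [|by move=> t _; rewrite lee_fin|exact: mp].
  apply: eq_integral => t _; rewrite big_ord_recl /cons_pair tnth0 EFinM.
  by under eq_bigr do rewrite tnthS.
have c0 : 0 <= c.
  by rewrite -lee_fin -fc; apply: integral_ge0 => x _; rewrite lee_fin.
rewrite ge0_integralZr//; last 3 first.
- exact/measurable_EFinP.
- by move=> x _; rewrite lee_fin.
- by rewrite lee_fin exprn_ge0.
by rewrite fc -EFinM exprS.
Qed.

Lemma nneseries_expR (c : R) : 0 <= c ->
  (\sum_(n <oo) ((n`!%:R^-1)%:E * (c ^+ n)%:E) = (expR c)%:E)%E.
Proof.
move=> c0; rewrite /expR -EFin_lim; last exact: is_cvg_series_exp_coeff.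
congr (limn _); apply/funext => n /=.
rewrite /series/= -sumEFin; apply: eq_bigr => k _.
by rewrite /exp_coeff /= -EFinM mulrC.
Qed.

(** The exponential formula for the Lebesgue-Poisson measure: the integral over n points factorizes
    into c^n, and the weights 1/n! sum these powers to an exponential. *)
Lemma integral_lambda_eprod (f : E -> R) (c : R) :
  measurable_fun setT f -> (forall x, 0 <= f x) ->
  (\int[lebd R d]_x (f x)%:E = c%:E)%E ->
  (\int[lambda]_eta (eprod f eta)%:E = (expR c)%:E)%E.
Proof.
move=> mf f0 fc.
have c0 : 0 <= c.
  by rewrite -lee_fin -fc; apply: integral_ge0 => x _; rewrite lee_fin.
have mj : jointly_measurable (fun _ : unit => eprod f).
  apply: jointly_measurable_eprod.
  exact: (measurableT_comp mf measurable_snd).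
have me := jointly_measurable_section tt mj.
rewrite ge0_integral_lambda//; last 2 first.
- exact/measurable_EFinP.
- by move=> eta; rewrite lee_fin; exact: prodr_ge0.
rewrite -nneseries_expR//; apply: eq_eseriesr => n _; congr (_ * _)%E.
rewrite -(integral_prod_tuple _ mf f0 fc); apply: ae_eq_integral => //.
- apply/measurable_EFinP; exact: (measurableT_comp me (@measurable_config_of R d n)).
- apply/measurable_EFinP; apply: measurable_prod => i _.
  by apply: measurableT_comp => //; exact: measurable_tnth.
by move: (ae_uniq R d_gt0 n); apply: filterS => t ut _ /=; rewrite eprod_config_of.
Qed.

End integrals_on_configurations.

Section configuration_cardinality.
Context (R : realType) (d : nat).
Hypothesis d_gt0 : (0 < d)%N.
Local Notation E := (Eucl R d).
Local Notation config := (Gamma0 R d).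
Local Notation lambda := (lebesgue_poisson R d).

(** Under an integral over [xi], this splits the power of q in a growth bound at the union of [xi]
    and [rho] into one factor for each. *)
Lemma ae_disjoint_union (rho : config) :
  {ae lambda, forall xi : config,
    #|` xi `|` rho|%fset = (#|` xi| + #|` rho|)%N}.
Proof.
have [r [ur rE]] := config_of_surj rho.
pose D := [set xi : config | #|` xi `|` rho|%fset = (#|` xi| + #|` rho|)%N].
have DE n (t : n.-tuple E) : uniq t -> D (config_of t) <-> uniq (t ++ r).
  move=> ut; rewrite /D /= card_config_of// -{1}rE -config_of_cat.
  rewrite /config_of card_fseq /=; split => [h|u].
    apply/negPn/negP => nu; have := ltn_size_undup (t ++ r).
    by rewrite nu h size_cat !size_tuple ltnn.
  by rewrite undup_id// size_cat !size_tuple.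
have mD : measurable D.
  suff : Gamma0_measurable D by [].
  move=> n; rewrite (_ : level _ = [set t : n.-tuple E | uniq (t ++ r)]).
    have mf : measurable_fun setT (fun t : n.-tuple E => [tuple of t ++ r]).
      exact: measurable_cat_tuple.
    by have := mf measurableT _ (@measurable_distinct R d _); rewrite setTI.
  apply/seteqP; split => t /=.
    by move=> [ut /(DE _ _ ut)].
  move=> u; have ut : uniq t by move: u; rewrite cat_uniq => /andP[].
  by split => //; apply/DE.
apply/(ae_lambdaP d_gt0 mD) => n.
move: (@ae_uniq_cat R d d_gt0 n r ur); apply: filterS => t u.
by apply/DE => //; move: u; rewrite cat_uniq => /andP[].
Qed.

Lemma normr_eprod (f : E -> R) eta : `|eprod f eta| = eprod (fun x => `|f x|) eta.
Proof. by rewrite /eprod normr_prod. Qed.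

Lemma eprodZ (f : E -> R) (q : R) eta :
  eprod (fun x => q * f x) eta = q ^+ #|` eta| * eprod f eta.
Proof.
rewrite /eprod big_split /= big_const_seq count_predT iter_mulr_1.
by congr (_ ^+ _ * _).
Qed.

Lemma eprod_ge0 (f : E -> R) eta : (forall x, 0 <= f x) -> 0 <= eprod f eta.
Proof. by move=> f0; exact: prodr_ge0. Qed.

Lemma eprod_le1 (f : E -> R) eta : (forall x, 0 <= f x <= 1) -> eprod f eta <= 1.
Proof.
by move=> f01; apply: prodr_ile1 => x _.
Qed.

Lemma normr_Rintegral_le d0 (T : measurableType d0)
    (m : {measure set T -> \bar R}) (f : T -> R) : measurable_fun setT f ->
  ((`|\int[m]_x f x|)%:E <= \int[m]_x (`|f x|)%:E)%E.
Proof.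
move=> mf; have mf' : measurable_fun setT (EFin \o f) by exact/measurable_EFinP.
apply: (@le_trans _ _ `|\int[m]_x (f x)%:E|%E).
  (* An infinite integral has the real value 0, for which the bound is trivial. *)
  by rewrite /Rintegral; case: (\int[m]_x _)%E => [r||] //=; rewrite normr0 leey.
exact: (le_abse_integral m measurableT mf').
Qed.

End configuration_cardinality.

(** * Bounds for the operator *)

Section kernels.
Context (R : realType) (d : nat).
Hypothesis d_gt0 : (0 < d)%N.
Local Notation E := (Eucl R d).
Local Notation config := (Gamma0 R d).
Local Notation lambda := (lebesgue_poisson R d).
Local Notation dx := (lebd R d).
Variables a phi : E -> R.
Hypothesis a_ge0 : forall x, 0 <= a x.
Hypothesis phi_ge0 : forall x, 0 <= phi x.
Hypothesis a_meas : measurable_fun setT a.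
Hypothesis phi_meas : measurable_fun setT phi.
Hypothesis a_even : forall x, a x = a (Eucl_opp x).
Hypothesis phi_even : forall x, phi x = phi (Eucl_opp x).
Hypothesis a_int : (\int[dx]_x (a x)%:E < +oo)%E.
Hypothesis phi_int : (\int[dx]_x (1 - expR (- phi x))%:E < +oo)%E.

Local Notation al := (alpha a).
Local Notation c := (cphi phi).
Local Notation t_ := (tfun phi).
Local Notation tau_ := (taufun phi).

Lemma Eucl_oppB (x y : E) : Eucl_opp (Eucl_sub x y) = Eucl_sub y x.
Proof. by apply: eq_from_tnth => i; rewrite !tnth_mktuple opprB. Qed.

Lemma integral_aE : (\int[dx]_x (a x)%:E = al%:E)%E.
Proof.
rewrite fineK// ge0_fin_numE//; apply: integral_ge0 => x _.
by rewrite lee_fin.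
Qed.

Lemma alpha_ge0 : 0 <= al.
Proof. exact: Rintegral_ge0. Qed.

Lemma phi_factor_ge0 x : 0 <= 1 - expR (- phi x).
Proof. by rewrite subr_ge0 -expR0 ler_expR oppr_le0. Qed.

Lemma cphi_ge0 : 0 <= c.
Proof. by apply: Rintegral_ge0 => x _; exact: phi_factor_ge0. Qed.

Lemma integral_cphiE : (\int[dx]_x (1 - expR (- phi x))%:E = c%:E)%E.
Proof.
rewrite fineK// ge0_fin_numE//; apply: integral_ge0 => x _.
by rewrite lee_fin phi_factor_ge0.
Qed.

Lemma measurable_Eucl_sub d0 (P : measurableType d0) (f g : P -> E) :
  measurable_fun setT f -> measurable_fun setT g ->
  measurable_fun setT (fun p => Eucl_sub (f p) (g p)).
Proof.
move=> mf mg; apply/measurable_fun_tnthP => i.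
rewrite (_ : _ \o _ = fun p => (tnth (f p) i : R) - tnth (g p) i).
  by apply: measurable_funB; exact: measurable_tnth_comp.
by apply/funext => p /=; rewrite tnth_mktuple.
Qed.

Lemma measurable_a d0 (P : measurableType d0) (f g : P -> E) :
  measurable_fun setT f -> measurable_fun setT g ->
  measurable_fun setT (fun p => a (Eucl_sub (f p) (g p))).
Proof. by move=> mf mg; exact: (measurableT_comp a_meas (measurable_Eucl_sub mf mg)). Qed.

Lemma measurable_tfun d0 (P : measurableType d0) (f g : P -> E) :
  measurable_fun setT f -> measurable_fun setT g ->
  measurable_fun setT (fun p => t_ (f p) (g p)).
Proof.
move=> mf mg; apply: measurable_funB => //.
apply: (measurableT_comp (@measurable_expR R)).
apply: measurable_funN.
exact: (measurableT_comp phi_meas (measurable_Eucl_sub mf mg)).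
Qed.

(** Evenness brings the variable of integration to the first place in the difference, the form to
    which the translation lemma applies. *)
Lemma normr_tfun x y : `|t_ x y| = 1 - expR (- phi (Eucl_sub y x)).
Proof.
rewrite /tfun phi_even Eucl_oppB ler0_norm ?opprB//.
by rewrite -oppr_ge0 opprB phi_factor_ge0.
Qed.

Lemma taufun01 x y : 0 <= tau_ x y <= 1.
Proof.
rewrite /taufun /tfun subrK expR_ge0 /=.
by rewrite -expR0 ler_expR oppr_le0.
Qed.

Lemma measurable_taufun d0 (P : measurableType d0) (f g : P -> E) :
  measurable_fun setT f -> measurable_fun setT g ->
  measurable_fun setT (fun p => tau_ (f p) (g p)).
Proof. by move=> mf mg; apply: measurable_funD => //; exact: measurable_tfun. Qed.

Lemma integral_aB y : (\int[dx]_x (a (Eucl_sub x y))%:E = al%:E)%E.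
Proof.
rewrite -integral_aE (ge0_integral_lebd_translation (f := EFin \o a))//.
exact/measurable_EFinP.
Qed.

Lemma integral_aBr x : (\int[dx]_y (a (Eucl_sub x y))%:E = al%:E)%E.
Proof.
by rewrite -(integral_aB x); apply: eq_integral => y _; rewrite a_even Eucl_oppB.
Qed.

Lemma integral_normr_tfun y : (\int[dx]_x (`|t_ y x|)%:E = c%:E)%E.
Proof.
rewrite -integral_cphiE.
rewrite -(ge0_integral_lebd_translation (f := fun x => (1 - expR (- phi x))%:E) y).
- by apply: eq_integral => x _; rewrite normr_tfun.
- apply/measurable_EFinP; apply: measurable_funB => //.
  apply: (measurableT_comp (@measurable_expR R)).
  exact: measurable_funN.
- by move=> x; rewrite lee_fin phi_factor_ge0.
Qed.

Definition inner (k : config -> R) (y : E) (rho : config) : R :=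
  \int[lambda]_xi (eprod (t_ y) xi * k (xi `|` rho)%fset).

(* What the y-summand of LDelta integrates over the landing point x, the other
   particles being rho. *)
Definition gain (k : config -> R) (y : E) (rho : config) (x : E) : R :=
  a (Eucl_sub x y) * eprod (tau_ y) (x |` rho)%fset * inner k y (x |` rho)%fset.

Definition loss (k : config -> R) (eta xi : config) : R :=
  k (xi `|` eta)%fset * \sum_(x <- eta) \int[dx]_y
    (a (Eucl_sub x y) * eprod (tau_ y) eta * eprod (t_ y) xi).

Lemma LDeltaE k eta : LDelta a phi k eta =
  \sum_(y <- eta) \int[dx]_x gain k y (eta `\ y)%fset x -
  \int[lambda]_xi loss k eta xi.
Proof. by []. Qed.

Section measurability.
Variable k : config -> R.
Hypothesis mk : measurable_fun setT k.

Lemma jointly_measurable_inner m :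
  jointly_measurable (fun (p : E * m.-tuple E) xi =>
    eprod (t_ p.1) xi * k (xi `|` config_of p.2)%fset).
Proof.
apply: jointly_measurableM; last exact: jointly_measurable_union.
apply: (jointly_measurable_eprod (f := fun p : E * m.-tuple E => t_ p.1)).
apply: measurable_tfun => //.
exact: (measurableT_comp measurable_fst measurable_fst).
Qed.

Lemma measurable_inner_integrand y rho :
  measurable_fun setT (fun xi => eprod (t_ y) xi * k (xi `|` rho)%fset).
Proof.
have [r [_ <-]] := config_of_surj rho.
by have := jointly_measurable_section (y, r) (@jointly_measurable_inner _).
Qed.

Lemma measurable_gain m :
  measurable_fun setT (fun z : (E * m.-tuple E) * E =>
    gain k z.1.1 (config_of z.1.2) z.2).
Proof.
have m11 : measurable_fun setT (fun z : (E * m.-tuple E) * E => z.1.1).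
  exact: (measurableT_comp measurable_fst measurable_fst).
have m12 : measurable_fun setT (fun z : (E * m.-tuple E) * E => z.1.2).
  exact: (measurableT_comp measurable_snd measurable_fst).
have mc : measurable_fun setT (fun z : (E * m.-tuple E) * E =>
    (z.1.1, cons_pair (z.2, z.1.2))).
  apply: measurable_fun_pair => //.
  apply: (measurableT_comp (@measurable_cons_pair _ _ _)).
  exact: measurable_fun_pair.
rewrite /gain; apply: measurable_funM; first apply: measurable_funM.
- exact: measurable_a.
- have mt : measurable_fun setT (fun z : E * E => tau_ z.1 z.2).
    exact: measurable_taufun.
  have me : jointly_measurable (fun y => eprod (tau_ y)).
    exact: jointly_measurable_eprod.
  have := measurableT_comp (me m.+1) mc.
  by congr measurable_fun; apply/funext => z /=; rewrite config_of_cons.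
- have := measurableT_comp (jointly_measurable_Rintegral d_gt0
    (@jointly_measurable_inner m.+1)) mc.
  by congr measurable_fun; apply/funext => z /=; rewrite config_of_cons.
Qed.

Lemma measurable_gain_section y rho : measurable_fun setT (gain k y rho).
Proof.
have [r [_ <-]] := config_of_surj rho.
exact: (measurableT_comp (@measurable_gain _) (pair1_measurable (y, r))).
Qed.

(** The sum runs over positions in the tuple. This is measurable on all tuples and agrees with
    [loss] on tuples of distinct points. *)
Lemma jointly_measurable_loss n :
  jointly_measurable (fun (t : n.-tuple E) xi =>
    k (xi `|` config_of t)%fset * \sum_(i < n) \int[dx]_y
    (a (Eucl_sub (tnth t i) y) * eprod (tau_ y) (config_of t) *
     eprod (t_ y) xi)).
Proof.
apply: jointly_measurableM.
  exact: (jointly_measurable_union (h := id)).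
move=> N; apply: measurable_sum => i.
apply: (measurable_parameter_Rintegral dx (g := fun (z : n.-tuple E * N.-tuple E) y =>
  a (Eucl_sub (tnth z.1 i) y) * eprod (tau_ y) (config_of z.1) *
     eprod (t_ y) (config_of z.2))).
have m11 : measurable_fun setT (fun z : (n.-tuple E * N.-tuple E) * E => z.1.1).
  exact: (measurableT_comp measurable_fst measurable_fst).
have m12 : measurable_fun setT (fun z : (n.-tuple E * N.-tuple E) * E => z.1.2).
  exact: (measurableT_comp measurable_snd measurable_fst).
apply: measurable_funM; first apply: measurable_funM.
- by apply: measurable_a => //; exact: measurable_tnth_comp.
- have mt : measurable_fun setT (fun z : E * E => tau_ z.1 z.2).
    exact: measurable_taufun.
  have me : jointly_measurable (fun y => eprod (tau_ y)).
    exact: jointly_measurable_eprod.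
  exact: (measurableT_comp (me n) (measurable_fun_pair measurable_snd m11)).
- have mt : measurable_fun setT (fun z : E * E => t_ z.1 z.2).
    exact: measurable_tfun.
  have me : jointly_measurable (fun y => eprod (t_ y)).
    exact: jointly_measurable_eprod.
  exact: (measurableT_comp (me N) (measurable_fun_pair measurable_snd m12)).
Qed.

Lemma big_config_of (V : nmodType) (F : E -> V) n (t : n.-tuple E) : uniq t ->
  \sum_(y <- config_of t) F y = \sum_(i < n) F (tnth t i).
Proof.
move=> ut; rewrite -(big_tuple _ _ t xpredT F); apply: perm_big.
by apply: uniq_perm => // x; rewrite !inE.
Qed.

Lemma config_of_delete n (t : n.+1.-tuple E) i : uniq t ->
  (config_of t `\ tnth t i)%fset = config_of (delete_tuple i t).
Proof.
move=> /tuple_uniqP ut; apply/fsetP => x; rewrite !inE; apply/andP/tnthP.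
  case=> xi /tnthP[j xj]; case: (unliftP i j) => [l jl|ji].
    by exists l; rewrite tnth_mktuple -jl.
  by rewrite xj ji eqxx in xi.
move=> [l ->]; rewrite tnth_mktuple mem_tnth; split => //.
by apply/eqP => /ut /eqP; rewrite eq_sym (negbTE (neq_lift _ _)).
Qed.

Lemma LDelta_config_of n (t : n.-tuple E) : uniq t ->
  LDelta a phi k (config_of t) =
  \sum_(i < n) \int[dx]_x gain k (tnth t i) (config_of t `\ tnth t i)%fset x -
  \int[lambda]_xi (k (xi `|` config_of t)%fset * \sum_(i < n) \int[dx]_y
    (a (Eucl_sub (tnth t i) y) * eprod (tau_ y) (config_of t) *
     eprod (t_ y) xi)).
Proof.
move=> ut; rewrite LDeltaE big_config_of//; congr (_ - _).
by apply: eq_Rintegral => xi _; rewrite /loss big_config_of.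
Qed.

Lemma measurable_loss eta : measurable_fun setT (loss k eta).
Proof.
have [r [ur rE]] := config_of_surj eta.
have := jointly_measurable_section r (@jointly_measurable_loss _).
congr measurable_fun; apply/funext => xi.
by rewrite /loss -[in RHS]rE big_config_of// rE.
Qed.

Lemma measurable_LDelta : measurable_fun setT (LDelta a phi k).
Proof.
apply: measurable_fun_Gamma0P => n.
pose G (t : n.-tuple E) :=
  \sum_(i < n) \int[dx]_x gain k (tnth t i) (config_of t `\ tnth t i)%fset x.
apply: (eq_measurable_fun (fun t => G t - _)).
  by move=> t; rewrite inE => ut; rewrite LDelta_config_of.
apply: measurable_funB; last first.
  apply: (@measurable_funS _ _ _ _ setT) => //.
  exact: (jointly_measurable_Rintegral d_gt0 (@jointly_measurable_loss n)).
rewrite /G; case: n G => [|n] _.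
  rewrite (_ : (fun t => _) = cst 0)//.
  by apply/funext => t; rewrite big_ord0.
(* The particles other than the jumping one are enumerated by deleting an entry, a measurable
   operation on tuples. *)
apply: (eq_measurable_fun (fun t : n.+1.-tuple E => \sum_(i < n.+1)
  \int[dx]_x gain k (tnth t i) (config_of (delete_tuple i t)) x)).
  move=> t; rewrite inE /= => ut; apply: eq_bigr => i _.
  by rewrite config_of_delete.
apply: measurable_sum => i; apply: (@measurable_funS _ _ _ _ setT) => //.
have mp : measurable_fun setT (fun t : n.+1.-tuple E =>
    (tnth t i, delete_tuple i t)).
  apply: measurable_fun_pair; first exact: measurable_tnth.
  exact: measurable_delete_tuple.
have mG := measurable_parameter_Rintegral dx
  (g := fun p : E * n.-tuple E => gain k p.1 (config_of p.2)) (@measurable_gain n).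
exact: (measurableT_comp mG mp).
Qed.

End measurability.
End kernels.

(** * The pointwise operator bound and linearity *)

Section operator_bounds.
Context (R : realType) (d : nat).
Hypothesis d_gt0 : (0 < d)%N.
Local Notation E := (Eucl R d).
Local Notation config := (Gamma0 R d).
Local Notation lambda := (lebesgue_poisson R d).
Local Notation dx := (lebd R d).
Variables a phi : E -> R.
Hypothesis a_ge0 : forall x, 0 <= a x.
Hypothesis phi_ge0 : forall x, 0 <= phi x.
Hypothesis a_meas : measurable_fun setT a.
Hypothesis phi_meas : measurable_fun setT phi.
Hypothesis a_even : forall x, a x = a (Eucl_opp x).
Hypothesis phi_even : forall x, phi x = phi (Eucl_opp x).
Hypothesis a_int : (\int[dx]_x (a x)%:E < +oo)%E.
Hypothesis phi_int : (\int[dx]_x (1 - expR (- phi x))%:E < +oo)%E.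

Local Notation al := (alpha a).
Local Notation c := (cphi phi).
Local Notation t_ := (tfun phi).
Local Notation tau_ := (taufun phi).
Local Notation L := (LDelta a phi).

Lemma ae_notin_config (rho : config) : {ae dx, forall x, x \notin rho}.
Proof. exact: (ae_notin_Eucl d_gt0 rho). Qed.

Lemma normr_eprod_taufun_le1 y rho : `|eprod (tau_ y) rho| <= 1.
Proof.
rewrite normr_eprod; apply: eprod_le1 => x.
by have /andP[t0 t1] := taufun01 phi_ge0 y x; rewrite ger0_norm// t0 t1.
Qed.

(** The factor q is placed inside the product so that the exponential formula gives the integral
    exp(q c). *)
Definition weight (q : R) (y : E) (xi : config) : R :=
  eprod (fun x => q * `|t_ y x|) xi.

Lemma weightE q y xi : weight q y xi = q ^+ #|` xi| * `|eprod (t_ y) xi|.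
Proof. by rewrite /weight eprodZ normr_eprod. Qed.

Lemma weight_ge0 q y xi : 0 <= q -> 0 <= weight q y xi.
Proof. by move=> q0; apply: eprod_ge0 => x; rewrite mulr_ge0. Qed.

Lemma jointly_measurable_weight q :
  jointly_measurable (weight q).
Proof.
apply: (jointly_measurable_eprod (f := fun y x => q * `|t_ y x|)).
apply: measurable_funM => //; apply: measurableT_comp => //.
exact: measurable_tfun.
Qed.

Lemma integral_weight q y : 0 <= q ->
  (\int[lambda]_xi (weight q y xi)%:E = (expR (q * c))%:E)%E.
Proof.
move=> q0; have mt : measurable_fun setT (fun x => `|t_ y x|).
  apply: measurableT_comp => //.
  exact: (measurable_tfun phi_meas (measurable_cst y) (@measurable_id _ _ _)).
apply: (integral_lambda_eprod d_gt0).
- exact: measurable_funM.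
- by move=> x; rewrite mulr_ge0.
under eq_integral do rewrite EFinM.
rewrite ge0_integralZl_EFin//; last exact/measurable_EFinP.
by rewrite (integral_normr_tfun phi_ge0).
Qed.

Section growth.
Variables (q C : R).
Hypothesis q_ge0 : 0 <= q.
Hypothesis C_ge0 : 0 <= C.
Variable k : config -> R.
Hypothesis mk : measurable_fun setT k.
Hypothesis kC : forall eta, `|k eta| <= C * q ^+ #|` eta|.

(** The growth bound at the union splits for almost every [xi]: the power of q belonging to [xi] is
    absorbed into [weight], and the one belonging to [rho] leaves the integral. *)
Lemma integral_inner_le y rho :
  (\int[lambda]_xi (`|eprod (t_ y) xi * k (xi `|` rho)%fset|)%:E <=
   (C * q ^+ #|` rho| * expR (q * c))%:E)%E.
Proof.
rewrite [leRHS]EFinM -(integral_weight y q_ge0) -ge0_integralZl_EFin//; last 3 first.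
- by move=> xi _; rewrite lee_fin weight_ge0.
- apply/measurable_EFinP.
  exact: (jointly_measurable_section y (jointly_measurable_weight q)).
- by rewrite mulr_ge0// exprn_ge0.
apply: ae_ge0_le_integral => //.
- apply/measurable_EFinP/measurableT_comp => //.
  exact: measurable_inner_integrand.
- by move=> xi _; rewrite lee_fin mulr_ge0 ?weight_ge0// mulr_ge0// exprn_ge0.
- apply: measurable_funeM; apply/measurable_EFinP.
  exact: (jointly_measurable_section y (jointly_measurable_weight q)).
move: (ae_disjoint_union d_gt0 rho); apply: filterS => xi card_xi _.
rewrite -EFinM lee_fin normrM weightE.
apply: le_trans (ler_wpM2l (normr_ge0 _) (kC _)) _.
by rewrite card_xi exprD; lra.
Qed.

Lemma normr_inner_le y rho :
  `|inner phi k y rho| <= C * q ^+ #|` rho| * expR (q * c).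
Proof.
rewrite -lee_fin; apply: le_trans (integral_inner_le y rho).
apply: normr_Rintegral_le; exact: measurable_inner_integrand.
Qed.

Lemma integrable_inner y rho :
  lambda.-integrable setT (EFin \o (fun xi => eprod (t_ y) xi * k (xi `|` rho)%fset)).
Proof.
apply/integrableP; split.
  apply/measurable_EFinP; exact: measurable_inner_integrand.
exact: le_lt_trans (integral_inner_le y rho) (ltry _).
Qed.

Lemma integral_gain_le y rho :
  (\int[dx]_x (`|gain a phi k y rho x|)%:E <=
   (al * (C * q ^+ #|` rho|.+1 * expR (q * c)))%:E)%E.
Proof.
rewrite [leRHS]EFinM -(integral_aB a_ge0 a_meas a_int y) -ge0_integralZr//; last 3 first.
- apply/measurable_EFinP.
  exact: (measurable_a a_meas (@measurable_id _ _ _) (measurable_cst y)).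
- by move=> x _; rewrite lee_fin.
- by rewrite lee_fin !mulr_ge0 ?exprn_ge0 ?expR_ge0.
have mg := measurable_gain_section d_gt0 a_meas phi_meas mk y rho.
apply: ae_ge0_le_integral => //.
- by apply/measurable_EFinP/measurableT_comp.
- by move=> x _; rewrite lee_fin !mulr_ge0 ?exprn_ge0 ?expR_ge0.
- apply/measurable_EFinP; apply: measurable_funM => //.
  exact: (measurable_a a_meas (@measurable_id _ _ _) (measurable_cst y)).
(* Almost every landing point lies outside [rho], whence one more power of q. *)
move: (ae_notin_config rho); apply: filterS => x xrho _.
rewrite -EFinM lee_fin !normrM (ger0_norm (a_ge0 _)) -mulrA.
apply: ler_wpM2l => //.
have := normr_inner_le y (x |` rho)%fset; rewrite cardfsU1 xrho add1n.
apply: le_trans; rewrite -[leRHS]mul1r ler_wpM2r//.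
exact: normr_eprod_taufun_le1.
Qed.

Lemma integrable_gain y rho :
  dx.-integrable setT (EFin \o gain a phi k y rho).
Proof.
apply/integrableP; split.
  by apply/measurable_EFinP; exact: measurable_gain_section.
exact: le_lt_trans (integral_gain_le y rho) (ltry _).
Qed.

(** Majorizes the contribution of the particle [x] to [loss], including the power of q that the
    growth bound on [k] produces. *)
Let drift (x : E) (xi : config) : \bar R :=
  (\int[dx]_y (a (Eucl_sub x y) * weight q y xi)%:E)%E.

Let jointly_measurable_drift x :
  jointly_measurable (fun y xi => (a (Eucl_sub x y) * weight q y xi)%:E).
Proof.
move=> n; apply/measurable_EFinP.
have mj := jointly_measurableM (jointly_measurable_cst
  (measurable_a a_meas (measurable_cst x) (@measurable_id _ _ _)))
  (jointly_measurable_weight q).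
exact: mj.
Qed.

Let drift_term_ge0 x y xi : (0 <= (a (Eucl_sub x y) * weight q y xi)%:E)%E.
Proof. by rewrite lee_fin mulr_ge0 ?weight_ge0. Qed.

Let measurable_drift x : measurable_fun setT (drift x).
Proof.
apply: measurable_fun_Gamma0P => n.
apply: (@measurable_funS _ _ _ _ setT) => //.
exact: (measurable_fun_fubini_tonelli_G (m1 := dx) (fun z : E * n.-tuple E =>
  (a (Eucl_sub x z.1) * weight q z.1 (config_of z.2))%:E)
  (@jointly_measurable_drift x n) (fun z => drift_term_ge0 x z.1 _)).
Qed.

Let drift_ge0 x xi : (0 <= drift x xi)%E.
Proof. by apply: integral_ge0 => y _; exact: drift_term_ge0. Qed.

(** Tonelli puts the integral over [xi] first: [weight] has the same mass exp(q c) for every [y],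
    and the kernel [a] then contributes alpha. *)
Let integral_drift x : (\int[lambda]_xi drift x xi = (al * expR (q * c))%:E)%E.
Proof.
rewrite (fubini_tonelli_lambda d_gt0 dx (@jointly_measurable_drift x)
  (drift_term_ge0 x)).
rewrite EFinM -(integral_aBr a_ge0 a_meas a_even a_int x) -ge0_integralZr//.
- apply: eq_integral => y _; rewrite -(integral_weight y q_ge0).
  rewrite -ge0_integralZl_EFin//.
  + by move=> xi _; rewrite lee_fin weight_ge0.
  + apply/measurable_EFinP.
    exact: (jointly_measurable_section y (jointly_measurable_weight q)).
- apply/measurable_EFinP.
  exact: (measurable_a a_meas (measurable_cst x) (@measurable_id _ _ _)).
- by move=> y _; rewrite lee_fin.

Qed.

Lemma integral_loss_le eta :
  (\int[lambda]_xi (`|loss a phi k eta xi|)%:E <=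
   (al * #|` eta|%:R * (C * q ^+ #|` eta| * expR (q * c)))%:E)%E.
Proof.
have sumE : (\sum_(x <- eta) (al * expR (q * c))%:E =
    (al * expR (q * c) * #|` eta|%:R)%:E)%E.
  by rewrite sumEFin big_const_seq count_predT iter_addr_0 mulr_natr.
have -> : al * #|` eta|%:R * (C * q ^+ #|` eta| * expR (q * c)) =
    C * q ^+ #|` eta| * (al * expR (q * c) * #|` eta|%:R).
  by move: (expR _) (_%:R) (q ^+ _) => e N Q; ring.
rewrite EFinM -sumE; under eq_bigr => x _ do rewrite -(integral_drift x).
rewrite -ge0_integral_sum// -ge0_integralZl_EFin//; last 3 first.
- by move=> xi _; exact: sume_ge0.
- exact: emeasurable_sum.
- by rewrite mulr_ge0 ?exprn_ge0.
apply: ae_ge0_le_integral => //.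
- by apply/measurable_EFinP/measurableT_comp => //; exact: measurable_loss.
- by move=> xi _; rewrite mule_ge0 ?lee_fin ?mulr_ge0 ?exprn_ge0// sume_ge0.
- by apply: measurable_funeM; exact: emeasurable_sum.
move: (ae_disjoint_union d_gt0 eta); apply: filterS => xi card_xi _.
pose J x := \int[dx]_y
  (a (Eucl_sub x y) * eprod (tau_ y) eta * eprod (t_ y) xi).
have Jle x : ((q ^+ #|` xi| * `|J x|)%:E <= drift x xi)%E.
  have mt : measurable_fun setT (fun y => eprod (t_ y) xi).
    have [r [_ <-]] := config_of_surj xi.
    have me : jointly_measurable (fun y => eprod (t_ y)).
      exact: jointly_measurable_eprod (measurable_tfun phi_meas _ _).
    exact: (measurableT_comp (me _) (pair2_measurable r)).
  have mtau : measurable_fun setT (fun y => eprod (tau_ y) eta).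
    have [r [_ <-]] := config_of_surj eta.
    have me : jointly_measurable (fun y => eprod (tau_ y)).
      exact: jointly_measurable_eprod (measurable_taufun phi_meas _ _).
    exact: (measurableT_comp (me _) (pair2_measurable r)).
  have mJ : measurable_fun setT (fun y =>
      a (Eucl_sub x y) * eprod (tau_ y) eta * eprod (t_ y) xi).
    apply: measurable_funM => //; apply: measurable_funM => //.
    exact: (measurable_a a_meas (measurable_cst x) (@measurable_id _ _ _)).
  rewrite EFinM; apply: (@le_trans _ _ ((q ^+ #|` xi|)%:E * \int[dx]_y
      `|a (Eucl_sub x y) * eprod (tau_ y) eta * eprod (t_ y) xi|%:E)%E).
    by rewrite lee_wpmul2l ?lee_fin ?exprn_ge0//; exact: normr_Rintegral_le.
  rewrite -ge0_integralZl_EFin ?exprn_ge0//; last first.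
    by apply/measurable_EFinP/measurableT_comp.
  apply: ge0_le_integral => //.
  - by move=> y _; rewrite mule_ge0 ?lee_fin ?exprn_ge0.
  - apply: measurable_funeM; exact/measurable_EFinP/measurableT_comp.
  - apply/measurable_EFinP; apply: measurable_funM.
      exact: (measurable_a a_meas (measurable_cst x) (@measurable_id _ _ _)).
    under eq_fun do rewrite weightE.
    by apply: measurable_funM => //; exact: measurableT_comp.
  move=> y _; rewrite -EFinM lee_fin weightE !normrM (ger0_norm (a_ge0 _)).
  rewrite (_ : _ * (_ * _ * _) = a (Eucl_sub x y) *
      (q ^+ #|` xi| * `|eprod (t_ y) xi|) * `|eprod (tau_ y) eta|).
    apply: ler_piMr; first by rewrite !mulr_ge0 ?exprn_ge0.
    exact: normr_eprod_taufun_le1.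
  by move: (_ ^+ _) (`|_|) (`|_|) => u v w; ring.
apply: (@le_trans _ _ ((C * q ^+ #|` eta|)%:E *
    \sum_(x <- eta) (q ^+ #|` xi| * `|J x|)%:E)%E); last first.
  by rewrite lee_wpmul2l ?lee_fin ?mulr_ge0 ?exprn_ge0//; exact: lee_sum.
rewrite sumEFin -EFinM lee_fin -mulr_sumr normrM mulrA.
apply: ler_pM => //; last exact: ler_norm_sum.
by apply: le_trans (kC _) _; rewrite card_xi exprD; lra.
Qed.

Lemma integrable_loss eta :
  lambda.-integrable setT (EFin \o loss a phi k eta).
Proof.
apply/integrableP; split.
  by apply/measurable_EFinP; exact: measurable_loss.
exact: le_lt_trans (integral_loss_le eta) (ltry _).
Qed.

(** A jump preserves the number of particles, so the gain has the same power of q as the loss. Both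
    obey the same bound, whence the factor 2. *)
Lemma normr_LDelta_le eta :
  `|L k eta| <= 2 * al * #|` eta|%:R * expR (q * c) * (C * q ^+ #|` eta|).
Proof.
rewrite LDeltaE; apply: le_trans (ler_normB _ _) _.
set B := C * q ^+ #|` eta|.
have -> : 2 * al * #|` eta|%:R * expR (q * c) * B =
  al * (B * expR (q * c)) *+ #|` eta| + al * #|` eta|%:R * (B * expR (q * c)).
  by rewrite -[X in X + _]mulr_natr; move: (#|` eta|%:R : R) => N; ring.
apply: lerD; last first.
  rewrite -lee_fin; apply: le_trans (integral_loss_le eta).
  by apply: normr_Rintegral_le; exact: measurable_loss.
apply: le_trans (ler_norm_sum _ _ _) _.
rewrite -[leRHS]iter_addr_0 -[X in iter X]count_predT -big_const_seq.
rewrite big_seq [leRHS]big_seq; apply: ler_sum => y yeta.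
rewrite -lee_fin /B (cardfsD1 y eta) yeta add1n.
apply: le_trans (integral_gain_le y (eta `\ y)%fset).
by apply: normr_Rintegral_le; exact: measurable_gain_section.
Qed.

End growth.

Section linearity.
Variables (q C1 C2 : R).
Hypothesis q_ge0 : 0 <= q.
Hypothesis C1_ge0 : 0 <= C1.
Hypothesis C2_ge0 : 0 <= C2.
Variables k1 k2 : config -> R.
Hypothesis mk1 : measurable_fun setT k1.
Hypothesis mk2 : measurable_fun setT k2.
Hypothesis kC1 : forall eta, `|k1 eta| <= C1 * q ^+ #|` eta|.
Hypothesis kC2 : forall eta, `|k2 eta| <= C2 * q ^+ #|` eta|.

(** The growth bounds make every integral converge absolutely, and only then is the real-valued
    integral additive. *)
Lemma LDelta_linear (r : R) eta :
  L (fun xi => r * k1 xi + k2 xi) eta = r * L k1 eta + L k2 eta.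
Proof.
have RintegralZD d0 (T : measurableType d0) (m : {measure set T -> \bar R})
    (f g : T -> R) : m.-integrable setT (EFin \o f) ->
    m.-integrable setT (EFin \o g) ->
    \int[m]_x (r * f x + g x) = r * \int[m]_x f x + \int[m]_x g x.
  move=> fi gi; rewrite RintegralD//; last exact: (integrableZl measurableT r fi).
  by rewrite RintegralZl.
have innerE y rho : inner phi (fun xi => r * k1 xi + k2 xi) y rho =
    r * inner phi k1 y rho + inner phi k2 y rho.
  rewrite /inner -RintegralZD; last 2 first.
  - exact: (integrable_inner q_ge0 C1_ge0 mk1 kC1).
  - exact: (integrable_inner q_ge0 C2_ge0 mk2 kC2).
  by apply: eq_Rintegral => xi _; ring.
have gainE y rho : \int[dx]_x gain a phi (fun xi => r * k1 xi + k2 xi) y rho x =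
    r * \int[dx]_x gain a phi k1 y rho x + \int[dx]_x gain a phi k2 y rho x.
  rewrite -RintegralZD; last 2 first.
  - exact: (integrable_gain q_ge0 C1_ge0 mk1 kC1).
  - exact: (integrable_gain q_ge0 C2_ge0 mk2 kC2).
  by apply: eq_Rintegral => x _; rewrite /gain innerE; ring.
have lossE : \int[lambda]_xi loss a phi (fun xi => r * k1 xi + k2 xi) eta xi =
    r * \int[lambda]_xi loss a phi k1 eta xi + \int[lambda]_xi loss a phi k2 eta xi.
  rewrite -RintegralZD; last 2 first.
  - exact: (integrable_loss q_ge0 C1_ge0 mk1 kC1).
  - exact: (integrable_loss q_ge0 C2_ge0 mk2 kC2).
  by apply: eq_Rintegral => xi _; rewrite /loss; ring.
rewrite !LDeltaE lossE.
under eq_bigr do rewrite gainE.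
by rewrite big_split /= -mulr_sumr; ring.
Qed.

End linearity.
End operator_bounds.

(** * The operator on classes of functions *)

Section almost_everywhere_invariance.
Context (R : realType) (d : nat).
Hypothesis d_gt0 : (0 < d)%N.
Local Notation E := (Eucl R d).
Local Notation config := (Gamma0 R d).
Local Notation lambda := (lebesgue_poisson R d).
Local Notation dx := (lebd R d).

Lemma measurable_eq_real d0 (P : measurableType d0) (f g : P -> R) :
  measurable_fun setT f -> measurable_fun setT g -> measurable [set p | f p = g p].
Proof.
move=> mf mg; rewrite (_ : [set p | _] = (f \- g) @^-1` [set 0]).
  by rewrite -[X in measurable X]setTI; exact: measurable_funB.
by apply/seteqP; split => p /= => [->|/eqP]; [rewrite subrr|rewrite subr_eq0 => /eqP].
Qed.

Section translates.
Variable D : set config.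
Hypothesis mD : measurable D.

Let mDU (r : config) : measurable [set xi : config | D (xi `|` r)%fset].
Proof.
have [s [_ <-]] := config_of_surj r.
suff : Gamma0_measurable [set xi : config | D (xi `|` config_of s)%fset] by [].
move=> n; apply: measurableI; first exact: measurable_distinct.
have mf : measurable_fun setT (fun t : n.-tuple E => config_of [tuple of t ++ s]).
  apply: (measurableT_comp (@measurable_config_of R d _)).
  exact: measurable_cat_tuple.
have := mf measurableT _ mD; rewrite setTI; congr measurable.
by apply/seteqP; split => t; rewrite /preimage /= config_of_cat.
Qed.

Let mDcat n j :
  measurable [set z : n.-tuple E * j.-tuple E | D (config_of [tuple of z.2 ++ z.1])].
Proof.
have mf : measurable_fun setT (fun z : n.-tuple E * j.-tuple E =>
    config_of [tuple of z.2 ++ z.1]).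
  apply: (measurableT_comp (@measurable_config_of R d _)).
  exact: measurable_cat_tuple.
by have := mf measurableT _ mD; rewrite setTI.
Qed.

(** For [D] the set where two functions agree, these are the tuples at which the integrals over [xi]
    in [LDelta] do not distinguish them. *)
Definition ae_translate n : set (n.-tuple E) :=
  [set t : n.-tuple E | {ae lambda, forall xi : config, D (xi `|` config_of t)%fset}].

Lemma ae_translateE n : @ae_translate n = \bigcap_j
  [set t : n.-tuple E | {ae lebdn R d j, forall s : j.-tuple E, D (config_of [tuple of s ++ t])}].
Proof.
apply/seteqP; split => t.
  move=> /(ae_lambdaP d_gt0 (mDU _)) h j _; apply: filterS (h j) => s.
  by rewrite config_of_cat.
move=> h; apply/(ae_lambdaP d_gt0 (mDU _)) => j; apply: filterS (h j I) => s.
by rewrite config_of_cat.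
Qed.

Lemma measurable_ae_translate n : measurable (@ae_translate n).
Proof.
rewrite ae_translateE; apply: bigcapT_measurable => j.
exact: (measurable_ae1 (lebdn R d j) (@mDcat n j)).
Qed.

Hypothesis aeD : {ae lambda, forall xi, D xi}.

(** Fubini on tuples of length j + n for each j, and a countable union of null sets over j. *)
Lemma ae_ae_translate n : {ae lebdn R d n, forall t, ae_translate t}.
Proof.
rewrite ae_translateE.
have h j : {ae lebdn R d n, forall t : n.-tuple E,
    {ae lebdn R d j, forall s : j.-tuple E, D (config_of [tuple of s ++ t])}}.
  have mDc N : measurable (@config_of R d N @^-1` D).
    by rewrite -[X in measurable X]setTI; exact: measurable_config_of.
  apply: (ae_cat_tuple (mDc _)).
  by have /(ae_lambdaP d_gt0 mD) := aeD; exact.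
move: h => /ae_foralln; apply: filterS => t ht j _; exact: ht.
Qed.

End translates.

Variables a phi : E -> R.
Hypothesis a_meas : measurable_fun setT a.
Hypothesis phi_meas : measurable_fun setT phi.
Variables k1 k2 : config -> R.
Hypothesis mk1 : measurable_fun setT k1.
Hypothesis mk2 : measurable_fun setT k2.
Hypothesis k12 : {ae lambda, forall eta, k1 eta = k2 eta}.

Let D := [set eta | k1 eta = k2 eta].
Let mD : measurable D. Proof. exact: measurable_eq_real. Qed.

Lemma ae_eq_Rintegral d0 (T : measurableType d0) (m : {measure set T -> \bar R})
    (f g : T -> R) : measurable_fun setT f -> measurable_fun setT g ->
  {ae m, forall x, f x = g x} -> \int[m]_x f x = \int[m]_x g x.
Proof.
move=> mf mg fg; congr fine; apply: ae_eq_integral => //.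
- exact/measurable_EFinP.
- exact/measurable_EFinP.
- by move: fg; apply: filterS => x fgx _; rewrite fgx.
Qed.

Let inner_eq n (t : n.-tuple E) y : ae_translate D t ->
  inner phi k1 y (config_of t) = inner phi k2 y (config_of t).
Proof.
move=> h; apply: ae_eq_Rintegral; [exact: measurable_inner_integrand..|].
by move: h; apply: filterS => xi ->.
Qed.

Let loss_eq n (t : n.-tuple E) : ae_translate D t ->
  \int[lambda]_xi loss a phi k1 (config_of t) xi =
  \int[lambda]_xi loss a phi k2 (config_of t) xi.
Proof.
move=> h; apply: ae_eq_Rintegral; [exact: measurable_loss..|].
by move: h; apply: filterS => xi; rewrite /loss => ->.
Qed.

Lemma LDelta_ae_eq :
  {ae lambda, forall eta, LDelta a phi k1 eta = LDelta a phi k2 eta}.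
Proof.
have mL := measurable_eq_real (measurable_LDelta d_gt0 a_meas phi_meas mk1)
  (measurable_LDelta d_gt0 a_meas phi_meas mk2).
apply/(ae_lambdaP d_gt0 mL) => n.
have aeU := ae_uniq R d_gt0 n.
have aeT := ae_ae_translate mD k12 n.
case: n aeU aeT => [|n] aeU aeT.
  move: aeU aeT; apply: filterS2 => t ut ht /=.
  by rewrite !LDeltaE loss_eq// !big_config_of// !big_ord0.
(* The gain term sees the tuple with its entry [i] replaced by the landing point [x]. Almost every
   shorter tuple is completed by almost every [x] to one in [ae_translate D], and deleting an entry
   preserves this. *)
have aeG (i : 'I_n.+1) : {ae lebdn R d n.+1, forall t : n.+1.-tuple E,
    {ae dx, forall x, ae_translate D (cons_pair (x, delete_tuple i t))}}.
  have mB : measurable (@ae_translate D n.+1) by exact: measurable_ae_translate.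
  have mB' := measurable_ae2 dx (measurable_preimage_cons_pair mB).
  apply: (ae_delete_tuple i mB').
  exact/(ae_power_measureSr _ mB)/(ae_ae_translate mD k12).
have {}aeG : {ae lebdn R d n.+1, forall t : n.+1.-tuple E, forall i : 'I_n.+1,
    {ae dx, forall x, ae_translate D (cons_pair (x, delete_tuple i t))}}.
  exact: filter_forall.
move: aeU aeT aeG; apply: filterS3 => t ut ht gt /=.
rewrite !LDeltaE loss_eq// !big_config_of//; congr (_ - _).
apply: eq_bigr => i _; rewrite config_of_delete//.
apply: ae_eq_Rintegral; [exact: measurable_gain_section..|].
move: (gt i); apply: filterS => x hx.
by rewrite /gain -config_of_cons inner_eq.
Qed.

End almost_everywhere_invariance.

(** * Norms *)

Section norms.
Context (R : realType) (d : nat).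
Hypothesis d_gt0 : (0 < d)%N.
Local Notation E := (Eucl R d).
Local Notation config := (Gamma0 R d).
Local Notation lambda := (lebesgue_poisson R d).
Implicit Types (k : config -> R) (theta C : R).

Lemma nu_leP n k (c : R) : 0 <= c -> (nu n k <= c%:E)%E <->
  {ae lebdn R d n, forall t : n.-tuple E, `|k (config_of t)| <= c}.
Proof.
move=> c0; rewrite /nu unlock /=; case: ifPn => [_|].
  split.
    by move=> /ess_supP; apply: filterS => t; rewrite /= lee_fin.
  move=> h; apply: (introT ess_supP); move: h; apply: filterS => t kt.
  by rewrite /= lee_fin.
(* On a space of measure zero the essential supremum norm is 0 by convention, and every property
   holds almost everywhere. *)
rewrite -leNgt => mu0; split => _; last by rewrite lee_fin.
exists setT; split => //; apply/eqP.
by rewrite eq_le mu0 measure_ge0.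
Qed.

Lemma knorm_leP theta k C : 0 <= C -> (knorm theta k <= C%:E)%E <->
  forall n, {ae lebdn R d n, forall t : n.-tuple E,
    `|k (config_of t)| <= C * expR (- theta) ^+ n}.
Proof.
move=> C0.
have P n : ((expR (theta * n%:R))%:E * nu n k <= C%:E)%E <->
    {ae lebdn R d n, forall t : n.-tuple E,
    `|k (config_of t)| <= C * expR (- theta) ^+ n}.
  rewrite -nu_leP ?mulr_ge0 ?exprn_ge0 ?expR_ge0//.
  rewrite -lee_pdivlMl ?expR_gt0//.
  suff -> : ((expR (theta * n%:R))^-1%:E * C%:E = (C * expR (- theta) ^+ n)%:E)%E by [].
  rewrite -EFinM mulrC; congr (_ * _)%:E.
  by rewrite -expRN -expRM_natr mulNr.
split => [h n|h].
  by apply/P/(le_trans _ h); apply: ereal_sup_ubound; exists n.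
by apply: ge_ereal_sup => _ [n _ <-]; exact/P.
Qed.

Lemma knorm_ge0 theta k : (0 <= knorm theta k)%E.
Proof.
apply: (@le_trans _ _ ((expR (theta * 0%:R))%:E * nu 0 k)%E).
  by rewrite mule_ge0 ?lee_fin ?expR_ge0// /nu Lnorm_ge0.
by apply: ereal_sup_ubound; exists 0%N.
Qed.

(* Unlike the norm of K_theta, this bounds k at every configuration, so that the
   series of iterates of LDelta converges pointwise. *)
Definition tempered theta C k :=
  measurable_fun setT k /\ forall eta, `|k eta| <= C * expR (- theta) ^+ #|` eta|.

Lemma pointwise_knorm_le theta C k : 0 <= C ->
  (forall eta, `|k eta| <= C * expR (- theta) ^+ #|` eta|) ->
  (knorm theta k <= C%:E)%E.
Proof.
move=> C0 kC; apply/knorm_leP => // n.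
move: (ae_uniq R d_gt0 n); apply: filterS => t ut.
by rewrite -{2}(card_config_of ut).
Qed.

Lemma tempered_Kspace theta C k : 0 <= C -> tempered theta C k -> Kspace theta k.
Proof.
move=> C0 [mk kC]; split => //.
by apply: le_lt_trans (ltry C); exact: pointwise_knorm_le.
Qed.

Lemma ae_eq_config_of k1 k2 : measurable_fun setT k1 -> measurable_fun setT k2 ->
  {ae lambda, forall eta, k1 eta = k2 eta} <->
  forall n, {ae lebdn R d n, forall t : n.-tuple E, k1 (config_of t) = k2 (config_of t)}.
Proof. by move=> m1 m2; exact: (ae_lambdaP d_gt0 (measurable_eq_real m1 m2)). Qed.

(** The bound contained in the norm fails only on a null set, where [k] is replaced by 0. *)
Lemma truncation theta C k : 0 <= C -> measurable_fun setT k ->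
  (knorm theta k <= C%:E)%E ->
  exists2 k', tempered theta C k' & {ae lambda, forall eta, k eta = k' eta}.
Proof.
move=> C0 mk kC.
pose k' eta := if `|k eta| <= C * expR (- theta) ^+ #|` eta| then k eta else 0.
have mk' : measurable_fun setT k'.
  apply: measurable_fun_Gamma0P => n.
  have mkn := measurableT_comp mk (@measurable_config_of R d n).
  apply: (eq_measurable_fun (fun t : n.-tuple E =>
    if `|k (config_of t)| <= C * expR (- theta) ^+ n then k (config_of t) else 0)).
    by move=> t; rewrite inE /= => ut; rewrite /k' card_config_of.
  apply: (@measurable_funS _ _ _ _ setT) => //.
  apply: measurable_fun_ifT => //.
  by apply: measurable_fun_ler => //; exact: measurableT_comp.
exists k'.
  split => // eta; rewrite /k'; case: ifPn => //.
  by rewrite normr0 mulr_ge0// exprn_ge0// expR_ge0.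
apply/(ae_eq_config_of mk mk') => n.
move/(knorm_leP _ _ C0) : kC => /(_ n) kC.
move: (ae_uniq R d_gt0 n) kC; apply: filterS2 => t ut kt.
by rewrite /k' card_config_of// kt.
Qed.

Lemma Kspace_truncation theta k : Kspace theta k ->
  exists C k', [/\ 0 <= C, tempered theta C k' &
    {ae lambda, forall eta, k eta = k' eta}].
Proof.
move=> [mk kfin]; have k0 := knorm_ge0 theta k.
have C0 : 0 <= fine (knorm theta k) by exact: fine_ge0.
have [|k' tk' kk'] := truncation C0 mk (theta := theta).
  by rewrite fineK// ge0_fin_numE.
by exists (fine (knorm theta k)), k'.
Qed.

Lemma cvge0P (T : Type) (F : set_system T) (FF : Filter F) (f : T -> \bar R) :
  (forall x, 0 <= f x)%E ->
  f @ F --> 0%E <-> (forall e : R, 0 < e -> \forall x \near F, (f x <= e%:E)%E).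
Proof.
move=> f0; split.
  move=> /fine_cvgP[ffin /cvgrPdist_le h] e e0.
  move: ffin (h _ e0); apply: filterS2 => x fx.
  rewrite sub0r normrN ger0_norm ?fine_ge0// => fe.
  by rewrite -(fineK fx) lee_fin.
move=> h; apply/fine_cvgP; split.
  move: (h 1 ltr01); apply: filterS => x fx.
  by rewrite ge0_fin_numE//; exact: le_lt_trans fx (ltry _).
apply/cvgrPdist_le => e e0; move: (h e e0); apply: filterS => x fx.
rewrite sub0r normrN ger0_norm ?fine_ge0//.
by rewrite -lee_fin fineK// ge0_fin_numE//; exact: le_lt_trans fx (ltry _).
Qed.

End norms.

(** * Exponential series *)

Section exponential_series.
Context (R : realType).

(* The witness comes from a quadratic P with P(m) - rho P(m+1) = (m+1)^2, which
   makes the sum telescope. *)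
Lemma sum_square_geometric (rho : R) : 0 <= rho -> rho < 1 ->
  exists2 H, 0 <= H &
    forall M, \sum_(m < M) m.+1%:R ^+ 2 * rho ^+ m <= H.
Proof.
move=> r0 r1; have r1' : 0 < 1 - rho by rewrite subr_gt0.
have r1n : 1 - rho != 0 by rewrite gt_eqF.
pose A := (1 - rho)^-1; pose B := 2 * rho * A * A; pose C := rho * (A + B) * A.
have A0 : 0 <= A by rewrite invr_ge0 ltW.
have B0 : 0 <= B by rewrite !mulr_ge0.
have C0 : 0 <= C by rewrite !mulr_ge0// addr_ge0.
pose P (m : nat) : R := A * m.+1%:R ^+ 2 + B * m.+1%:R + C.
exists (P 0%N); first by rewrite /P !addr_ge0// mulr_ge0// exprn_ge0.
move=> M; have -> : P 0%N = \sum_(m < M) m.+1%:R ^+ 2 * rho ^+ m + P M * rho ^+ M.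
  elim: M => [|M IH]; first by rewrite big_ord0 add0r mulr1.
  rewrite IH big_ord_recr /= -addrA; congr (_ + _).
  rewrite [rho ^+ M.+1]exprS [P M.+1 * _]mulrA -mulrDl; congr (_ * _).
  rewrite /P /C /B /A -(natr1 M.+1); move: (M.+1%:R) => x.
  by field.
by rewrite lerDl mulr_ge0 ?exprn_ge0// /P !addr_ge0// mulr_ge0// exprn_ge0.
Qed.

Lemma is_cvg_abs_bounded_series (x : nat -> R) (H : R) :
  (forall M, \sum_(m < M) `|x m| <= H) -> cvgn (series x).
Proof.
move=> xH; apply: normed_cvg; apply: nondecreasing_is_cvgn.
  by apply: nondecreasing_series => n _ _ /=.
exists H => _ [M _ <-]; rewrite /normed_series_of /series /= big_mkord; exact: xH.
Qed.

(** The mean value estimate for powers; the factor [r] on the left avoids the exponent m - 1. *)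
Lemma normr_subX_le (r s t : R) m : 0 <= s <= r -> 0 <= t <= r ->
  r * `|s ^+ m - t ^+ m| <= m%:R * r ^+ m * `|s - t|.
Proof.
move=> /andP[s0 sr] /andP[t0 tr]; have r0 := le_trans s0 sr.
elim: m => [|m IH]; first by rewrite subrr normr0 mulr0 !mul0r.
have -> : s ^+ m.+1 - t ^+ m.+1 = s * (s ^+ m - t ^+ m) + t ^+ m * (s - t).
  by rewrite !exprS; ring.
apply: (@le_trans _ _ (r * (s * `|s ^+ m - t ^+ m| + t ^+ m * `|s - t|))).
  apply: ler_wpM2l => //; apply: le_trans (ler_normD _ _) _.
  by rewrite !normrM (ger0_norm s0) (ger0_norm (exprn_ge0 m t0)).
rewrite mulrDr -natr1 exprS 2!mulrDl mul1r; apply: lerD.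
  rewrite mulrCA; apply: le_trans (_ : r * (r * `|s ^+ m - t ^+ m|) <= _).
    by apply: ler_wpM2r => //; rewrite mulr_ge0.
  by apply: le_trans (ler_wpM2l r0 IH) _; lra.
rewrite mulrA; apply: ler_wpM2r => //; apply: ler_wpM2l => //.
by rewrite lerXn2r// nnegrE.
Qed.

(** Second-order Taylor remainder of a power. The next remainder is s times the present one plus
    (m+1) t^m (s-t)^2, which drives the induction. *)
Lemma normr_subX_taylor_le (r s t : R) m : 0 <= s <= r -> 0 <= t <= r ->
  r * `|s ^+ m.+1 - t ^+ m.+1 - (s - t) * (m.+1%:R * t ^+ m)| <=
  m.+1%:R * m%:R * r ^+ m * (s - t) ^+ 2.
Proof.
move=> /andP[s0 sr] /andP[t0 tr]; have r0 := le_trans s0 sr.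
elim: m => [|m IH].
  by rewrite !expr1 expr0 !mulr1 subrr normr0 !mulr0 !mul0r.
set e := _ - _ - _ in IH.
have -> : s ^+ m.+2 - t ^+ m.+2 - (s - t) * (m.+2%:R * t ^+ m.+1) =
    s * e + m.+1%:R * t ^+ m * (s - t) ^+ 2.
  by rewrite /e !exprS -(natr1 m.+1); move: (m.+1%:R) (t ^+ m) (s ^+ m) => x y z; ring.
apply: (@le_trans _ _ (r * (s * `|e| + m.+1%:R * t ^+ m * (s - t) ^+ 2))).
  apply: ler_wpM2l => //; apply: le_trans (ler_normD _ _) _.
  rewrite normrM (ger0_norm s0) lerD2l ger0_norm//.
  by do ?[exact: sqr_ge0 | exact: exprn_ge0 | apply: mulr_ge0].
have h1 : r * (s * `|e|) <= r * (m.+1%:R * m%:R * r ^+ m * (s - t) ^+ 2).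
  rewrite mulrCA; apply: le_trans (_ : r * (r * `|e|) <= _).
    by apply: ler_wpM2r => //; rewrite mulr_ge0.
  exact: ler_wpM2l.
have h2 : r * (m.+1%:R * t ^+ m * (s - t) ^+ 2) <=
    r * (m.+1%:R * r ^+ m * (s - t) ^+ 2).
  apply: ler_wpM2l => //; apply: ler_wpM2r; first exact: sqr_ge0.
  by apply: ler_wpM2l => //; rewrite lerXn2r// nnegrE.
have h3 : 0 <= r * (m.+1%:R * r ^+ m * (s - t) ^+ 2).
  by do ?[exact: sqr_ge0 | exact: exprn_ge0 | apply: mulr_ge0].
rewrite mulrDr; apply: le_trans (lerD h1 h2) _.
rewrite [r ^+ m.+1]exprS -(natr1 m.+1) -!(natr1 m) in h3 *.
move: (m%:R) (r ^+ m) ((s - t) ^+ 2) h3 => x y z h3.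
lra.
Qed.

Definition exp_term (v : nat -> R) (t : R) (m : nat) : R :=
  t ^+ m / m`!%:R * v m.

Definition exp_sum (v : nat -> R) (t : R) : R := limn (series (exp_term v t)).

(** Shifting the coefficients differentiates [exp_sum] in time. For the iterates of [LDelta] at a
    configuration it is also the application of [LDelta], so the evolution equation compares two
    readings of one sequence. *)
Definition shift_seq (v : nat -> R) (m : nat) := v m.+1.

Lemma normr_cvg_le (u : nat -> R) (l C : R) :
  u @ \oo --> l -> (forall n, `|u n| <= C) -> `|l| <= C.
Proof.
move=> ul uC; apply: (ler_cvg_to (cvg_norm ul) (cvg_cst C)).
by apply: nearW => n; exact: uC.
Qed.

Section majorized.
Variables (T r H B : R) (v : nat -> R).
Hypothesis r_gt0 : 0 < r.
Hypothesis rT : r < T.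
Hypothesis HB : forall M, \sum_(m < M) m.+1%:R ^+ 2 * (r / T) ^+ m <= H.
Hypothesis vB : forall m, T ^+ m / m`!%:R * `|v m| <= B.

Let rho := r / T.
Let T_gt0 : 0 < T. Proof. exact: lt_trans rT. Qed.
Let rho0 : 0 <= rho. Proof. by rewrite divr_ge0// ltW. Qed.
Let B0 : 0 <= B.
Proof. by apply: le_trans (vB 0); rewrite mulr_ge0// divr_ge0// exprn_ge0// ltW. Qed.
Let rE m : r ^+ m = rho ^+ m * T ^+ m.
Proof. by rewrite -exprMn /rho divfK// gt_eqF. Qed.

Let sum_le (x : nat -> R) (C : R) M : 0 <= C ->
  (forall m, x m <= C * (m.+1%:R ^+ 2 * rho ^+ m)) ->
  \sum_(m < M) x m <= C * H.
Proof.
move=> C0 xC; apply: (@le_trans _ _ (C * \sum_(m < M) m.+1%:R ^+ 2 * rho ^+ m)).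
  by rewrite mulr_sumr; apply: ler_sum => m _.
by apply: ler_wpM2l => //; exact: HB.
Qed.

Let sq_ge1 m : 1 <= m.+1%:R ^+ 2 :> R.
Proof. by rewrite expr_ge1// ler1n. Qed.

Lemma exp_term_le t m : 0 <= t <= r -> `|exp_term v t m| <= B * rho ^+ m.
Proof.
move=> /andP[t0 tr]; rewrite /exp_term normrM ger0_norm; last first.
  by rewrite divr_ge0// exprn_ge0.
apply: (@le_trans _ _ (r ^+ m / m`!%:R * `|v m|)).
  apply: ler_wpM2r => //; apply: ler_wpM2r; first by rewrite invr_ge0.
  by rewrite lerXn2r// nnegrE// ltW.
rewrite rE; have := ler_wpM2l (exprn_ge0 m rho0) (vB m); lra.
Qed.

(** One majorant serves all the series below: of the two factors m + 1, one pays for the index shift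
    and one for the difference in time. *)
Lemma exp_term_le_sq t m : 0 <= t <= r ->
  `|exp_term v t m| <= B * (m.+1%:R ^+ 2 * rho ^+ m).
Proof.
move=> tr; apply: le_trans (exp_term_le m tr) _.
by rewrite mulrCA ler_peMl// mulr_ge0// exprn_ge0.
Qed.

Let shift_coef m : T ^+ m / m`!%:R * `|v m.+1| <= B / T * m.+1%:R.
Proof.
rewrite [leRHS]mulrAC ler_pdivlMr//.
have -> : T ^+ m / m`!%:R * `|v m.+1| * T =
    m.+1%:R * (T ^+ m.+1 / (m.+1)`!%:R * `|v m.+1|).
  rewrite factS natrM exprS; have : m`!%:R != 0 :> R.
    by rewrite pnatr_eq0 gtn_eqF// fact_gt0.
  have : m.+1%:R != 0 :> R by rewrite pnatr_eq0.
  by move: (m.+1%:R) (m`!%:R) => x y x0 y0; field; rewrite x0 y0.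
by rewrite [leRHS]mulrC; apply: ler_wpM2l => //; exact: vB.
Qed.

Let shift_coef_rho m : r ^+ m / m`!%:R * `|v m.+1| <= B / T * (m.+1%:R * rho ^+ m).
Proof.
rewrite rE; have := ler_wpM2l (exprn_ge0 m rho0) (shift_coef m); lra.
Qed.

Let BT0 : 0 <= B / T. Proof. by rewrite divr_ge0// ltW. Qed.

Let le_sq m : m.+1%:R * rho ^+ m <= m.+1%:R ^+ 2 * rho ^+ m.
Proof.
apply: ler_wpM2r; first exact: exprn_ge0.
by rewrite expr2 ler_peMl// ler1n.
Qed.

Lemma exp_term_shift_le t m : 0 <= t <= r ->
  `|exp_term (shift_seq v) t m| <= B / T * (m.+1%:R ^+ 2 * rho ^+ m).
Proof.
move=> /andP[t0 tr]; rewrite /exp_term normrM ger0_norm; last first.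
  by rewrite divr_ge0// exprn_ge0.
apply: (@le_trans _ _ (r ^+ m / m`!%:R * `|v m.+1|)).
  apply: ler_wpM2r => //; apply: ler_wpM2r; first by rewrite invr_ge0.
  by rewrite lerXn2r// nnegrE// ltW.
apply: le_trans (shift_coef_rho m) _; apply: ler_wpM2l => //; exact: le_sq.
Qed.

Lemma is_cvg_exp_sum t : 0 <= t <= r -> cvgn (series (exp_term v t)).
Proof.
move=> tr; apply: (@is_cvg_abs_bounded_series _ (B * H)) => M.
by apply: (sum_le (x := fun m => `|exp_term v t m|)) => // m; exact: exp_term_le_sq.
Qed.

Lemma is_cvg_exp_sum_shift t : 0 <= t <= r -> cvgn (series (exp_term (shift_seq v) t)).
Proof.
move=> tr; apply: (@is_cvg_abs_bounded_series _ (B / T * H)) => M.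
apply: (sum_le (x := fun m => `|exp_term (shift_seq v) t m|)) => // m.
exact: exp_term_shift_le.
Qed.

Lemma exp_sum_shift_le t : 0 <= t <= r -> `|exp_sum (shift_seq v) t| <= B / T * H.
Proof.
move=> tr; apply: normr_cvg_le (is_cvg_exp_sum_shift tr) _ => n.
rewrite /series /= big_mkord; apply: le_trans (ler_norm_sum _ _ _) _.
apply: (sum_le (x := fun m => `|exp_term (shift_seq v) t m|)) => // m.
exact: exp_term_shift_le.
Qed.

(** In the tail, (m+1)/(M+1) >= 1 may be inserted into each term; the majorant has a factor m + 1 to
    spare. *)
Lemma exp_sum_tail_le t M : 0 <= t <= r ->
  `|exp_sum v t - \sum_(m < M) exp_term v t m| <= B * H / M.+1%:R.
Proof.
move=> tr.
have cv : (fun n => series (exp_term v t) (n + M)%N - \sum_(m < M) exp_term v t m) @ \oo -->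
    exp_sum v t - \sum_(m < M) exp_term v t m.
  apply: cvgB; last exact: cvg_cst.
  by rewrite (cvg_shiftn M (series (exp_term v t))); exact: is_cvg_exp_sum.
apply: normr_cvg_le cv _ => n.
rewrite /series /= big_mkord addnC big_split_ord /= addrAC subrr add0r.
apply: le_trans (ler_norm_sum _ _ _) _; rewrite ler_pdivlMr// mulr_suml.
apply: (@le_trans _ _ (\sum_(m < M + n) `|exp_term v t m| * m.+1%:R)).
  rewrite big_split_ord /= ler_wpDl//; first by apply: sumr_ge0 => m _; rewrite mulr_ge0.
  apply: ler_sum => m _; apply: ler_wpM2l => //.
  by rewrite ler_nat ltnS leq_addr.
apply: (sum_le (x := fun m => `|exp_term v t m| * m.+1%:R)) => // m.
have h := ler_wpM2r (ler0n R m.+1) (exp_term_le m tr).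
apply: le_trans h _; rewrite -mulrA [rho ^+ m * _]mulrC.
by apply: ler_wpM2l => //; exact: le_sq.
Qed.

Lemma exp_sum_taylor_le s t : 0 <= s <= r -> 0 <= t <= r ->
  `|exp_sum v s - exp_sum v t - (s - t) * exp_sum (shift_seq v) t| <=
  B / T * H / r * (s - t) ^+ 2.
Proof.
move=> sr tr.
(* The sums of [v] run one term further, so that its term m + 1 meets term m of the shifted
   sequence; the terms of index 0 cancel. *)
have cv : (fun n => series (exp_term v s) (n + 1)%N - series (exp_term v t) (n + 1)%N -
     (s - t) * series (exp_term (shift_seq v) t) n) @ \oo -->
   exp_sum v s - exp_sum v t - (s - t) * exp_sum (shift_seq v) t.
  apply: cvgB; last by apply: cvgMr; exact: is_cvg_exp_sum_shift.
  apply: cvgB.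
    by rewrite (cvg_shiftn 1 (series (exp_term v s))); exact: is_cvg_exp_sum.
  by rewrite (cvg_shiftn 1 (series (exp_term v t))); exact: is_cvg_exp_sum.
apply: normr_cvg_le cv _ => n.
rewrite /series /= !big_mkord addn1 !big_ord_recl mulr_sumr.
have -> : exp_term v s (@ord0 n) = exp_term v t (@ord0 n) by rewrite /exp_term /= 2!expr0.
rewrite opprD addrACA subrr add0r -!sumrB.
apply: le_trans (ler_norm_sum _ _ _) _.
have -> : B / T * H / r * (s - t) ^+ 2 = B / T / r * (s - t) ^+ 2 * H by ring.
have C0 : 0 <= B / T / r * (s - t) ^+ 2.
  by rewrite mulr_ge0 ?sqr_ge0// divr_ge0// ltW.
apply: (sum_le (x := fun m => `|exp_term v s m.+1 - exp_term v t m.+1 -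
  (s - t) * exp_term (shift_seq v) t m|)) => // m.
have fm : m`!%:R != 0 :> R by rewrite pnatr_eq0 gtn_eqF// fact_gt0.
have m0 : m.+1%:R != 0 :> R by rewrite pnatr_eq0.
have -> : exp_term v s m.+1 - exp_term v t m.+1 - (s - t) * exp_term (shift_seq v) t m =
    (s ^+ m.+1 - t ^+ m.+1 - (s - t) * (m.+1%:R * t ^+ m)) *
    (v m.+1 / (m.+1%:R * m`!%:R)).
  rewrite /exp_term /shift_seq factS natrM.
  move: (v m.+1) (m.+1%:R) (m`!%:R) m0 fm (s ^+ _) (t ^+ _) (t ^+ _) => w x y x0 y0 S1 T1 T0.
  by field; rewrite x0 y0.
rewrite normrM -(ler_pM2l r_gt0) mulrA.
apply: le_trans (ler_wpM2r (normr_ge0 _) (normr_subX_taylor_le m sr tr)) _.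
have -> : `|v m.+1 / (m.+1%:R * m`!%:R)| = `|v m.+1| / (m.+1%:R * m`!%:R).
  by rewrite normrM [X in _ * X]ger0_norm// invr_ge0 mulr_ge0.
have -> : m.+1%:R * m%:R * r ^+ m * (s - t) ^+ 2 *
    (`|v m.+1| / (m.+1%:R * m`!%:R)) =
    m%:R * (s - t) ^+ 2 * (r ^+ m / m`!%:R * `|v m.+1|).
  move: (m.+1%:R) (m`!%:R) m0 fm => x y x0 y0.
  by field; rewrite x0 y0.
have h : 0 <= m%:R * (s - t) ^+ 2 :> R by rewrite mulr_ge0 ?sqr_ge0.
apply: le_trans (ler_wpM2l h (shift_coef_rho m)) _.
have -> : r * (B / T / r * (s - t) ^+ 2 * (m.+1%:R ^+ 2 * rho ^+ m)) =
    (s - t) ^+ 2 * (B / T) * (m.+1%:R * (m.+1%:R * rho ^+ m)).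
  by rewrite expr2; field; rewrite !gt_eqF.
have -> : m%:R * (s - t) ^+ 2 * (B / T * (m.+1%:R * rho ^+ m)) =
    (s - t) ^+ 2 * (B / T) * (m%:R * (m.+1%:R * rho ^+ m)) by ring.
apply: ler_wpM2l; first by rewrite mulr_ge0 ?sqr_ge0.
apply: ler_wpM2r; first by rewrite mulr_ge0// exprn_ge0.
by rewrite ler_nat.
Qed.

Lemma exp_sum_shift_lipschitz s t : 0 <= s <= r -> 0 <= t <= r ->
  `|exp_sum (shift_seq v) s - exp_sum (shift_seq v) t| <=
  B / T * H / r * `|s - t|.
Proof.
move=> sr tr.
have cv : (fun n => series (exp_term (shift_seq v) s) n -
    series (exp_term (shift_seq v) t) n) @ \oo -->
    exp_sum (shift_seq v) s - exp_sum (shift_seq v) t.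
  by apply: cvgB; exact: is_cvg_exp_sum_shift.
apply: normr_cvg_le cv _ => n.
rewrite /series /= !big_mkord -sumrB; apply: le_trans (ler_norm_sum _ _ _) _.
have -> : B / T * H / r * `|s - t| = B / T / r * `|s - t| * H by ring.
have C0 : 0 <= B / T / r * `|s - t| by rewrite mulr_ge0// divr_ge0// ltW.
apply: (sum_le (x := fun m => `|exp_term (shift_seq v) s m -
  exp_term (shift_seq v) t m|)) => // m.
have -> : exp_term (shift_seq v) s m - exp_term (shift_seq v) t m =
    (s ^+ m - t ^+ m) * (v m.+1 / m`!%:R).
  by rewrite /exp_term /shift_seq; ring.
rewrite normrM -(ler_pM2l r_gt0) mulrA.
apply: le_trans (ler_wpM2r (normr_ge0 _) (normr_subX_le m sr tr)) _.
have -> : `|v m.+1 / m`!%:R| = `|v m.+1| / m`!%:R.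
  by rewrite normrM [X in _ * X]ger0_norm// invr_ge0.
have -> : m%:R * r ^+ m * `|s - t| * (`|v m.+1| / m`!%:R) =
    m%:R * `|s - t| * (r ^+ m / m`!%:R * `|v m.+1|) by ring.
have h : 0 <= m%:R * `|s - t| by rewrite mulr_ge0.
apply: le_trans (ler_wpM2l h (shift_coef_rho m)) _.
have -> : r * (B / T / r * `|s - t| * (m.+1%:R ^+ 2 * rho ^+ m)) =
    `|s - t| * (B / T) * (m.+1%:R * (m.+1%:R * rho ^+ m)).
  by rewrite expr2; field; rewrite !gt_eqF.
have -> : m%:R * `|s - t| * (B / T * (m.+1%:R * rho ^+ m)) =
    `|s - t| * (B / T) * (m%:R * (m.+1%:R * rho ^+ m)) by ring.
apply: ler_wpM2l; first by rewrite mulr_ge0.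
apply: ler_wpM2r; first by rewrite mulr_ge0// exprn_ge0.
by rewrite ler_nat.
Qed.

End majorized.

End exponential_series.

(** * Iterates of the operator on the initial value *)

Section iterates.
Context (R : realType) (d : nat).
Hypothesis d_gt0 : (0 < d)%N.
Local Notation E := (Eucl R d).
Local Notation config := (Gamma0 R d).
Local Notation lambda := (lebesgue_poisson R d).
Local Notation dx := (lebd R d).
Variables a phi : E -> R.
Hypothesis a_ge0 : forall x, 0 <= a x.
Hypothesis phi_ge0 : forall x, 0 <= phi x.
Hypothesis a_meas : measurable_fun setT a.
Hypothesis phi_meas : measurable_fun setT phi.
Hypothesis a_even : forall x, a x = a (Eucl_opp x).
Hypothesis phi_even : forall x, phi x = phi (Eucl_opp x).
Hypothesis a_int : (\int[dx]_x (a x)%:E < +oo)%E.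
Hypothesis phi_int : (\int[dx]_x (1 - expR (- phi x))%:E < +oo)%E.

Local Notation al := (alpha a).
Local Notation c := (cphi phi).
Local Notation L := (LDelta a phi).

Lemma tempered_LDelta_le (theta C : R) k eta : 0 <= C -> tempered theta C k ->
  `|L k eta| <= 2 * al * #|` eta|%:R * expR (c * expR (- theta)) *
    (C * expR (- theta) ^+ #|` eta|).
Proof.
move=> C0 [mk kC]; rewrite [c * _]mulrC.
by apply: normr_LDelta_le => //; exact: expR_ge0.
Qed.

(** Trades the factor n for a loss of level, by 1 + x <= exp x. *)
Lemma mulrn_expR_le (theta theta' : R) n : theta' < theta ->
  n%:R * expR (- theta) ^+ n <= (theta - theta')^-1 * expR (- theta') ^+ n.
Proof.
move=> tt'; have t0 : 0 < theta - theta' by rewrite subr_gt0.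
rewrite ler_pdivlMl// mulrA -!expRM_natl.
have -> : expR (n%:R * - theta') = expR ((theta - theta') * n%:R) * expR (n%:R * - theta).
  by rewrite -expRD; congr expR; ring.
apply: ler_wpM2r; first exact: expR_ge0.
by apply: le_trans (expR_ge1Dx _); rewrite lerDr.
Qed.

Lemma tempered_weaken (theta theta' C : R) (k : config -> R) : 0 <= C -> theta' <= theta ->
  tempered theta C k -> tempered theta' C k.
Proof.
move=> C0 tt' [mk kC]; split => // eta; apply: le_trans (kC eta) _.
apply: ler_wpM2l => //; rewrite lerXn2r ?nnegrE ?expR_ge0//.
by rewrite ler_expR lerN2.
Qed.

Lemma tempered_LDelta (theta theta' C : R) k : 0 <= C -> theta' < theta ->
  tempered theta C k ->
  tempered theta' (2 * al * expR (c * expR (- theta)) * C / (theta - theta')) (L k).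
Proof.
move=> C0 tt' tk; split => [|eta].
  by apply: measurable_LDelta => //; case: tk.
apply: le_trans (tempered_LDelta_le eta C0 tk) _.
have D0 : 0 <= 2 * al * expR (c * expR (- theta)) * C.
  by rewrite !mulr_ge0 ?expR_ge0// (alpha_ge0 a_ge0).
have := ler_wpM2l D0 (mulrn_expR_le #|` eta| tt').
lra.
Qed.

(** The bound on the partial sum is carried through the induction because [LDelta_linear] asks for
    growth bounds on both summands. *)
Lemma LDelta_sum (theta : R) M (r : nat -> R) (C : nat -> R) (v : nat -> config -> R) eta :
  (forall m, 0 <= C m) -> (forall m, tempered theta (C m) (v m)) ->
  L (fun xi => \sum_(m < M) r m * v m xi) eta = \sum_(m < M) r m * L (v m) eta /\
  exists2 C', 0 <= C' & tempered theta C' (fun xi => \sum_(m < M) r m * v m xi).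
Proof.
move=> C0 tv; elim: M => [|M [IH [C' C'0 tC']]].
  have t0 : tempered theta 0 ((fun=> 0) : config -> R).
    by split => // xi; rewrite normr0 mul0r.
  have -> : (fun xi : config => \sum_(m < 0) r m * v m xi) = (fun=> 0).
    by apply/funext => xi; rewrite big_ord0.
  split; last by exists 0.
  rewrite big_ord0; apply/eqP; rewrite -normr_le0.
  by apply: le_trans (tempered_LDelta_le eta (lexx 0) t0) _; rewrite mul0r mulr0.
have -> : (fun xi => \sum_(m < M.+1) r m * v m xi) =
    (fun xi => r M * v M xi + \sum_(m < M) r m * v m xi).
  by apply/funext => xi; rewrite big_ord_recr /= addrC.
have [mM vM] := tv M; have [mS vS] := tC'; split.
  rewrite big_ord_recr /= addrC -IH.
  exact: (LDelta_linear d_gt0 a_ge0 phi_ge0 a_meas phi_meas a_even phi_even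
    a_int phi_int (expR_ge0 _) (C0 M) C'0 mM mS vM vS).
exists (`|r M| * C M + C'); first by rewrite addr_ge0// mulr_ge0.
split; first by apply: measurable_funD => //; exact: measurable_funM.
move=> xi; rewrite mulrDl; apply: le_trans (ler_normD _ _) _; apply: lerD => //.
by rewrite normrM -mulrA; apply: ler_wpM2l.
Qed.

Variables (theta0 A : R) (k0 : config -> R).
Hypothesis A_ge0 : 0 <= A.
Hypothesis k0A : tempered theta0 A k0.

Definition iterate m : config -> R := iter m L k0.

(** Each further iterate spends half of the remaining gap to [theta0]. The constants are of no
    interest: only the convergence of integrals is drawn from them, and the sharp bound is
    [iterate_le]. *)
Lemma tempered_iterate m theta : theta < theta0 ->
  exists2 C, 0 <= C & tempered theta C (iterate m).
Proof.
elim: m theta => [|m IH] theta tt0.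
  by exists A => //; apply: tempered_weaken k0A => //; exact: ltW.
have [|C C0 tC] := IH ((theta + theta0) / 2); first by lra.
exists (2 * al * expR (c * expR (- ((theta + theta0) / 2))) * C /
    ((theta + theta0) / 2 - theta)); last first.
  by apply: tempered_LDelta => //; lra.
rewrite divr_ge0 ?mulr_ge0 ?expR_ge0// ?(alpha_ge0 a_ge0)//; lra.
Qed.

Lemma measurable_iterate m : measurable_fun setT (iterate m).
Proof.
case: m => [|m]; first by case: k0A.
apply: measurable_LDelta => //.
have [|C _ []//] := @tempered_iterate m (theta0 - 1); lra.
Qed.

Lemma LDelta_iterate_sum M (r : nat -> R) eta :
  L (fun xi => \sum_(m < M) r m * iterate m xi) eta =
  \sum_(m < M) r m * iterate m.+1 eta.
Proof.
have tt0 : theta0 - 1 < theta0 by lra.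
have /choice[C tC] : forall m, exists C, 0 <= C /\
    tempered (theta0 - 1) C (iterate m).
  by move=> m; have [C C0 tC] := @tempered_iterate m _ tt0; exists C.
by have [-> _] := @LDelta_sum (theta0 - 1) M r C iterate eta
  (fun m => (tC m).1) (fun m => (tC m).2).
Qed.

Lemma is_derive_exp_sum_partial (w : nat -> R) M (s : R) :
  is_derive s 1 (fun s => \sum_(m < M.+1) exp_term w s m)
    (\sum_(m < M) exp_term (shift_seq w) s m).
Proof.
elim: M => [|M IH].
  rewrite big_ord0 (_ : (fun s => _) = cst (w 0%N)); first exact: is_derive_cst.
  by apply/funext => x; rewrite big_ord1 /exp_term expr0 invr1 !mul1r.
have -> : (fun s => \sum_(m < M.+2) exp_term w s m) =
    (fun s => \sum_(m < M.+1) exp_term w s m) + (fun s => exp_term w s M.+1).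
  by apply/funext => x; rewrite big_ord_recr.
rewrite big_ord_recr /=; apply: is_deriveD.
rewrite (_ : (fun s => _) = horner ((w M.+1 / (M.+1)`!%:R) *: 'X^(M.+1))); last first.
  by apply/funext => x; rewrite hornerZ hornerXn /exp_term; ring.
apply: is_derive_eq; rewrite derivZ derivXn hornerZ hornerMn hornerXn.
rewrite /exp_term /shift_seq /= factS natrM -[s ^+ M *+ _]mulr_natr.
have : M`!%:R != 0 :> R by rewrite pnatr_eq0 gtn_eqF// fact_gt0.
have : M.+1%:R != 0 :> R by rewrite pnatr_eq0.
move: (M.+1%:R) (M`!%:R) => x y x0 y0; field.
by rewrite x0 y0.
Qed.

End iterates.

Section evolution_derivative.
Context (R : realType).

Lemma ge0_derive_le (g dg : R -> R) (s : R) : 0 <= s ->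
  (forall x : R, is_derive x 1 g (dg x)) ->
  (forall x, 0 <= x <= s -> 0 <= dg x) -> g 0 <= g s.
Proof.
move=> s0 is_dg dg0.
have [|z + gz] := @MVT_segment R g dg 0 s s0 (fun x _ => is_dg x).
  apply: continuous_subspaceT => x; apply: differentiable_continuous.
  by apply/derivable1_diffP; exact: (@ex_derive _ _ _ _ _ _ _ (is_dg x)).
rewrite in_itv/= => z0s.
by rewrite -subr_ge0 gz subr0 mulr_ge0// dg0.
Qed.

End evolution_derivative.

(** * Comparison with the supersolution, and the exponential series *)

Section evolution.
Context (R : realType) (d : nat).
Hypothesis d_gt0 : (0 < d)%N.
Local Notation E := (Eucl R d).
Local Notation config := (Gamma0 R d).
Local Notation lambda := (lebesgue_poisson R d).
Local Notation dx := (lebd R d).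
Variables a phi : E -> R.
Hypothesis a_ge0 : forall x, 0 <= a x.
Hypothesis phi_ge0 : forall x, 0 <= phi x.
Hypothesis a_meas : measurable_fun setT a.
Hypothesis phi_meas : measurable_fun setT phi.
Hypothesis a_even : forall x, a x = a (Eucl_opp x).
Hypothesis phi_even : forall x, phi x = phi (Eucl_opp x).
Hypothesis a_int : (\int[dx]_x (a x)%:E < +oo)%E.
Hypothesis phi_int : (\int[dx]_x (1 - expR (- phi x))%:E < +oo)%E.

Local Notation al := (alpha a).
Local Notation c := (cphi phi).
Local Notation L := (LDelta a phi).

Hypothesis al_gt0 : 0 < al.
Variables (theta0 A : R) (k0 : config -> R).
Hypothesis A_ge0 : 0 <= A.
Hypothesis k0A : tempered theta0 A k0.

Local Notation u := (iterate a phi k0).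
Local Notation T := (Ttime al c theta0).

(* A e^{-(theta0 - speed theta * s) n} is a supersolution of the majorant
   equation u_n' = 2 al n sum_j c^j/j! u_{n+j} as long as
   theta <= theta0 - speed theta * s, that is for s <= T theta. *)
Definition speed (theta : R) : R := 2 * al * expR (c * expR (- theta)).

Lemma speed_gt0 theta : 0 < speed theta.
Proof. by rewrite /speed !mulr_gt0// expR_gt0. Qed.

Lemma TtimeE theta : T theta = (theta0 - theta) / speed theta.
Proof. by rewrite /Ttime /speed expRN -mulrA -invfM. Qed.

Lemma Ttime_gt0 theta : theta < theta0 -> 0 < T theta.
Proof. by move=> tt0; rewrite TtimeE divr_gt0 ?subr_gt0// speed_gt0. Qed.

Lemma level_ge theta s : s <= T theta -> theta <= theta0 - speed theta * s.
Proof.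
rewrite TtimeE ler_pdivlMr ?speed_gt0// => h; rewrite mulrC; lra.
Qed.

Let abs_iterate (eta : config) (m : nat) : R := `|u m eta|.

(** Induction on the number of terms. The time derivative of the longer sum is [LDelta] of a
    combination of fewer iterates, which the induction hypothesis bounds at every configuration; the
    operator bound then keeps it below the derivative of the supersolution. *)
Lemma partial_sum_le (theta : R) M (s : R) eta : theta < theta0 -> 0 <= s <= T theta ->
  \sum_(m < M) exp_term (abs_iterate eta) s m <=
  A * expR (- (theta0 - speed theta * s)) ^+ #|` eta|.
Proof.
move=> tt0; elim: M s eta => [|M IH] s eta /andP[s0 sT].
  by rewrite big_ord0 mulr_ge0// exprn_ge0// expR_ge0.
set K := speed theta; set n := #|` eta|.
pose g (x : R) := A * expR (n%:R * (K * x - theta0)) -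
  \sum_(m < M.+1) exp_term (abs_iterate eta) x m.
pose dg (x : R) := A * (n%:R * K) * expR (n%:R * (K * x - theta0)) -
  \sum_(m < M) exp_term (shift_seq (abs_iterate eta)) x m.
have is_dg (x : R) : is_derive x (1 : R) g (dg x).
  apply: is_deriveB; last exact: is_derive_exp_sum_partial.
  pose p : {poly R} := (n%:R * K) *: 'X - (n%:R * theta0)%:P.
  have pE y : p.[y] = n%:R * (K * y - theta0).
    by rewrite /p hornerD hornerN hornerZ hornerX hornerC; ring.
  rewrite (_ : (fun y => _) = A *: (expR \o horner p)); last first.
    by apply/funext => y; rewrite /GRing.scale /= pE.
  apply: is_derive_eq; rewrite /GRing.scale /= pE.
  rewrite /p derivB derivZ derivX derivC subr0 hornerZ hornerC; ring.
have expE (x : R) : expR (n%:R * (K * x - theta0)) = expR (- (theta0 - K * x)) ^+ n.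
  by rewrite -expRM_natl opprB.
have dg0 x : 0 <= x <= s -> 0 <= dg x.
  move=> /andP[x0 xs]; have xT : x <= T theta by exact: le_trans sT.
  (* The signs are fixed at the given [eta], so that [LDelta] of the combination there is a sum of
     absolute values; at every other configuration the combination still obeys the bound. *)
  pose r m : R := x ^+ m / m`!%:R * Num.sg (u m.+1 eta).
  set q := expR (- (theta0 - K * x)).
  have hq xi : `|\sum_(m < M) r m * u m xi| <= A * q ^+ #|` xi|.
    apply: le_trans (IH x xi _); last by rewrite x0 xT.
    apply: le_trans (ler_norm_sum _ _ _) _; apply: ler_sum => m _.
    rewrite /exp_term /abs_iterate /r normrM; apply: ler_wpM2r => //.
    rewrite normrM ger0_norm ?divr_ge0 ?exprn_ge0//.
    rewrite ler_piMr ?divr_ge0 ?exprn_ge0//.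
    by rewrite normr_sg; case: (_ != 0).
  have mh : measurable_fun setT (fun xi => \sum_(m < M) r m * u m xi).
    apply: measurable_sum => m; apply: measurable_funM => //.
    by apply: (measurable_iterate d_gt0 a_ge0 phi_ge0 a_meas phi_meas a_even
      phi_even a_int phi_int A_ge0 k0A).
  have := normr_LDelta_le d_gt0 a_ge0 phi_ge0 a_meas phi_meas a_even phi_even
    a_int phi_int (expR_ge0 _) A_ge0 mh hq eta.
  rewrite (LDelta_iterate_sum d_gt0 a_ge0 phi_ge0 a_meas phi_meas a_even phi_even
    a_int phi_int A_ge0 k0A).
  have -> : \sum_(m < M) r m * u m.+1 eta =
      \sum_(m < M) exp_term (shift_seq (abs_iterate eta)) x m.
    apply: eq_bigr => m _; rewrite /r /exp_term /shift_seq /abs_iterate.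
    by rewrite -[LHS]mulrA -normrEsg.
  rewrite /dg subr_ge0 expE -/q -/n => h.
  apply: le_trans (ler_norm _) (le_trans h _).
  rewrite [q * c]mulrC.
  have -> : A * (n%:R * K) * q ^+ n = 2 * al * n%:R * expR (c * expR (- theta)) * (A * q ^+ n).
    by rewrite /K /speed; ring.
  apply: ler_wpM2r; first by rewrite mulr_ge0// exprn_ge0// expR_ge0.
  apply: ler_wpM2l; first by rewrite !mulr_ge0// ltW.
  (* Up to time [T theta] the current level is at least [theta], so the growth rate is at most
     [speed theta]. *)
  rewrite ler_expR; apply: ler_wpM2l; first exact: cphi_ge0.
  by rewrite ler_expR lerN2; exact: level_ge.
have := ge0_derive_le s0 is_dg dg0; rewrite /g !expE => h.
rewrite -subr_ge0; apply: le_trans h; rewrite mulr0 subr0.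
rewrite big_ord_recl /= big1 ?addr0; last first.
  by move=> m _; rewrite /exp_term /= expr0n /= !mul0r.
rewrite /exp_term expr0 invr1 !mul1r subr_ge0 /abs_iterate.
by case: k0A => _; exact.
Qed.

(** One term of the partial sum, taken at the last admissible time, when the level has dropped
    exactly to [theta]. *)
Lemma iterate_le theta m eta : theta < theta0 ->
  T theta ^+ m / m`!%:R * `|u m eta| <= A * expR (- theta) ^+ #|` eta|.
Proof.
move=> tt0; have T0 := Ttime_gt0 tt0.
have := @partial_sum_le theta m.+1 (T theta) eta tt0.
rewrite lexx ltW// => /(_ isT).
have -> : theta0 - speed theta * T theta = theta.
  by rewrite TtimeE mulrC divfK ?gt_eqF ?speed_gt0//; ring.
apply: le_trans; rewrite big_ord_recr /= lerDr; apply: sumr_ge0 => i _.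
by rewrite /exp_term /abs_iterate mulr_ge0// divr_ge0// exprn_ge0// ltW.
Qed.

Definition evolution (t : R) (eta : config) : R := exp_sum (u ^~ eta) t.

Definition evolution_rate (t : R) (eta : config) : R :=
  exp_sum (shift_seq (u ^~ eta)) t.

Section level.
Variables theta r : R.
Hypothesis tt0 : theta < theta0.
Hypothesis r_gt0 : 0 < r.
Hypothesis rT : r < T theta.

Lemma is_cvg_evolution (t : R) eta : 0 <= t <= r -> cvgn (series (exp_term (u ^~ eta) t)).
Proof.
have rho0 : 0 <= r / T theta by rewrite divr_ge0 ?ltW ?Ttime_gt0.
have rho1 : r / T theta < 1 by rewrite ltr_pdivrMr ?mul1r// Ttime_gt0.
have [H _ HB] := sum_square_geometric rho0 rho1.
exact: (is_cvg_exp_sum r_gt0 rT HB (fun m => iterate_le m eta tt0)).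
Qed.

Lemma measurable_evolution (t : R) : 0 <= t <= r -> measurable_fun setT (evolution t).
Proof.
move=> tr; apply: (measurable_fun_cvg
  (h := fun n eta => series (exp_term (u ^~ eta) t) n)).
  move=> n; rewrite (_ : (fun _ => _) = fun eta => \sum_(m < n) exp_term (u ^~ eta) t m).
    apply: measurable_sum => m; apply: measurable_funM => //.
    by apply: (measurable_iterate d_gt0 a_ge0 phi_ge0 a_meas phi_meas a_even
      phi_even a_int phi_int A_ge0 k0A).
  by apply/funext => eta; rewrite /series /= big_mkord.
by move=> eta _; exact: is_cvg_evolution.
Qed.

(** The constant [A] is the same at all levels; this is what allows the passage to the level
    [theta_of]. *)
Lemma evolution_le (t : R) : 0 <= t <= r -> tempered theta A (evolution t).
Proof.
move=> tr; split; first exact: measurable_evolution.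
move=> eta; have cv := @is_cvg_evolution t eta tr; rewrite /evolution; apply: (@normr_cvg_le R _ _ _ cv) => n.
rewrite /series /= big_mkord; apply: le_trans (ler_norm_sum _ _ _) _.
have /andP[t0 tr'] := tr; have tT : t <= T theta by exact: le_trans tr' (ltW rT).
apply: (@le_trans _ _ (A * expR (- (theta0 - speed theta * t)) ^+ #|` eta|)).
  apply: le_trans (_ : \sum_(m < n) exp_term (abs_iterate eta) t m <= _).
    apply: ler_sum => m _; rewrite /exp_term normrM ger0_norm//.
    by rewrite divr_ge0// exprn_ge0.
  by apply: partial_sum_le => //; rewrite t0 tT.
apply: ler_wpM2l => //; rewrite lerXn2r ?nnegrE ?expR_ge0// ler_expR lerN2.
exact: level_ge.
Qed.

(** The scalar estimates are linear in their constant B, here A exp(-theta)^|eta|, and their other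
    constants depend only on r and T(theta). Hence they become estimates in the norm of K_theta. *)
Lemma evolution_estimates : exists2 X, 0 <= X & forall s t, 0 <= s <= r -> 0 <= t <= r ->
  [/\ forall eta, `|evolution s eta - evolution t eta - (s - t) * evolution_rate t eta|
        <= X * (s - t) ^+ 2 * expR (- theta) ^+ #|` eta|,
      forall eta, `|evolution_rate s eta - evolution_rate t eta|
        <= X * `|s - t| * expR (- theta) ^+ #|` eta|,
      forall eta, `|evolution_rate t eta| <= X * expR (- theta) ^+ #|` eta| &
      forall M eta, `|evolution t eta - \sum_(m < M) exp_term (u ^~ eta) t m| <=
        X / M.+1%:R * expR (- theta) ^+ #|` eta|].
Proof.
have T0 := Ttime_gt0 tt0.
have rho0 : 0 <= r / T theta by rewrite divr_ge0 ?ltW.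
have rho1 : r / T theta < 1 by rewrite ltr_pdivrMr ?mul1r.
have [H H0 HB] := sum_square_geometric rho0 rho1.
have vB eta m := iterate_le m eta tt0.
pose Tr := T theta.
have p1 : 0 <= A / Tr * H / r by rewrite !mulr_ge0 ?invr_ge0// ltW.
have p2 : 0 <= A / Tr * H by rewrite !mulr_ge0 ?invr_ge0// ltW.
have p3 : 0 <= A * H by rewrite mulr_ge0.
exists (A / Tr * H / r + A / Tr * H + A * H); first by rewrite !addr_ge0.
move=> s t sr tr; split=> [eta|eta|eta|M eta]; set q := expR _ ^+ _;
  have q0 : 0 <= q by rewrite exprn_ge0// expR_ge0.
- apply: le_trans (exp_sum_taylor_le r_gt0 rT HB (vB eta) sr tr) _.
  rewrite -/q -/Tr.
  have -> : A * q / Tr * H / r * (s - t) ^+ 2 = A / Tr * H / r * (s - t) ^+ 2 * q by ring.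
  apply: ler_wpM2r => //; apply: ler_wpM2r; first exact: sqr_ge0.
  lra.
- apply: le_trans (exp_sum_shift_lipschitz r_gt0 rT HB (vB eta) sr tr) _.
  rewrite -/q -/Tr.
  have -> : A * q / Tr * H / r * `|s - t| = A / Tr * H / r * `|s - t| * q by ring.
  apply: ler_wpM2r => //; apply: ler_wpM2r => //; lra.
- apply: le_trans (exp_sum_shift_le r_gt0 rT HB (vB eta) tr) _.
  rewrite -/q -/Tr.
  have -> : A * q / Tr * H = A / Tr * H * q by ring.
  apply: ler_wpM2r => //; lra.
- apply: le_trans (exp_sum_tail_le r_gt0 rT HB (vB eta) M tr) _.
  rewrite -/q.
  have -> : A * q * H / M.+1%:R = A * H / M.+1%:R * q by ring.
  apply: ler_wpM2r => //; apply: ler_wpM2r; first by rewrite invr_ge0.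
  lra.
Qed.

Lemma is_cvg_evolution_rate (t : R) eta : 0 <= t <= r ->
  series (exp_term (shift_seq (u ^~ eta)) t) @ \oo --> evolution_rate t eta.
Proof.
have rho0 : 0 <= r / T theta by rewrite divr_ge0 ?ltW ?Ttime_gt0.
have rho1 : r / T theta < 1 by rewrite ltr_pdivrMr ?mul1r// Ttime_gt0.
have [H _ HB] := sum_square_geometric rho0 rho1.
exact: (is_cvg_exp_sum_shift r_gt0 rT HB (fun m => iterate_le m eta tt0)).
Qed.

(** At a fixed [eta] the operator bound is a finite multiple of the norm, so the vanishing tail lets
    [LDelta] pass under the sum, although this multiple grows with |eta|. *)
Lemma LDelta_evolution (t : R) : 0 <= t <= r ->
  L (evolution t) = evolution_rate t.
Proof.
move=> tr; apply/funext => eta.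
have [X X0 /(_ t t tr tr) [_ _ _ tail]] := evolution_estimates.
pose S M xi := \sum_(m < M) t ^+ m / m`!%:R * u m xi.
have mu m : measurable_fun setT (u m).
  by apply: (measurable_iterate d_gt0 a_ge0 phi_ge0 a_meas phi_meas a_even
      phi_even a_int phi_int A_ge0 k0A).
have mS M : measurable_fun setT (S M).
  by apply: measurable_sum => m; exact: measurable_funM.
have mE := measurable_evolution tr.
have /choice[C tC] : forall m, exists C, 0 <= C /\ tempered theta C (u m).
  move=> m; have [C C0 tC] := tempered_iterate d_gt0 a_ge0 phi_ge0 a_meas phi_meas
    a_even phi_even a_int phi_int A_ge0 k0A m tt0.
  by exists C.
have LS M : L (S M) eta = \sum_(m < M) exp_term (shift_seq (u ^~ eta)) t m.
  exact: (LDelta_iterate_sum d_gt0 a_ge0 phi_ge0 a_meas phi_meas a_even phi_even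
    a_int phi_int A_ge0 k0A M (fun m => t ^+ m / m`!%:R) eta).
set Y := 2 * al * #|` eta|%:R * expR (c * expR (- theta)) * (X * expR (- theta) ^+ #|` eta|).
have close M : `|L (evolution t) eta - \sum_(m < M) exp_term (shift_seq (u ^~ eta)) t m|
    <= Y / M.+1%:R.
  pose D xi := evolution t xi - S M xi.
  have tD : tempered theta (X / M.+1%:R) D.
    by split; [exact: measurable_funB|exact: tail].
  have D0 : 0 <= X / M.+1%:R by rewrite divr_ge0.
  have [_ [C' C'0 [_ SC']]] := LDelta_sum d_gt0 a_ge0 phi_ge0 a_meas phi_meas a_even
    phi_even a_int phi_int M (fun m => t ^+ m / m`!%:R) eta
    (fun m => (tC m).1) (fun m => (tC m).2).
  have -> : evolution t = (fun xi => 1 * D xi + S M xi).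
    by apply/funext => xi; rewrite mul1r subrK.
  rewrite (LDelta_linear d_gt0 a_ge0 phi_ge0 a_meas phi_meas a_even phi_even
    a_int phi_int (expR_ge0 _) D0 C'0 tD.1 (mS M) tD.2 SC').
  rewrite LS mul1r addrK.
  apply: le_trans (tempered_LDelta_le d_gt0 a_ge0 phi_ge0 a_meas phi_meas a_even
    phi_even a_int phi_int eta D0 tD) _.
  by rewrite /Y le_eqVlt; apply/orP; left; apply/eqP; ring.
have cv := @is_cvg_evolution_rate t eta tr.
apply/eqP; rewrite -subr_eq0 -normr_le0.
have cvY : (fun M => Y * M.+1%:R^-1) @ \oo --> Y * 0.
  by apply: cvgMr; exact: cvg_harmonic.
rewrite -(mulr0 Y).
have cvD : (fun M => `|L (evolution t) eta -
    series (exp_term (shift_seq (u ^~ eta)) t) M|) @ \oo -->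
    `|L (evolution t) eta - evolution_rate t eta|.
  by apply: cvg_norm; apply: cvgB cv; exact: cvg_cst.
apply: ler_cvg_to cvD cvY _; apply: nearW => M.
by apply: le_trans (close M); rewrite /series /= big_mkord.
Qed.

End level.
End evolution.

(** * Uniqueness *)

Section dini.
Context (R : realType).

(* For fixed eps, psi s = phi s + 2 eps (b - s) has no minimum on [x, b[, so
   that its minimum is at b. *)
Lemma dini_nonincreasing (phi : R -> R) (a b : R) : a < b ->
  {within `[a, b], continuous phi} ->
  (forall s e, a < s < b -> 0 < e -> exists2 del, 0 < del &
     forall h, 0 < h < del -> phi (s + h) <= phi s + e * h) ->
  phi b <= phi a.
Proof.
move=> ab cphi dphi.
have key x e : a < x < b -> 0 < e -> phi b <= phi x + 2 * e * (b - x).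
  move=> /andP[ax xb] e0; pose psi s := phi s + 2 * e * (b - s).
  have cpsi : {within `[x, b], continuous psi}.
    apply: (@continuous_subspaceW _ _ _ `[a, b]).
      by apply: subset_itvr; rewrite bnd_simp ltW.
    have cl : continuous (fun s : R => 2 * e * (b - s)).
      by move=> s; apply: cvgM; [exact: cvg_cst|apply: cvgB; [exact: cvg_cst|exact: cvg_id]].
    move=> s; apply: (@cvgD _ _ _ _ _ phi (fun s => 2 * e * (b - s))).
    - exact: nbhs_subspace_filter.
    - exact: (cphi s).
    - exact: (continuous_subspaceT cl).
  have [m] := EVT_min (ltW xb) cpsi.
  rewrite in_itv /= => /andP[xm mb] min_m.
  (* A minimum before [b] is impossible: a small step h to the right lowers [psi] by at least e
     h. *)
  have mE : m = b.
    apply/eqP; rewrite eq_le mb leNgt; apply/negP => mltb.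
    have amb : a < m < b by rewrite mltb andbT (lt_le_trans ax).
    have [del del0 hdel] := dphi m e amb e0.
    pose h := Num.min (del / 2) (b - m).
    have h0 : 0 < h by rewrite lt_min divr_gt0// subr_gt0.
    have hd : h < del by rewrite gt_min ltr_pdivrMr// ltr_pMr// ltr1n.
    have hb : h <= b - m by rewrite ge_min lexx orbT.
    have := min_m (m + h); rewrite in_itv /= => /(_ _) => H.
    have {}H : psi m <= psi (m + h) by apply: H; apply/andP; split; lra.
    have := hdel h; rewrite h0 hd => /(_ isT).
    have := mulr_gt0 e0 h0; rewrite /psi in H; lra.
  have := min_m x; rewrite in_itv /= lexx ltW// => /(_ isT).
  by rewrite mE /psi subrr mulr0 addr0.
have keyx x : a < x < b -> phi b <= phi x.
  move=> axb; have /andP[_ xb] := axb.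
  apply/ler_addgt0Pr => e e0.
  have bx0 : 0 < b - x by rewrite subr_gt0.
  have := key x (e / (2 * (b - x))) axb.
  rewrite divr_gt0 ?mulr_gt0// => /(_ isT) /le_trans; apply.
  by rewrite lerD2l le_eqVlt; apply/orP; left; apply/eqP; field; rewrite gt_eqF.
(* The derivative bound is assumed inside the interval only; the endpoint [a] is reached by
   continuity. *)
have := (continuous_within_itvP _ ab).1 cphi => -[_ phia _].
apply: (cvgr_to_ge phia); near=> x; apply: keyx; apply/andP; split.
  by near: x; exact: nbhs_right_gt.
by near: x; exact: nbhs_right_lt.
Unshelve. all: by end_near. Qed.

End dini.

Section seminorms.
Context (R : realType) (d : nat).
Hypothesis d_gt0 : (0 < d)%N.
Local Notation E := (Eucl R d).
Local Notation config := (Gamma0 R d).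
Implicit Types (k : config -> R) (theta C : R).

Lemma Kspace_knormE theta k : Kspace theta k ->
  knorm theta k = (fine (knorm theta k))%:E.
Proof.
by move=> [_ kfin]; rewrite fineK// ge0_fin_numE// knorm_ge0.
Qed.

Lemma fine_knorm_ge0 theta k : 0 <= fine (knorm theta k).
Proof. by rewrite fine_ge0// knorm_ge0. Qed.

Lemma Kspace_ae_le theta k n : Kspace theta k ->
  {ae lebdn R d n, forall t : n.-tuple E,
    `|k (config_of t)| <= fine (knorm theta k) * expR (- theta) ^+ n}.
Proof.
move=> Kk; move: n; apply/(knorm_leP _ _ (fine_knorm_ge0 theta k)).
by rewrite {1}(Kspace_knormE Kk).
Qed.

Lemma fine_nu_le n k C : 0 <= C ->
  {ae lebdn R d n, forall t : n.-tuple E, `|k (config_of t)| <= C} ->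
  fine (nu n k) <= C.
Proof.
move=> C0 /(nu_leP n k C0) h.
have n0 : (0 <= nu n k)%E by rewrite /nu Lnorm_ge0.
by rewrite -lee_fin fineK// ge0_fin_numE//; exact: le_lt_trans h (ltry _).
Qed.

Lemma fine_nu_ge0 n k : 0 <= fine (nu n k).
Proof. by rewrite fine_ge0// /nu Lnorm_ge0. Qed.

Lemma ae_le_fine_nu theta n k : Kspace theta k ->
  {ae lebdn R d n, forall t : n.-tuple E, `|k (config_of t)| <= fine (nu n k)}.
Proof.
move=> Kk; apply/(nu_leP n k (fine_nu_ge0 n k)).
have C0 : 0 <= fine (knorm theta k) * expR (- theta) ^+ n.
  by rewrite mulr_ge0 ?exprn_ge0 ?expR_ge0 ?fine_knorm_ge0.
have h := (nu_leP n k C0).2 (Kspace_ae_le n Kk).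
have n0 : (0 <= nu n k)%E by rewrite /nu Lnorm_ge0.
by rewrite fineK// ge0_fin_numE//; exact: le_lt_trans h (ltry _).
Qed.

Lemma fine_nu_sub theta n k1 k2 e : 0 <= e -> Kspace theta k2 ->
  (knorm theta (k1 \- k2)%R <= e%:E)%E ->
  fine (nu n k1) <= fine (nu n k2) + e * expR (- theta) ^+ n.
Proof.
move=> e0 K2 /(knorm_leP _ _ e0) /(_ n) h.
have q0 : 0 <= e * expR (- theta) ^+ n by rewrite mulr_ge0 ?exprn_ge0 ?expR_ge0.
apply: fine_nu_le; first by rewrite addr_ge0// fine_nu_ge0.
move: (ae_le_fine_nu n K2) h; apply: filterS2 => t h2 h12.
apply: le_trans (lerD h2 h12); apply: le_trans (ler_normD _ _).
by rewrite /= addrC subrK.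
Qed.

Lemma fine_knorm_le theta k C : 0 <= C -> (knorm theta k <= C%:E)%E ->
  fine (knorm theta k) <= C.
Proof.
move=> C0 h; rewrite -lee_fin fineK// ge0_fin_numE ?knorm_ge0//.
exact: le_lt_trans h (ltry _).
Qed.

Lemma knorm_triangle theta k1 k2 k3 C1 C2 : 0 <= C1 -> 0 <= C2 ->
  (forall eta, `|k3 eta| <= `|k1 eta| + `|k2 eta|) ->
  (knorm theta k1 <= C1%:E)%E -> (knorm theta k2 <= C2%:E)%E ->
  (knorm theta k3 <= (C1 + C2)%:E)%E.
Proof.
move=> C10 C20 k123 /(knorm_leP _ _ C10) h1 /(knorm_leP _ _ C20) h2.
apply/knorm_leP => [|n]; first exact: addr_ge0.
move: (h1 n) (h2 n); apply: filterS2 => t t1 t2.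
by rewrite mulrDl; apply: le_trans (k123 _) (lerD t1 t2).
Qed.

Lemma fine_knorm_sub theta k1 k2 e : 0 <= e -> Kspace theta k2 ->
  (knorm theta (k1 \- k2)%R <= e%:E)%E ->
  fine (knorm theta k1) <= fine (knorm theta k2) + e.
Proof.
move=> e0 K2 h; apply: fine_knorm_le.
  by rewrite addr_ge0// fine_knorm_ge0.
apply: (knorm_triangle (k1 := k2) (k2 := k1 \- k2)) => //.
- exact: fine_knorm_ge0.
- move=> eta; apply: le_trans (ler_normD _ _).
  by rewrite /= addrC subrK.
- by rewrite {1}(Kspace_knormE K2).
Qed.

Lemma knorm_subC theta k1 k2 : knorm theta (k1 \- k2)%R = knorm theta (k2 \- k1)%R.
Proof.
have nuC n : nu n (k1 \- k2)%R = nu n (k2 \- k1)%R.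
  rewrite /nu -Lnorm_abse -[RHS]Lnorm_abse; congr Lnorm.
  by apply/funext => t; rewrite /= /kn /= distrC.
rewrite /knorm; congr (ereal_sup (image _ _)).
by apply/funext => n; rewrite nuC.
Qed.

Lemma Kspace_sub theta k1 k2 : Kspace theta k1 -> Kspace theta k2 ->
  Kspace theta (k1 \- k2)%R.
Proof.
move=> K1 K2; split; first by apply: measurable_funB; [case: K1|case: K2].
apply: le_lt_trans (ltry (fine (knorm theta k1) + fine (knorm theta k2))).
apply: (knorm_triangle (k1 := k1) (k2 := k2)); rewrite ?fine_knorm_ge0//.
- by move=> eta; exact: ler_normB.
- by rewrite {1}(Kspace_knormE K1).
- by rewrite {1}(Kspace_knormE K2).
Qed.

Lemma within_continuous_lipschitz (f : R -> R) (a b : R) :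
  (forall s e, a <= s <= b -> 0 < e -> exists2 del, 0 < del &
    forall s', a <= s' <= b -> `|s' - s| < del -> `|f s' - f s| <= e) ->
  {within `[a, b], continuous f}.
Proof.
move=> h; apply/subspace_continuousP => s; rewrite /= in_itv /= => sab.
apply/cvgrPdist_le => e e0; have [del del0 hdel] := h s e sab e0.
suff : \forall s' \near s, s' \in `[a, b] -> `|f s - f s'| <= e.
  by apply: filterS => s' hs' ab; apply: hs'.
have := @nbhsx_ballx _ _ s del del0; apply: filterS => s'.
rewrite /ball /= distrC in_itv /= => sd s'ab.
by rewrite distrC; exact: hdel.
Qed.

End seminorms.

(** * Contraction on a short time interval *)

Section uniqueness.
Context (R : realType) (d : nat).
Hypothesis d_gt0 : (0 < d)%N.
Local Notation E := (Eucl R d).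
Local Notation config := (Gamma0 R d).
Local Notation lambda := (lebesgue_poisson R d).
Local Notation dx := (lebd R d).
Variables a phi : E -> R.
Hypothesis a_ge0 : forall x, 0 <= a x.
Hypothesis phi_ge0 : forall x, 0 <= phi x.
Hypothesis a_meas : measurable_fun setT a.
Hypothesis phi_meas : measurable_fun setT phi.
Hypothesis a_even : forall x, a x = a (Eucl_opp x).
Hypothesis phi_even : forall x, phi x = phi (Eucl_opp x).
Hypothesis a_int : (\int[dx]_x (a x)%:E < +oo)%E.
Hypothesis phi_int : (\int[dx]_x (1 - expR (- phi x))%:E < +oo)%E.

Local Notation al := (alpha a).
Local Notation c := (cphi phi).
Local Notation L := (LDelta a phi).

Hypothesis al_gt0 : 0 < al.
Variables (theta : R) (v w : R -> config -> R).

(** Twice the growth rate of [LDelta] at level theta - 1. The surplus factor 2 is what halves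
    bounds; theta - 1 is the lowest level reached, since a step has K (b - a') <= 1. *)
Let K : R := 4 * al * expR (c * expR (- (theta - 1))).

Let K_gt0 : 0 < K. Proof. by rewrite /K !mulr_gt0// expR_gt0. Qed.

Section one_step.
Variables (a' b : R).
Hypothesis ab : a' < b.
Hypothesis step : K * (b - a') <= 1.
Hypothesis vK : forall s, a' <= s <= b -> Kspace theta (v s).
Hypothesis vC : forall s e : R, a' <= s <= b -> 0 < e -> exists2 del : R, 0 < del &
  forall s', a' <= s' <= b -> `|s' - s| < del ->
    (knorm theta (v s' \- v s)%R <= e%:E)%E.
Hypothesis wM : forall s, a' < s < b -> measurable_fun setT (w s).
Hypothesis vD : forall s e : R, a' < s < b -> 0 < e -> exists2 del : R, 0 < del &
  forall h : R, 0 < h < del ->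
    (knorm theta (fun eta => h^-1 * (v (s + h) eta - v s eta) - w s eta)%R <= e%:E)%E.
Hypothesis wL : forall s, a' < s < b -> {ae lambda, forall eta, w s eta = L (v s) eta}.
Hypothesis va : {ae lambda, forall eta, v a' eta = 0}.

Let f n s := fine (nu n (v s)).
Let N s := fine (knorm theta (v s)).
Let q : R := expR (- theta).

Let m0 : measurable_fun setT ((fun=> 0) : config -> R).
Proof. exact: measurable_cst. Qed.

Let fC n : {within `[a', b], continuous (f n)}.
Proof.
apply: within_continuous_lipschitz => s e sab e0.
have qn0 : 0 < q ^+ n by rewrite exprn_gt0// expR_gt0.
have eq0 : 0 < e / q ^+ n by rewrite divr_gt0.
have [del del0 hdel] := vC sab eq0; exists del => // s' s'ab s's.
have h1 := hdel s' s'ab s's.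
have h2 := h1; rewrite knorm_subC in h2.
have := fine_nu_sub n (ltW eq0) (vK sab) h1.
have := fine_nu_sub n (ltW eq0) (vK s'ab) h2.
rewrite -/q divfK ?gt_eqF// -!/(f n _) => l1 l2.
by rewrite ler_norml; apply/andP; split; lra.
Qed.

Let NC : {within `[a', b], continuous N}.
Proof.
apply: within_continuous_lipschitz => s e sab e0.
have [del del0 hdel] := vC sab e0; exists del => // s' s'ab s's.
have h1 := hdel s' s'ab s's.
have h2 := h1; rewrite knorm_subC in h2.
have := fine_knorm_sub (ltW e0) (vK sab) h1.
have := fine_knorm_sub (ltW e0) (vK s'ab) h2.
rewrite -!/(N _) => l1 l2.
by rewrite ler_norml; apply/andP; split; lra.
Qed.

(* Weight of the level theta - K (s - a'). *)
Let wt n s : R := expR (n%:R * (K * (s - a') - theta)).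

Let wtE n s : wt n s = expR (- (theta - K * (s - a'))) ^+ n.
Proof. by rewrite -expRM_natl opprB. Qed.

Let wt_growth n s h : h * (n%:R * K) * wt n s <= wt n (s + h) - wt n s.
Proof.
have -> : wt n (s + h) = wt n s * expR (h * (n%:R * K)).
  by rewrite /wt -expRD; congr expR; ring.
have := ler_wpM2l (expR_ge0 (n%:R * (K * (s - a') - theta))) (expR_ge1Dx (h * (n%:R * K))).
rewrite -/(wt n s); lra.
Qed.

(** A bound M0 at the moving level bounds [LDelta] of the solution by (M0 / 2) n K times [wt n],
    while (M0 / 2) times [wt n] grows at least at this rate. So [f n] minus half the old bound is
    nonincreasing, and at the left end [f n] vanishes. *)
Lemma one_step_contraction (M0 : R) : 0 <= M0 ->
  (forall s n, a' <= s <= b -> f n s <= M0 * wt n s) ->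
  forall s n, a' <= s <= b -> f n s <= M0 / 2 * wt n s.
Proof.
have aab : a' <= a' <= b by rewrite lexx ltW.
move=> M00 hM s n /andP[]; rewrite le_eqVlt => /predU1P[<- _|as_ sb].
  apply: (@le_trans _ _ 0); last by rewrite mulr_ge0 ?divr_ge0 ?expR_ge0.
  apply: fine_nu_le => //.
  have mva : measurable_fun setT (v a').
    by have [] := vK aab.
  have := (ae_eq_config_of d_gt0 mva m0).1 va n.
  by apply: filterS => t ->; rewrite normr0.
pose psi x := f n x - M0 / 2 * wt n x.
suff : psi s <= psi a'.
  rewrite /psi; have -> : f n a' = 0.
    apply/eqP; rewrite eq_le fine_nu_ge0 andbT; apply: fine_nu_le => //.
    have mva : measurable_fun setT (v a').
      by have [] := vK aab.
    have := (ae_eq_config_of d_gt0 mva m0).1 va n.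
    by apply: filterS => t ->; rewrite normr0.
  have : 0 <= M0 / 2 * wt n a' by rewrite mulr_ge0 ?divr_ge0 ?expR_ge0.
  lra.
apply: dini_nonincreasing => //.
  have cl : continuous (fun x : R => - (M0 / 2 * wt n x)).
    move=> x; apply: cvgN; apply: cvgM; first exact: cvg_cst.
    apply: (continuous_comp (f := fun x : R => n%:R * (K * (x - a') - theta)));
      last exact: continuous_expR.
    apply: cvgM; first exact: cvg_cst.
    apply: cvgB; last exact: cvg_cst.
    apply: cvgM; first exact: cvg_cst.
    by apply: cvgB; [exact: cvg_id|exact: cvg_cst].
  have cf : {within `[a', s], continuous (f n)}.
    apply: (@continuous_subspaceW _ _ _ `[a', b]); last exact: fC.
    by apply: subset_itvl; rewrite bnd_simp.
  move=> x; apply: (@cvgD _ _ _ _ _ (f n) (fun x => - (M0 / 2 * wt n x))).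
  - exact: nbhs_subspace_filter.
  - exact: (cf x).
  - exact: (continuous_subspaceT cl).
move=> x e /andP[ax xs] e0.
have axb : a' < x < b by rewrite ax (lt_le_trans xs).
have axb' : a' <= x <= b by rewrite !ltW// (lt_le_trans xs).
have qn0 : 0 < q ^+ n by rewrite exprn_gt0// expR_gt0.
have eq0 : 0 < e / q ^+ n by rewrite divr_gt0.
have [del del0 hdel] := vD axb eq0.
exists (Num.min del (s - x)); first by rewrite lt_min del0 subr_gt0.
move=> h /andP[h0]; rewrite lt_min => /andP[hd hs].
have wle : {ae lebdn R d n, forall t : n.-tuple E,
    `|w x (config_of t)| <= M0 / 2 * (n%:R * K) * wt n x}.
  pose th := theta - K * (x - a').
  have Kx : K * (x - a') <= 1.
    by apply: le_trans step; apply: ler_wpM2l; [exact: ltW|lra].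
  have vth : (knorm th (v x) <= M0%:E)%E.
    apply/knorm_leP => // m; have := ae_le_fine_nu m (vK axb').
    apply: filterS => t; move=> /le_trans; apply.
    by have := hM x m axb'; rewrite wtE.
  have mv : measurable_fun setT (v x) by have [] := vK axb'.
  (* The operator bound asks for a bound at every configuration. Hence [w x] is traced, up to null
     sets, to [LDelta] of a truncation of [v x] at the current level. *)
  have [kap [mkap tkap] vkap] := truncation d_gt0 M00 mv vth.
  have mL k : measurable_fun setT k -> measurable_fun setT (L k).
    exact: measurable_LDelta.
  have := (ae_eq_config_of d_gt0 (wM axb) (mL _ mv)).1 (wL axb) n.
  have := (ae_eq_config_of d_gt0 (mL _ mv) (mL _ mkap)).1
    (LDelta_ae_eq d_gt0 a_meas phi_meas mv mkap vkap) n.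
  move: (ae_uniq R d_gt0 n); apply: filterS3 => t ut e1 e2.
  rewrite e2 e1.
  have := tempered_LDelta_le d_gt0 a_ge0 phi_ge0 a_meas phi_meas a_even
    phi_even a_int phi_int (config_of t) M00 (conj mkap tkap).
  rewrite card_config_of// -wtE => /le_trans; apply.
  have -> : M0 / 2 * (n%:R * K) * wt n x =
    2 * al * n%:R * expR (c * expR (- (theta - 1))) * (M0 * wt n x).
    by rewrite /K; field.
  apply: ler_wpM2r; first by rewrite mulr_ge0 ?expR_ge0.
  apply: ler_wpM2l; first by rewrite !mulr_ge0// ltW.
  rewrite ler_expR; apply: ler_wpM2l; first exact: cphi_ge0.
  by rewrite ler_expR lerN2 /th; lra.
have xhb : a' <= x + h <= b by apply/andP; split; lra.
have W0 : 0 <= M0 / 2 * (n%:R * K) * wt n x.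
  by rewrite !mulr_ge0 ?expR_ge0 ?invr_ge0// ltW.
have fxh : f n (x + h) <= f n x + h * (M0 / 2 * (n%:R * K) * wt n x + e).
  apply: fine_nu_le.
    by rewrite addr_ge0 ?fine_nu_ge0// mulr_ge0 ?ltW// ltr_wpDl.
  have := hdel h; rewrite h0 hd => /(_ isT) /(knorm_leP _ _ (ltW eq0)) /(_ n).
  rewrite -/q divfK ?gt_eqF//.
  move: wle (ae_le_fine_nu n (vK axb')); apply: filterS3 => t t1 t2 t3.
  have -> : v (x + h) (config_of t) = v x (config_of t) + h * (w x (config_of t) +
      (h^-1 * (v (x + h) (config_of t) - v x (config_of t)) - w x (config_of t))).
    by field; rewrite gt_eqF.
  apply: le_trans (ler_normD _ _) _; apply: lerD => //.
  rewrite normrM (ger0_norm (ltW h0)); apply: ler_wpM2l; first exact: ltW.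
  by apply: le_trans (ler_normD _ _) _; exact: lerD.
have := wt_growth n x h; rewrite /psi.
have M20 : 0 <= M0 / 2 by rewrite divr_ge0.
move=> /(ler_wpM2l M20); lra.
Qed.

Lemma one_step_uniqueness : {ae lambda, forall eta, v b eta = 0}.
Proof.
(* Continuity on a compact interval supplies a first finite bound, which the contraction then halves
   indefinitely. *)
have [m] := EVT_max (ltW ab) NC; rewrite in_itv /= => mab Nmax.
pose M0 := N m; have M00 : 0 <= M0 by exact: fine_knorm_ge0.
have claim j : forall s n, a' <= s <= b -> f n s <= M0 / 2 ^+ j * wt n s.
  elim: j => [s n sab|j IH].
    rewrite expr0 divr1; apply: (@le_trans _ _ (N s * q ^+ n)).
      apply: fine_nu_le; first by rewrite mulr_ge0 ?exprn_ge0 ?expR_ge0 ?fine_knorm_ge0.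
      exact: Kspace_ae_le (vK sab).
    apply: ler_pM; rewrite ?fine_knorm_ge0 ?exprn_ge0 ?expR_ge0//.
      by apply: Nmax; rewrite in_itv.
    rewrite wtE lerXn2r ?nnegrE ?expR_ge0// ler_expR lerN2 gerBl.
    by apply: mulr_ge0; [exact: ltW|rewrite subr_ge0; case/andP: sab].
  move=> s n sab; rewrite exprSr invfM mulrA.
  by apply: one_step_contraction => //; rewrite divr_ge0 ?exprn_ge0.
have bab : a' <= b <= b by rewrite lexx ltW.
have mvb : measurable_fun setT (v b) by have [] := vK bab.
apply/(ae_eq_config_of d_gt0 mvb m0) => n.
have fb : f n b <= 0.
  have cv : (fun j => M0 * wt n b * (2^-1) ^+ j) @ \oo --> M0 * wt n b * 0.
    apply: cvgMr; apply: cvg_expr; rewrite ger0_norm ?invr_ge0//.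
    by rewrite invf_lt1// ltr1n.
  rewrite -(mulr0 (M0 * wt n b)); apply: (cvgr_to_ge cv); apply: nearW => j.
  by have := claim j b n bab; rewrite exprVn mulrAC.
have := ae_le_fine_nu n (vK bab); apply: filterS => t.
move=> /le_trans/(_ fb); rewrite normr_le0 => /eqP; exact.
Qed.

End one_step.
End uniqueness.

Section epsilon_delta.
Context (R : realType) (d : nat).
Local Notation config := (Gamma0 R d).

Lemma Kcontinuous_atP (theta : R) (I : set R) (k : R -> config -> R) (t : R) :
  Kcontinuous_at theta I k t <-> forall e : R, 0 < e -> exists2 del : R, 0 < del &
    forall s : R, I s -> `|s - t| < del -> (knorm theta (k s \- k t)%R <= e%:E)%E.
Proof.
rewrite /Kcontinuous_at cvge0P; last by move=> s; exact: knorm_ge0.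
split => h e e0; have := h e e0.
  move=> /nbhs_ballP[del /= del0 hdel]; exists del => // s Is st.
  by apply: hdel => //; rewrite /ball /= distrC.
move=> [del del0 hdel]; apply/nbhs_ballP; exists del => //= s st Is.
by apply: hdel => //; rewrite distrC.
Qed.

Lemma Kderivative_atP (theta : R) (k : R -> config -> R) (t : R) l :
  Kderivative_at theta k t l <-> forall e : R, 0 < e -> exists2 del : R, 0 < del &
    forall h : R, h != 0 -> `|h| < del ->
    (knorm theta (fun eta => h^-1 * (k (t + h) eta - k t eta) - l eta)%R <= e%:E)%E.
Proof.
rewrite /Kderivative_at cvge0P; last by move=> s; exact: knorm_ge0.
split => H e e0; have := H e e0.
  move=> /nbhs_ballP[del /= del0 hdel]; exists del => // h h0 hd.
  by apply: hdel => //; rewrite /ball /= sub0r normrN.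
move=> [del del0 hdel]; apply/nbhs_ballP; exists del => //= h; rewrite /ball /= sub0r normrN.
by move=> hd h0; apply: hdel.
Qed.

End epsilon_delta.

Section segment.
Context (R : realType) (d : nat).
Hypothesis d_gt0 : (0 < d)%N.
Local Notation E := (Eucl R d).
Local Notation config := (Gamma0 R d).
Local Notation lambda := (lebesgue_poisson R d).
Local Notation dx := (lebd R d).
Variables a phi : E -> R.
Hypothesis a_ge0 : forall x, 0 <= a x.
Hypothesis phi_ge0 : forall x, 0 <= phi x.
Hypothesis a_meas : measurable_fun setT a.
Hypothesis phi_meas : measurable_fun setT phi.
Hypothesis a_even : forall x, a x = a (Eucl_opp x).
Hypothesis phi_even : forall x, phi x = phi (Eucl_opp x).
Hypothesis a_int : (\int[dx]_x (a x)%:E < +oo)%E.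
Hypothesis phi_int : (\int[dx]_x (1 - expR (- phi x))%:E < +oo)%E.

Local Notation al := (alpha a).
Local Notation c := (cphi phi).
Local Notation L := (LDelta a phi).

Hypothesis al_gt0 : 0 < al.

(** Linearity needs pointwise growth bounds; [k1] acquires one by truncation, at the price of a null
    set. *)
Lemma LDelta_sub_ae (theta C : R) k1 k2 : Kspace theta k1 -> 0 <= C ->
  tempered theta C k2 ->
  {ae lambda, forall eta, L (k1 \- k2) eta = L k1 eta - L k2 eta}.
Proof.
move=> K1 C0 [m2 k2C]; have m1 := K1.1.
have [C1 [k1' [C10 [m1' k1C] k11']]] := Kspace_truncation d_gt0 K1.
have mS : measurable_fun setT (k1 \- k2) by exact: measurable_funB.
have mS' : measurable_fun setT (k1' \- k2) by exact: measurable_funB.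
have eqS : {ae lambda, forall eta, (k1 \- k2) eta = (k1' \- k2) eta}.
  by move: k11'; apply: filterS => eta /= ->.
move: (LDelta_ae_eq d_gt0 a_meas phi_meas mS mS' eqS)
  (LDelta_ae_eq d_gt0 a_meas phi_meas m1 m1' k11').
apply: filterS2 => eta -> ->.
have -> : (k1' \- k2) = (fun xi => -1 * k2 xi + k1' xi).
  by apply/funext => xi /=; rewrite mulN1r addrC.
rewrite (LDelta_linear d_gt0 a_ge0 phi_ge0 a_meas phi_meas a_even phi_even
  a_int phi_int (expR_ge0 _) C0 C10 m2 m1' k2C k1C).
by rewrite mulN1r addrC.
Qed.

(** The step length 1/K depends on [theta] alone, and the level may restart at [theta] in each step
    because [v] stays in K_theta. So finitely many steps cover the segment. *)
Lemma segment_uniqueness (theta t : R) (v w : R -> config -> R) : 0 <= t ->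
  (forall s, 0 <= s <= t -> Kspace theta (v s)) ->
  (forall s e : R, 0 <= s <= t -> 0 < e -> exists2 del : R, 0 < del &
    forall s', 0 <= s' <= t -> `|s' - s| < del ->
    (knorm theta (v s' \- v s)%R <= e%:E)%E) ->
  (forall s, 0 < s < t -> measurable_fun setT (w s)) ->
  (forall s e : R, 0 < s < t -> 0 < e -> exists2 del : R, 0 < del &
    forall h : R, 0 < h < del ->
    (knorm theta (fun eta => h^-1 * (v (s + h) eta - v s eta) - w s eta)%R <= e%:E)%E) ->
  (forall s, 0 < s < t -> {ae lambda, forall eta, w s eta = L (v s) eta}) ->
  {ae lambda, forall eta, v 0 eta = 0} ->
  {ae lambda, forall eta, v t eta = 0}.
Proof.
move=> t0 vK vC wM vD wL v0.
pose K : R := 4 * al * expR (c * expR (- (theta - 1))).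
have K0 : 0 < K by rewrite /K !mulr_gt0// expR_gt0.
have claim j : forall s, 0 <= s <= t -> s * K <= j%:R ->
    {ae lambda, forall eta, v s eta = 0}.
  elim: j => [s /andP[s0 _]|j IH s /andP[s0 st] sj].
    rewrite pmulr_lle0// => s0'.
    by have -> : s = 0 by apply/eqP; rewrite eq_le s0 s0'.
  have [sj'|js] := leP (s * K) j%:R; first by apply: IH => //; rewrite s0 st.
  have a0 : 0 <= j%:R / K by rewrite divr_ge0// ltW.
  have as_ : j%:R / K < s by rewrite ltr_pdivrMr.
  apply: (one_step_uniqueness d_gt0 a_ge0 phi_ge0 a_meas phi_meas a_even phi_even
    a_int phi_int al_gt0 (theta := theta) (v := v) (w := w) (a' := j%:R / K)) => //.
  - rewrite -/K mulrBr [K * (j%:R / K)]mulrC divfK ?gt_eqF//.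
    by move: sj; rewrite -natr1 mulrC; lra.
  - by move=> x /andP[x0 xs]; apply: vK; apply/andP; split; lra.
  - move=> x e /andP[x0 xs] e0.
    have xt : 0 <= x <= t by apply/andP; split; lra.
    have [del del0 hdel] := vC x e xt e0; exists del => // s' /andP[s'0 s's].
    by apply: hdel; apply/andP; split; lra.
  - by move=> x /andP[x0 xs]; apply: wM; apply/andP; split; lra.
  - by move=> x e /andP[x0 xs]; apply: vD; apply/andP; split; lra.
  - by move=> x /andP[x0 xs]; apply: wL; apply/andP; split; lra.
  apply: IH; last by rewrite divfK ?gt_eqF.
  by apply/andP; split; lra.
apply: (claim (Num.truncn (t * K)).+1); first by rewrite t0 lexx.
by rewrite ltW// truncnS_gt.
Qed.

End segment.

(** * The solution on the scale of spaces *)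

Section existence.
Context (R : realType) (d : nat).
Hypothesis d_gt0 : (0 < d)%N.
Local Notation E := (Eucl R d).
Local Notation config := (Gamma0 R d).
Local Notation lambda := (lebesgue_poisson R d).
Local Notation dx := (lebd R d).
Variables a phi : E -> R.
Hypothesis a_ge0 : forall x, 0 <= a x.
Hypothesis phi_ge0 : forall x, 0 <= phi x.
Hypothesis a_meas : measurable_fun setT a.
Hypothesis phi_meas : measurable_fun setT phi.
Hypothesis a_even : forall x, a x = a (Eucl_opp x).
Hypothesis phi_even : forall x, phi x = phi (Eucl_opp x).
Hypothesis a_int : (\int[dx]_x (a x)%:E < +oo)%E.
Hypothesis phi_int : (\int[dx]_x (1 - expR (- phi x))%:E < +oo)%E.

Local Notation al := (alpha a).
Local Notation c := (cphi phi).
Local Notation L := (LDelta a phi).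

Hypothesis al_gt0 : 0 < al.
Variables (theta0 A : R) (k0 : config -> R).
Hypothesis A_ge0 : 0 <= A.
Hypothesis k0A : tempered theta0 A k0.

Local Notation T := (Ttime al c theta0).
Local Notation k := (evolution a phi k0).
Local Notation k' := (evolution_rate a phi k0).

Lemma exp_sum0 (v : nat -> R) : exp_sum v 0 = v 0%N.
Proof.
apply: cvg_lim => //; apply: cvg_near_cst.
exists 1%N => // -[//|n] _; rewrite /series /= big_mkord big_ord_recl big1 ?addr0.
  by rewrite /exp_term expr0 invr1 !mul1r.
by move=> i _; rewrite /exp_term expr0n /= !mul0r.
Qed.

Let estimates (theta r : R) (tt0 : theta < theta0) (r0 : 0 < r) (rT : r < T theta) :=
  evolution_estimates d_gt0 a_ge0 phi_ge0 a_meas phi_meas a_even phi_even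
    a_int phi_int al_gt0 A_ge0 k0A tt0 r0 rT.

Lemma evolution_tempered (theta t : R) : theta < theta0 -> 0 <= t < T theta ->
  tempered theta A (k t).
Proof.
move=> tt0 /andP[t0 tT].
have r0 : 0 < (t + T theta) / 2 by lra.
have rT : (t + T theta) / 2 < T theta by lra.
apply: (evolution_le d_gt0 a_ge0 phi_ge0 a_meas phi_meas a_even phi_even
    a_int phi_int al_gt0 A_ge0 k0A tt0 r0 rT).
by apply/andP; split; lra.
Qed.

Lemma evolution_LDelta (theta t : R) : theta < theta0 -> 0 <= t < T theta ->
  L (k t) = k' t.
Proof.
move=> tt0 /andP[t0 tT].
have r0 : 0 < (t + T theta) / 2 by lra.
have rT : (t + T theta) / 2 < T theta by lra.
apply: (LDelta_evolution d_gt0 a_ge0 phi_ge0 a_meas phi_meas a_even phi_even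
    a_int phi_int al_gt0 A_ge0 k0A tt0 r0 rT).
by apply/andP; split; lra.
Qed.

Lemma evolution_local (theta t : R) : theta < theta0 -> 0 <= t < T theta ->
  exists X del : R, [/\ 0 <= X, 0 < del & forall s : R, 0 <= s -> `|s - t| < del ->
  [/\ forall eta, `|k s eta - k t eta - (s - t) * k' t eta|
        <= X * (s - t) ^+ 2 * expR (- theta) ^+ #|` eta|,
      forall eta, `|k' s eta - k' t eta| <= X * `|s - t| * expR (- theta) ^+ #|` eta| &
      forall eta, `|k' t eta| <= X * expR (- theta) ^+ #|` eta|]].
Proof.
move=> tt0 /andP[t0 tT].
(* The midpoint leaves room to the right of [t] for the nearby times [s]. *)
have r0 : 0 < (t + T theta) / 2 by lra.
have rT : (t + T theta) / 2 < T theta by lra.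
have [X X0 hX] := estimates tt0 r0 rT.
exists X, ((T theta - t) / 2); split => //; first by lra.
move=> s s0; rewrite ltr_norml => /andP[_ st].
have sr : 0 <= s <= (t + T theta) / 2 by apply/andP; split; lra.
have tr : 0 <= t <= (t + T theta) / 2 by apply/andP; split; lra.
by have [h1 h2 h3 _] := hX s t sr tr.
Qed.

Lemma Kspace_evolution_rate (theta t : R) : theta < theta0 -> 0 <= t < T theta ->
  Kspace theta (k' t).
Proof.
move=> tt0 tT; have [X [del [X0 del0 /(_ t)]]] := evolution_local tt0 tT.
have /andP[t0 _] := tT.
rewrite subrr normr0 => /(_ t0 del0) [_ _ h].
apply: (tempered_Kspace d_gt0 X0); split => //.
rewrite -(evolution_LDelta tt0 tT); apply: measurable_LDelta => //.
by have [] := evolution_tempered tt0 tT.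
Qed.

Lemma Kcontinuous_evolution (theta t : R) : theta < theta0 -> 0 <= t < T theta ->
  Kcontinuous_at theta `[0, T theta[%classic k t.
Proof.
move=> tt0 tT; apply/Kcontinuous_atP => e e0.
have [X [del [X0 del0 h]]] := evolution_local tt0 tT.
have X1 : 0 < 2 * X + 1 by lra.
(* For |s - t| < 1 the Taylor bound is at most 2 X |s - t|; the added 1 keeps the divisor
   positive. *)
exists (Num.min del (Num.min 1 (e / (2 * X + 1)))).
  by rewrite !lt_min del0 ltr01 divr_gt0.
move=> s; rewrite /= in_itv /= => /andP[s0 _].
rewrite !lt_min => /and3P[st st1]; rewrite ltr_pdivlMr// => ste.
have [h1 _ h3] := h s s0 st.
apply: (pointwise_knorm_le d_gt0 (ltW e0)) => eta; rewrite /=.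
have q0 : 0 <= expR (- theta) ^+ #|` eta| by rewrite exprn_ge0// expR_ge0.
have -> : k s eta - k t eta = (k s eta - k t eta - (s - t) * k' t eta) +
  (s - t) * k' t eta by rewrite subrK.
apply: le_trans (ler_normD _ _) _; rewrite normrM.
apply: le_trans (lerD (h1 eta) (ler_wpM2l (normr_ge0 _) (h3 eta))) _.
rewrite [X in X <= _](_ : _ = (X * (s - t) ^+ 2 + `|s - t| * X) *
  expR (- theta) ^+ #|` eta|); last by ring.
apply: ler_wpM2r => //.
rewrite -real_normK ?num_real// expr2.
have := normr_ge0 (s - t); move: (`|s - t|) st1 ste => y y1 ye y0.
have : X * (y * y) <= X * y by apply: ler_wpM2l => //; nra.
lra.
Qed.

Lemma Kcontinuous_evolution_rate (theta t : R) (I : set R) :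
  I `<=` [set s | 0 <= s] -> theta < theta0 -> 0 <= t < T theta ->
  Kcontinuous_at theta I k' t.
Proof.
move=> I0 tt0 tT; apply/Kcontinuous_atP => e e0.
have [X [del [X0 del0 h]]] := evolution_local tt0 tT.
have X1 : 0 < X + 1 by lra.
exists (Num.min del (e / (X + 1))); first by rewrite lt_min del0 divr_gt0.
move=> s /I0 /= s0; rewrite lt_min => /andP[st]; rewrite ltr_pdivlMr// => ste.
have [_ h2 _] := h s s0 st.
apply: (pointwise_knorm_le d_gt0 (ltW e0)) => eta; rewrite /=.
apply: le_trans (h2 eta) _; apply: ler_wpM2r; first by rewrite exprn_ge0// expR_ge0.
by have := normr_ge0 (s - t); lra.
Qed.

Lemma Kderivative_evolution (theta t : R) : theta < theta0 -> 0 < t < T theta ->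
  Kderivative_at theta k t (k' t).
Proof.
move=> tt0 /andP[t0 tT]; apply/Kderivative_atP => e e0.
have tT' : 0 <= t < T theta by rewrite ltW.
have [X [del [X0 del0 h]]] := evolution_local tt0 tT'.
have X1 : 0 < X + 1 by lra.
(* The bound by [t] keeps t + y nonnegative, where the series is controlled. *)
exists (Num.min t (Num.min del (e / (X + 1)))).
  by rewrite !lt_min t0 del0 divr_gt0.
move=> y y0; rewrite !lt_min => /and3P[yt yd]; rewrite ltr_pdivlMr// => ye.
have ty0 : 0 <= t + y by move: yt; rewrite ltr_norml => /andP[]; lra.
have [] := h (t + y) ty0; first by rewrite addrAC subrr add0r.
rewrite [t + y - t]addrAC subrr add0r => h1 _ _.
apply: (pointwise_knorm_le d_gt0 (ltW e0)) => eta.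
have -> : y^-1 * (k (t + y) eta - k t eta) - k' t eta =
    y^-1 * (k (t + y) eta - k t eta - y * k' t eta) by field.
have yn0 : 0 < `|y| by rewrite normr_gt0.
rewrite normrM normfV ler_pdivrMl//; apply: le_trans (h1 eta) _.
rewrite [leRHS]mulrA; apply: ler_wpM2r; first by rewrite exprn_ge0// expR_ge0.
rewrite -real_normK ?num_real// expr2.
have : `|y| * (X * `|y|) <= `|y| * e by apply: ler_wpM2l => //; lra.
lra.
Qed.

(** [k1] is the prescribed initial value and [k0] its bounded representative, from which the series
    is built. *)
Lemma classical_evolution (theta : R) (k1 : config -> R) : theta < theta0 ->
  {ae lambda, forall eta, k0 eta = k1 eta} ->
  classical_solution a phi theta `[0, T theta[%classic k1 k.
Proof.
move=> tt0 k01; set I := `[0, T theta[%classic.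
have inI t : I t -> 0 <= t < T theta by rewrite /I /= in_itv.
have intI t : I° t -> 0 < t < T theta.
  move=> It; have /inI/andP[t0 ->] := interior_subset It; rewrite andbT.
  move: It => /nbhs_ballP[e /= e0 he].
  have : I (t - e / 2).
    by apply: he; rewrite /ball /= opprB addrC subrK ger0_norm ?ltr_pdivrMr ?ltr_pMr ?ltr1n ?divr_ge0// ltW.
  by move=> /inI/andP[h _]; lra.
split.
- move=> t /inI tT; split; first exact: (tempered_Kspace d_gt0 A_ge0 (evolution_tempered tt0 tT)).
  by rewrite (evolution_LDelta tt0 tT); exact: Kspace_evolution_rate.
- by move=> t /inI tT; exact: Kcontinuous_evolution.
- exists k'; split => t /intI/andP[t0 tT].
  + by apply: Kspace_evolution_rate => //; rewrite ltW.
  + by apply: Kderivative_evolution => //; rewrite t0.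
  + apply: Kcontinuous_evolution_rate => //; last by rewrite ltW.
    by move=> s /intI/andP[/ltW].
  + by apply: aeW => eta _; rewrite (evolution_LDelta tt0)// ltW.
- move: k01; apply: filterS => eta e _.
  by rewrite /evolution exp_sum0.
Qed.

End existence.

(** * The limiting level, and uniqueness along the scale *)

Section scale.
Context (R : realType) (d : nat).
Hypothesis d_gt0 : (0 < d)%N.
Local Notation E := (Eucl R d).
Local Notation config := (Gamma0 R d).
Local Notation lambda := (lebesgue_poisson R d).
Local Notation dx := (lebd R d).
Variables a phi : E -> R.
Hypothesis a_ge0 : forall x, 0 <= a x.
Hypothesis phi_ge0 : forall x, 0 <= phi x.
Hypothesis a_meas : measurable_fun setT a.
Hypothesis phi_meas : measurable_fun setT phi.
Hypothesis a_even : forall x, a x = a (Eucl_opp x).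
Hypothesis phi_even : forall x, phi x = phi (Eucl_opp x).
Hypothesis a_int : (\int[dx]_x (a x)%:E < +oo)%E.
Hypothesis phi_int : (\int[dx]_x (1 - expR (- phi x))%:E < +oo)%E.

Local Notation al := (alpha a).
Local Notation c := (cphi phi).
Local Notation L := (LDelta a phi).

Hypothesis al_gt0 : 0 < al.
Variables (theta0 A : R) (k0 : config -> R).
Hypothesis A_ge0 : 0 <= A.
Hypothesis k0A : tempered theta0 A k0.

Local Notation T := (Ttime al c theta0).
Local Notation k := (evolution a phi k0).

Lemma lt_Tstar_level (t : R) : 0 <= t -> (t%:E < Tstar al c theta0)%E ->
  exists2 theta, theta < theta0 & t < T theta.
Proof.
move=> t0 /ereal_sup_gt[_ [theta tt0 <-]]; rewrite lte_fin => tT.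
exists theta => //; rewrite lt_neqAle tt0 andbT; apply: contraTneq tT => ->.
by rewrite /Ttime subrr !mul0r -leNgt.
Qed.

(** The supremum defining the level need not be attained. Levels arbitrarily close below it give
    bounds with the same constant [A], and at each configuration these pass to the limit. *)
Lemma Kspace_theta_of (t : R) : 0 <= t -> (t%:E < Tstar al c theta0)%E ->
  Kspace (theta_of al c theta0 t) (k t).
Proof.
move=> t0 tT.
have level (theta : R) : theta <= theta0 -> t < T theta -> theta < theta0.
  move=> tt0 tTt; rewrite lt_neqAle tt0 andbT; apply: contraTneq tTt => ->.
  by rewrite /Ttime subrr !mul0r -leNgt.
have [th1 tt1 tT1] := lt_Tstar_level t0 tT.
set S := [set theta | theta <= theta0 /\ t < T theta].
have supS : has_sup S.
  by split; [exists th1; split => //; exact: ltW|exists theta0 => th []].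
have tk (th : R) : th < theta0 -> t < T th -> tempered th A (k t).
  move=> h1 h2; apply: (evolution_tempered d_gt0 a_ge0 phi_ge0 a_meas phi_meas a_even
    phi_even a_int phi_int al_gt0 A_ge0 k0A h1).
  by rewrite t0.
apply: (tempered_Kspace d_gt0 A_ge0); split; first by case: (tk _ tt1 tT1).
move=> eta; rewrite /theta_of -/S; set n := #|` eta|.
pose g (e : R) := A * expR (n%:R * (e - sup S)).
have g0 : A * expR (- sup S) ^+ n = g 0 by rewrite /g sub0r expRM_natl.
have gP e : 0 < e -> `|k t eta| <= g e.
  move=> e0; have [th [tht0 tTth] sth] := sup_adherent e0 supS.
  apply: le_trans ((tk th (level _ tht0 tTth) tTth).2 eta) _.
  apply: ler_wpM2l => //; rewrite -expRM_natl ler_expR ler_wpM2l//; lra.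
rewrite g0.
have gc : g e @[e --> 0^'+] --> g 0.
  apply: cvg_at_right_filter; apply: cvgM; first exact: cvg_cst.
  apply: (continuous_comp (f := fun e : R => n%:R * (e - sup S)));
    last exact: continuous_expR.
  apply: cvgM; first exact: cvg_cst.
  by apply: cvgB; [exact: cvg_id|exact: cvg_cst].
apply: (cvgr_to_ge gc); near=> e; apply: gP.
by near: e; exact: nbhs_right_gt.
Unshelve. all: by end_near. Qed.

(** A competitor is compared with the constructed solution, which is tempered, so that
    [LDelta_sub_ae] splits the operator on the difference. *)
Lemma classical_solution_unique (theta t : R) (k1 : config -> R)
    (k2 : R -> config -> R) : theta < theta0 -> 0 <= t < T theta ->
  {ae lambda, forall eta, k0 eta = k1 eta} -> measurable_fun setT k1 ->
  classical_solution a phi theta `[0, T theta[%classic k1 k2 ->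
  {ae lambda, forall eta, k2 t eta = k t eta}.
Proof.
move=> tt0 /andP[t0 tT] k01 mk1 [dom2 cont2 [k2' [K2' D2 _ E2]] init2].
have [_ cont1 _ _] := classical_evolution d_gt0 a_ge0 phi_ge0 a_meas phi_meas a_even
  phi_even a_int phi_int al_gt0 A_ge0 k0A tt0 k01.
set I := `[0, T theta[%classic in dom2 cont2 K2' D2 E2 cont1.
have inI s : 0 <= s <= t -> I s.
  by move=> /andP[s0 st]; rewrite /I /= in_itv /= s0 (le_lt_trans st).
have inI' s : 0 < s < t -> I° s.
  move=> /andP[s0 st]; have : s \in `]0, T theta[ by rewrite in_itv /= s0 (lt_trans st).
  move=> /near_in_itvoo; apply: filterS => x; rewrite /I /= !in_itv /=.
  by move=> /andP[/ltW -> ->].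
have tempk s : 0 <= s <= t -> tempered theta A (k s).
  move=> /andP[s0 st]; apply: (evolution_tempered d_gt0 a_ge0 phi_ge0 a_meas phi_meas
    a_even phi_even a_int phi_int al_gt0 A_ge0 k0A tt0).
  by rewrite s0 (le_lt_trans st).
have ltT s : 0 < s < t -> 0 < s < T theta by move=> /andP[-> /lt_trans ->].
pose v s := (k2 s \- k s)%R.
pose w s := (k2' s \- evolution_rate a phi k0 s)%R.
have vK s : 0 <= s <= t -> Kspace theta (v s).
  move=> st; apply: Kspace_sub; first by have [] := dom2 s (inI s st).
  exact: (tempered_Kspace d_gt0 A_ge0 (tempk s st)).
have half (e : R) : 0 < e -> 0 < e / 2 by move=> e0; rewrite divr_gt0.
suff : {ae lambda, forall eta, v t eta = 0}.
  by apply: filterS => eta /eqP; rewrite /v /= subr_eq0 => /eqP.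
apply: (segment_uniqueness d_gt0 a_ge0 phi_ge0 a_meas phi_meas a_even phi_even
  a_int phi_int al_gt0 (theta := theta) (w := w) t0 vK).
- move=> s e st e0.
  have /Kcontinuous_atP/(_ _ (half _ e0))[d1 d10 h1] := cont2 s (inI s st).
  have /Kcontinuous_atP/(_ _ (half _ e0))[d2 d20 h2] := cont1 s (inI s st).
  exists (Num.min d1 d2); first by rewrite lt_min d10.
  move=> s' s't; rewrite lt_min => /andP[sd1 sd2].
  rewrite [e]splitr; apply: (knorm_triangle _ _ _ (h1 s' (inI s' s't) sd1)
    (h2 s' (inI s' s't) sd2)); rewrite ?ltW ?half//.
  move=> eta; apply: le_trans (ler_normB _ _); rewrite /v /= opprD opprK.
  by rewrite le_eqVlt; apply/orP; left; apply/eqP; congr (`| _ |); ring.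
- move=> s st; apply: measurable_funB; first by have [] := K2' s (inI' s st).
  have sT : 0 <= s < T theta by case/andP: (ltT s st) => /ltW ->.
  by case: (Kspace_evolution_rate d_gt0 a_ge0 phi_ge0 a_meas phi_meas a_even
    phi_even a_int phi_int al_gt0 A_ge0 k0A tt0 sT).
- move=> s e st e0.
  have /Kderivative_atP/(_ _ (half _ e0))[d1 d10 h1] := D2 s (inI' s st).
  have /Kderivative_atP/(_ _ (half _ e0))[d2 d20 h2] :=
    Kderivative_evolution d_gt0 a_ge0 phi_ge0 a_meas phi_meas a_even
    phi_even a_int phi_int al_gt0 A_ge0 k0A tt0 (ltT s st).
  exists (Num.min d1 d2); first by rewrite lt_min d10.
  move=> h /andP[h0]; rewrite lt_min => /andP[hd1 hd2].
  have hn0 : h != 0 by rewrite gt_eqF.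
  rewrite -(ger0_norm (ltW h0)) in hd1 hd2.
  rewrite [e]splitr; apply: (knorm_triangle _ _ _ (h1 h hn0 hd1) (h2 h hn0 hd2));
    rewrite ?ltW ?half//.
  move=> eta; apply: le_trans (ler_normB _ _); rewrite /v /w /=.
  by rewrite le_eqVlt; apply/orP; left; apply/eqP; congr (`| _ |); ring.
- move=> s st; have st' : 0 <= s <= t by case/andP: st => /ltW -> /ltW ->.
  have sT : 0 <= s < T theta by case/andP: (ltT s st) => /ltW ->.
  have [K2s _] := dom2 s (inI s st').
  move: (E2 s (inI' s st)) (LDelta_sub_ae d_gt0 a_ge0 phi_ge0 a_meas phi_meas a_even
    phi_even a_int phi_int K2s A_ge0 (tempk s st')).
  apply: filterS2 => eta /(_ Logic.I) e1 e2; rewrite /w /= e2 e1.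
  by rewrite (evolution_LDelta d_gt0 a_ge0 phi_ge0 a_meas phi_meas a_even
    phi_even a_int phi_int al_gt0 A_ge0 k0A tt0 sT).
- move: init2 k01; apply: filterS2 => eta /(_ Logic.I) e1 e2.
  by rewrite /v /= e1 -e2 /evolution exp_sum0 subrr.
Qed.

End scale.

Theorem theorem3p2 (R : realType) (d : nat) (a phi : Eucl R d -> R)
    (d_gt0 : (0 < d)%N)
    (a_ge0 : forall x, 0 <= a x) (phi_ge0 : forall x, 0 <= phi x)
    (a_meas : measurable_fun setT a) (phi_meas : measurable_fun setT phi)
    (a_even : forall x, a x = a (Eucl_opp x))
    (phi_even : forall x, phi x = phi (Eucl_opp x))
    (a_int : (0 < \int[lebd R d]_x (a x)%:E < +oo)%E)
    (phi_int : (\int[lebd R d]_x (1 - expR (- phi x))%:E < +oo)%E)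
    (theta0 : R) :
  (0 < Tstar (alpha a) (cphi phi) theta0)%E /\
  forall k0 : Gamma0 R d -> R, Kspace theta0 k0 ->
    exists k : R -> Gamma0 R d -> R,
      scale_solution a phi theta0 k0 k /\
      forall k' : R -> Gamma0 R d -> R, scale_solution a phi theta0 k0 k' ->
        forall t, 0 <= t -> (t%:E < Tstar (alpha a) (cphi phi) theta0)%E ->
          k' t = k t %[ae lebesgue_poisson R d].
Proof.
have /andP[a_pos a_fin] := a_int.
have al_gt0 : 0 < alpha a by rewrite -lte_fin -integral_aE.
split.
  have T0 : 0 < Ttime (alpha a) (cphi phi) theta0 (theta0 - 1).
    by apply: Ttime_gt0 => //; lra.
  apply: (@lt_le_trans _ _ (Ttime (alpha a) (cphi phi) theta0 (theta0 - 1))%:E).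
    by rewrite lte_fin.
  by apply: ereal_sup_ubound; exists (theta0 - 1) => //=; lra.
move=> k0 Kk0.
have [A [kt [A0 tkt k0kt]]] := Kspace_truncation d_gt0 Kk0.
have ktk0 : {ae lebesgue_poisson R d, forall eta, kt eta = k0 eta}.
  by move: k0kt; apply: filterS => eta ->.
exists (evolution a phi kt); split.
  split => [t t0 tT|theta tt0].
    exact: (Kspace_theta_of d_gt0 a_ge0 phi_ge0 a_meas phi_meas a_even phi_even
      a_fin phi_int al_gt0 A0 tkt).
  exact: (classical_evolution d_gt0 a_ge0 phi_ge0 a_meas phi_meas a_even phi_even
      a_fin phi_int al_gt0 A0 tkt).
move=> k' [_ sol'] t t0 tT.
(* A single level whose lifetime exceeds [t] decides the equality at time [t]. *)
have [theta tt0 tTt] := lt_Tstar_level t0 tT.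
have t0T : 0 <= t < Ttime (alpha a) (cphi phi) theta0 theta by rewrite t0.
have := classical_solution_unique d_gt0 a_ge0 phi_ge0 a_meas phi_meas a_even phi_even
  a_fin phi_int al_gt0 A0 tkt tt0 t0T ktk0 Kk0.1 (sol' theta tt0).
by apply: filterS => eta e _.
Qed.
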